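(* Let $n$ be a non-negative integer, and let $m$ and $l$ be complex numbers for which the integral on the left side below converges. Then $$ \int_{0}^{\infty}\frac{x^{l-1}}{(1+x)^{m+1}}\log^{n}(1+x)\, dx =(-1)^{n}\,P_{n}(s_1,s_2,\ldots,s_n)\cdot\frac{\Gamma(m+1-l)\,\Gamma(l)}{\Gamma(m+1)}, $$ where $$ s_1=\psi(m+1-l)-\psi(m+1),\qquad s_j=\zeta(j,m+1)-\zeta(j,m+1-l)\quad (2\le j\le n), $$ and where, at those $(l,m)$ at which some factor or term on the right side has a pole (that is, $l$ or $m+1$ is a non-positive integer), the right side is understood as its limiting value, taken along nearby points $(l',m')\to(l,m)$ at which all terms are defined.
   Context: $\Gamma$ is the gamma function and $\psi(s)=\Gamma'(s)/\Gamma(s)$ is the digamma function. $\zeta(j,a)$ is the Hurwitz zeta function; for integers $j\ge 2$ and complex $a\notin\{0,-1,-2,\ldots\}$ it is $\zeta(j,a)=\sum_{k=0}^{\infty}\frac{1}{(k+a)^{j}}$. For $x>0$, $\log(1+x)$ is the real natural logarithm, $\log^n(1+x)=(\log(1+x))^n$, and complex powers are $x^{l-1}=e^{(l-1)\log x}$, $(1+x)^{m+1}=e^{(m+1)\log(1+x)}$ with real logarithms. The polynomials $P_n(s_1,\ldots,s_n)$ are defined by $P_0=1$ and, for $n\ge 1$, $$P_{n}(s_{1},\ldots,s_{n})=(-1)^{n}\,Y_{n}(-s_{1},-s_{2},-2s_{3},\ldots,-(n-1)!\,s_{n}),$$ i.e. the $j$-th argument of $Y_n$ is $-(j-1)!\,s_j$.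 Here $Y_n$ is the (complete exponential) Bell polynomial, determined by $\exp\left(\sum_{j\ge1} x_j\frac{t^j}{j!}\right)=\sum_{n\ge 0}Y_n(x_1,\ldots,x_n)\frac{t^n}{n!}$. The first few are $P_1=s_1$, $P_2=s_1^2-s_2$, $P_3=s_1^3-3s_1s_2+2s_3$, $P_4=s_1^4-6s_1^2s_2+8s_1s_3+3s_2^2-6s_4$. *)

(* Defs.v *)
From Stdlib Require Import Reals ZArith Arith.
From Coquelicot Require Import Coquelicot.
Open Scope R_scope.

Definition Cexp (z : C) : C := (exp (Re z) * cos (Im z), exp (Re z) * sin (Im z)).

(* [x] to the complex power [z], meaningful for [0 < x]. *)
Definition Rpow_C (x : R) (z : C) : C := Cexp (z * RtoC (ln x))%C.

(* Improper Riemann integral over (0, +oo), the two end points tending to 0+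
   and +oo independently. *)
Definition converges_0_infty (f : R -> C) : Prop :=
  ex_RInt_gen (V := C_R_NormedModule) f (at_right 0) (Rbar_locally p_infty).

Definition integral_0_infty (f : R -> C) : C :=
  RInt_gen (V := C_R_CompleteNormedModule) f (at_right 0) (Rbar_locally p_infty).

Definition nonpos_integer (z : C) : Prop := exists k : nat, z = RtoC (- INR k).

(* Euler's integral, convergent for [0 < Re z]. *)
Definition Gamma_integral (z : C) : C :=
  integral_0_infty (fun t => (Rpow_C t (z - 1) * RtoC (exp (- t)))%C).

Fixpoint rising (z : C) (k : nat) : C :=
  match k with
  | O => 1%C
  | S k' => (rising z k' * (z + RtoC (INR k')))%C
  end.

(* Since [up r] is the integer with [r < up r <= r + 1], the shift [k] is 0 when
   [0 < Re z] and otherwise the least one with [0 < Re z + k]; the functional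
   equation then continues Euler's integral to C minus the non-positive
   integers. *)
Definition Gamma (z : C) : C :=
  let k := Z.to_nat (up (- Re z)) in
  (Gamma_integral (z + RtoC (INR k)) / rising z k)%C.

Definition digamma (z : C) : C := (C_derive Gamma z / Gamma z)%C.

Definition Hurwitz_zeta (j : nat) (a : C) : C :=
  iota (T := C_CompleteNormedModule)
    (fun v => is_series (V := C_NormedModule)
                (fun k : nat => (1 / (RtoC (INR k) + a) ^ j)%C) v).

(* Formal power series over C, given by their coefficient sequences. *)
Definition fps_mul (a b : nat -> C) (n : nat) : C :=
  sum_n (G := C_AbelianMonoid) (fun i => (a i * b (n - i)%nat)%C) n.

Fixpoint fps_pow (a : nat -> C) (k : nat) : nat -> C :=
  match k with
  | O => fun n => match n with O => 1%C | S _ => 0%C end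
  | S k' => fps_mul a (fps_pow a k')
  end.

(* exp(a) = sum_k a^k / k! for a series [a] without constant term; then [a^k]
   has no coefficient of degree [n < k], so the sum stops at [k = n]. *)
Definition fps_exp (a : nat -> C) (n : nat) : C :=
  sum_n (G := C_AbelianMonoid)
    (fun k => (fps_pow a k n / RtoC (INR (fact k)))%C) n.

(* Complete exponential Bell polynomial Y_n(x_1, ..., x_n), with [x j] for x_j;
   [x 0] is ignored. *)
Definition Bell (n : nat) (x : nat -> C) : C :=
  (RtoC (INR (fact n)) *
   fps_exp (fun j => match j with
                     | O => 0%C
                     | S _ => (x j / RtoC (INR (fact j)))%C
                     end) n)%C.

Definition P (n : nat) (s : nat -> C) : C :=
  ((-1) ^ n * Bell n (fun j => - (RtoC (INR (fact (j - 1))) * s j))%C)%C.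

(* Only the values at [1 <= j] matter. *)
Definition s_arg (l m : C) (j : nat) : C :=
  if Nat.eqb j 1
  then (digamma (m + 1 - l) - digamma (m + 1))%C
  else (Hurwitz_zeta j (m + 1) - Hurwitz_zeta j (m + 1 - l))%C.

Definition log_beta_integrand (n : nat) (l m : C) (x : R) : C :=
  (Rpow_C x (l - 1) / Rpow_C (1 + x) (m + 1) * RtoC (ln (1 + x) ^ n))%C.

Definition log_beta_rhs (n : nat) (l m : C) : C :=
  ((-1) ^ n * P n (s_arg l m) *
   (Gamma (m + 1 - l) * Gamma l / Gamma (m + 1)))%C.

Definition rhs_defined (l m : C) : Prop :=
  ~ nonpos_integer l /\ ~ nonpos_integer (m + 1)%C /\
  ~ nonpos_integer (m + 1 - l)%C.

(* Main.v *)
(** Write [I_n(l, m)] for the integral, [a = m + 1 - l] and [w = m + 1].  It converges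
    exactly for [0 < Re l + n] and [0 < Re a].  Integration by parts gives
    [l I_n(l, m) = w I_n(l+1, m+1) - n I_(n-1)(l+1, m+1)], and a splitting of the
    integrand then gives a recurrence from [m] to [m + 1].  Since [N^l I_n(l, m + N)]
    tends to [Gamma(l)] for [n = 0] and to 0 for [n > 0], the case [n = 0] of the latter
    yields Gauss's product for [Gamma] and the beta integral.

    For [0 < Re l], let [M(t) = sum_n I_n t^n / (n! I_0)] and
    [T(t) = exp (- sum_j s_j t^j / j)].  Both satisfy
    [(1 - t/w) f_(m+1)(t) = (1 - t/a) f_m(t)], because [zeta(j, z)] and [psi(z)] change
    by [z^-j] and [1/z] when [z] grows by 1, and both tend to 1 along [m + N]; hence they
    are equal.  The only derivative needed is [I_1 = - dI_0/dm], which gives [s_1].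
    Integration by parts continues the formula to [0 < Re l + n], one unit of [Re l] at a
    time.  At the poles the right side equals the integral at the nearby points, and the
    integral is continuous in [(l, m)]. *)

Require Import Defs.
From Stdlib Require Import Reals Lra Lia Psatz ZArith Arith.
From Coquelicot Require Import Coquelicot.
Open Scope R_scope.

(** * The complex exponential and derivatives of complex-valued functions *)


(** All the analysis rests on the weights [x^(e-1) / (1 + x^e)^2], whose primitive is elementary and
    whose total mass is [1 / e]. An integrand below [K * weight e] is integrable with integral at
    most [K / e], so every passage to the limit under the integral sign (differentiation, continuity
    in the parameters, [N] to infinity) becomes a pointwise bound with an explicit small factor,
    [r^2], [r] or [1 / N]. Differentiating the beta integral [n] times would demand the higher
    derivatives of [psi] and their identification with zeta values. Comparing two generating series
    along [m + N] avoids this: the zeta series enters only through its shift and its vanishing tail.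
    The price is a division by [I_0], hence a proof that Gamma has no zero in the right half-plane.
    The only hypothesis is convergence, so conditional convergence through oscillating complex
    powers must be excluded before the half-plane conditions are available. It cannot occur because
    the phase is linear in [ln x] and [ln (1 + x)] and turns too slowly. *)

Lemma exp_le (x y : R) : x <= y -> exp x <= exp y.
Proof. intros [H | ->]; [apply Rlt_le, exp_increasing, H | apply Rle_refl]. Qed.

Lemma Cexp_plus (z w : C) : Cexp (z + w) = (Cexp z * Cexp w)%C.
Proof.
unfold Cexp, Cmult, Re, Im; simpl. rewrite exp_plus, cos_plus, sin_plus.
apply injective_projections; simpl; ring.
Qed.

Lemma Cexp_RtoC (x : R) : Cexp (RtoC x) = RtoC (exp x).
Proof.
unfold Cexp, RtoC; simpl. rewrite cos_0, sin_0.
apply injective_projections; simpl; ring.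
Qed.

Lemma Cexp_0 : Cexp 0 = 1.
Proof. rewrite Cexp_RtoC, exp_0; reflexivity. Qed.

Lemma Cmod_Cexp (z : C) : Cmod (Cexp z) = exp (Re z).
Proof.
unfold Cmod, Cexp; simpl.
replace (_ + _) with (exp (Re z) * exp (Re z) *
  (Rsqr (sin (Im z)) + Rsqr (cos (Im z)))) by (unfold Rsqr; ring).
rewrite sin2_cos2, Rmult_1_r. apply sqrt_square, Rlt_le, exp_pos.
Qed.

Lemma Cexp_neq_0 (z : C) : Cexp z <> 0.
Proof.
apply Cmod_gt_0. rewrite Cmod_Cexp. apply exp_pos.
Qed.

Lemma Cexp_opp (z : C) : Cexp (- z) = (/ Cexp z)%C.
Proof.
assert (H := Cexp_neq_0 z).
assert (E : (Cexp (- z) * Cexp z)%C = 1).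
{ rewrite <- Cexp_plus. replace (- z + z)%C with (RtoC 0) by ring. apply Cexp_0. }
transitivity (Cexp (- z) * Cexp z * / Cexp z)%C; [field; exact H |].
rewrite E; ring.
Qed.

(** Componentwise, so that the real mean value theorem and the real fundamental theorem of calculus
    apply to each part. *)
Definition has_deriv (F : R -> C) (x : R) (l : C) : Prop :=
  is_derive (fun t => Re (F t)) x (Re l) /\ is_derive (fun t => Im (F t)) x (Im l).

Definition continuous_C (f : R -> C) (x : R) : Prop :=
  continuous (fun t => Re (f t)) x /\ continuous (fun t => Im (f t)) x.

Lemma has_deriv_eq F x l l' : has_deriv F x l -> l = l' -> has_deriv F x l'.
Proof. intros H <-; exact H. Qed.

Lemma has_deriv_ext_loc F G x l :
  locally x (fun t => F t = G t) -> has_deriv F x l -> has_deriv G x l.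
Proof.
intros H [A B]; split; eapply is_derive_ext_loc; try eassumption;
 (eapply filter_imp; [|exact H]; intros t Ht; simpl; rewrite Ht; reflexivity).
Qed.

Lemma continuous_C_ext_loc f g x :
  locally x (fun t => f t = g t) -> continuous_C f x -> continuous_C g x.
Proof.
intros H [A B]; split.
- apply (continuous_ext_loc (fun t => Re (g t)) (fun t => Re (f t)) x); trivial.
  eapply filter_imp; [|exact H]; intros t Ht; rewrite Ht; reflexivity.
- apply (continuous_ext_loc (fun t => Im (g t)) (fun t => Im (f t)) x); trivial.
  eapply filter_imp; [|exact H]; intros t Ht; rewrite Ht; reflexivity.
Qed.

Lemma has_deriv_continuous_C F x l : has_deriv F x l -> continuous_C F x.
Proof.
intros [A B]; split.
- apply (ex_derive_continuous (K := R_AbsRing) (V := R_NormedModule)). exists (Re l); exact A.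
- apply (ex_derive_continuous (K := R_AbsRing) (V := R_NormedModule)). exists (Im l); exact B.
Qed.

Lemma has_deriv_const c x : has_deriv (fun _ => c) x 0.
Proof. split; simpl; apply @is_derive_const. Qed.

Lemma has_deriv_plus F G x l m : has_deriv F x l -> has_deriv G x m -> has_deriv (fun t => F t + G t)%C x (l + m)%C.
Proof.
intros [A B] [A' B']; split; simpl.
- apply (is_derive_plus (K := R_AbsRing) (V := R_NormedModule) _ _ _ _ _ A A').
- apply (is_derive_plus (K := R_AbsRing) (V := R_NormedModule) _ _ _ _ _ B B').
Qed.

Lemma has_deriv_mult F G x l m : has_deriv F x l -> has_deriv G x m ->
  has_deriv (fun t => F t * G t)%C x (l * G x + F x * m)%C.
Proof.
intros [A B] [A' B']; split; simpl.
- evar_last.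
  apply (is_derive_minus (K := R_AbsRing) (V := R_NormedModule)).
  apply (is_derive_mult _ _ _ _ _ A A' Rmult_comm).
  apply (is_derive_mult _ _ _ _ _ B B' Rmult_comm).
  unfold minus, plus, opp, mult; simpl. unfold Re, Im. ring.
- evar_last.
  apply (is_derive_plus (K := R_AbsRing) (V := R_NormedModule)).
  apply (is_derive_mult _ _ _ _ _ A B' Rmult_comm).
  apply (is_derive_mult _ _ _ _ _ B A' Rmult_comm).
  unfold minus, plus, opp, mult; simpl. unfold Re, Im. ring.
Qed.

Lemma has_deriv_RtoC (g : R -> R) x l : is_derive g x l -> has_deriv (fun t => RtoC (g t)) x (RtoC l).
Proof.
intros H; split; simpl; [exact H | apply @is_derive_const].
Qed.

Lemma has_deriv_Cexp F x l : has_deriv F x l -> has_deriv (fun t => Cexp (F t)) x (l * Cexp (F x))%C.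
Proof.
intros [A B]. 
assert (E := is_derive_comp exp (fun t => Re (F t)) x _ _ (is_derive_exp _) A).
assert (Cc := is_derive_comp cos (fun t => Im (F t)) x _ _ (is_derive_cos _) B).
assert (S := is_derive_comp sin (fun t => Im (F t)) x _ _ (is_derive_sin _) B).
split; simpl.
- evar_last.
  apply (is_derive_mult _ _ _ _ _ E Cc Rmult_comm).
  unfold plus, mult, scal; simpl; unfold mult; simpl. unfold Re, Im. ring.
- evar_last.
  apply (is_derive_mult _ _ _ _ _ E S Rmult_comm).
  unfold plus, mult, scal; simpl; unfold mult; simpl. unfold Re, Im. ring.
Qed.

Lemma has_deriv_comp_R F (g : R -> R) x l m :
  has_deriv F (g x) l -> is_derive g x m -> has_deriv (fun t => F (g t)) x (RtoC m * l)%C.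
Proof.
intros [A B] H; split; simpl.
- evar_last. apply (is_derive_comp (fun t => Re (F t)) g x _ _ A H).
  unfold scal; simpl; unfold mult; simpl. unfold Re, Im. ring.
- evar_last. apply (is_derive_comp (fun t => Im (F t)) g x _ _ B H).
  unfold scal; simpl; unfold mult; simpl. unfold Re, Im. ring.
Qed.

Lemma continuous_C_plus f g x : continuous_C f x -> continuous_C g x -> continuous_C (fun t => f t + g t)%C x.
Proof.
intros [A B] [A' B']; split; simpl.
- apply (continuous_plus (K := R_AbsRing) (V := R_NormedModule) _ _ _ A A').
- apply (continuous_plus (K := R_AbsRing) (V := R_NormedModule) _ _ _ B B').
Qed.

Lemma continuous_C_mult f g x : continuous_C f x -> continuous_C g x -> continuous_C (fun t => f t * g t)%C x.
Proof.
intros [A B] [A' B']; split; simpl.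
- apply (continuous_minus (K := R_AbsRing) (V := R_NormedModule)).
  apply (continuous_mult (K := R_AbsRing) _ _ _ A A').
  apply (continuous_mult (K := R_AbsRing) _ _ _ B B').
- apply (continuous_plus (K := R_AbsRing) (V := R_NormedModule)).
  apply (continuous_mult (K := R_AbsRing) _ _ _ A B').
  apply (continuous_mult (K := R_AbsRing) _ _ _ B A').
Qed.

Lemma continuous_C_const c x : continuous_C (fun _ => c) x.
Proof. exact (has_deriv_continuous_C _ _ _ (has_deriv_const c x)). Qed.

Lemma continuous_C_comp_R f (g : R -> R) x :
  continuous_C f (g x) -> continuous g x -> continuous_C (fun t => f (g t)) x.
Proof.
intros [A B] H; split.
- apply (continuous_comp g (fun t => Re (f t)) x H A).
- apply (continuous_comp g (fun t => Im (f t)) x H B).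
Qed.

Lemma derive_nonpos_decr (h h' : R -> R) a b : a <= b ->
  (forall t, a <= t <= b -> is_derive h t (h' t)) ->
  (forall t, a <= t <= b -> h' t <= 0) -> h b <= h a.
Proof.
intros Hab D N.
destruct (MVT_gen h a b h') as [c [Hc E]].
- intros t Ht. apply D. rewrite Rmin_left, Rmax_right in Ht by lra. lra.
- intros t Ht. rewrite Rmin_left, Rmax_right in Ht by lra.
  apply continuity_pt_filterlim, (ex_derive_continuous (K := R_AbsRing) (V := R_NormedModule)). exists (h' t). apply D; lra.
- rewrite Rmin_left, Rmax_right in Hc by lra.
  assert (Hn := N c Hc). nra.
Qed.

(* Apply the real mean value theorem to the projection of [F] on the direction
   of [F b - F a]. *)
Lemma Cmod_increment_le (F f : R -> C) (G g : R -> R) a b : a <= b ->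
  (forall t, a <= t <= b -> has_deriv F t (f t)) ->
  (forall t, a <= t <= b -> is_derive G t (g t)) ->
  (forall t, a <= t <= b -> Cmod (f t) <= g t) ->
  Cmod (F b - F a) <= G b - G a.
Proof.
intros Hab DF DG Hfg.
set (w := (F b - F a)%C).
destruct (Req_dec (Cmod w) 0) as [Z|NZ].
- rewrite Z.
  assert (- G b <= - G a); [|lra].
  apply (derive_nonpos_decr (fun t => - G t) (fun t => - g t) a b Hab).
  + intros t Ht. apply (is_derive_opp (K := R_AbsRing) (V := R_NormedModule)).
    apply DG, Ht.
  + intros t Ht. assert (H := Hfg t Ht). assert (H' := Cmod_ge_0 (f t)). lra.
- assert (Hp : 0 < Cmod w) by (assert (H := Cmod_ge_0 w); lra).
  assert (K : Re (Cconj w * F b) - Cmod w * G b <= Re (Cconj w * F a) - Cmod w * G a).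
  { apply (derive_nonpos_decr (fun t => Re (Cconj w * F t) - Cmod w * G t)
      (fun t => Re (Cconj w * f t) - Cmod w * g t) a b Hab).
    - intros t Ht.
      apply (is_derive_minus (K := R_AbsRing) (V := R_NormedModule)).
      + destruct (has_deriv_mult _ _ _ _ _ (has_deriv_const (Cconj w) t) (DF t Ht)) as [A _].
        evar_last; [exact A|]. f_equal. ring.
      + evar_last.
        apply (is_derive_scal G t (Cmod w) _ (DG t Ht)). reflexivity.
    - intros t Ht. assert (H := Hfg t Ht).
      assert (H1 := re_le_Cmod (Cconj w * f t)).
      rewrite Cmod_mult, Cmod_conj in H1.
      assert (H2 := Rle_abs (Re (Cconj w * f t))).
      assert (Cmod w * Cmod (f t) <= Cmod w * g t) by (apply Rmult_le_compat_l; lra).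
      lra. }
  assert (E : Re (Cconj w * F b) - Re (Cconj w * F a) = Cmod w * Cmod w).
  { transitivity (Cmod w ^ 2); [|ring]. rewrite Cmod2_alt.
    unfold w, Cconj, Re, Im; simpl. ring. }
  nra.
Qed.

Lemma Re_le_Cmod (w : C) : Re w <= Cmod w.
Proof. assert (H := re_le_Cmod w). assert (H' := Rle_abs (Re w)). lra. Qed.

Lemma has_deriv_line w t : has_deriv (fun t => RtoC t * w)%C t w.
Proof.
eapply has_deriv_eq.
apply has_deriv_mult. apply has_deriv_RtoC, @is_derive_id. apply has_deriv_const.
unfold one; simpl. ring.
Qed.

Lemma Cmod_Cexp_line_le (w : C) t : 0 <= t <= 1 ->
  Cmod (Cexp (RtoC t * w)) <= exp (Cmod w).
Proof.
intros Ht. rewrite Cmod_Cexp. apply exp_le.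
assert (H := Re_le_Cmod w). assert (H' := Cmod_ge_0 w).
simpl. unfold Re in *. nra.
Qed.

(** Mean value inequality along the segment [t w] with [t] in [[0, 1]], on which the derivative
    [w Cexp (t w)] has modulus at most [|w| exp |w|]. *)
Lemma Cexp_minus_1_le (w : C) : Cmod (Cexp w - 1) <= Cmod w * exp (Cmod w).
Proof.
replace (Cmod w * exp (Cmod w)) with
  (Cmod w * exp (Cmod w) * 1 - Cmod w * exp (Cmod w) * 0) by ring.
replace (Cexp w - 1)%C with (Cexp (RtoC 1 * w) - Cexp (RtoC 0 * w))%C.
2:{ rewrite Cmult_0_l, Cexp_0, Cmult_1_l. reflexivity. }
apply (Cmod_increment_le (fun t => Cexp (RtoC t * w)) (fun t => w * Cexp (RtoC t * w))%C
  (fun t => Cmod w * exp (Cmod w) * t) (fun t => Cmod w * exp (Cmod w)) 0 1).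
- lra.
- intros t _. apply (has_deriv_Cexp (fun t => RtoC t * w)%C). apply has_deriv_line.
- intros t _. auto_derive; trivial; ring.
- intros t Ht. rewrite Cmod_mult. apply Rmult_le_compat_l. apply Cmod_ge_0.
  apply Cmod_Cexp_line_le, Ht.
Qed.

(** Mean value inequality once more: the derivative of [Cexp (t w) - t w] is [w (Cexp (t w) - 1)],
    and the first-order bound applies to the second factor. *)
Lemma Cexp_taylor_1_le (w : C) : Cmod (Cexp w - 1 - w) <= Cmod w ^ 2 * exp (Cmod w).
Proof.
set (K := Cmod w ^ 2 * exp (Cmod w)).
replace K with (K * 1 - K * 0) by ring.
replace (Cexp w - 1 - w)%C with
  ((Cexp (RtoC 1 * w) - RtoC 1 * w) - (Cexp (RtoC 0 * w) - RtoC 0 * w))%C.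
2:{ rewrite !Cmult_0_l, Cexp_0, Cmult_1_l. ring. }
apply (Cmod_increment_le (fun t => Cexp (RtoC t * w) - RtoC t * w)%C
  (fun t => w * (Cexp (RtoC t * w) - 1))%C
  (fun t => K * t) (fun t => K) 0 1).
- lra.
- intros t _. eapply has_deriv_eq. apply has_deriv_plus. apply has_deriv_Cexp, has_deriv_line.
  apply (has_deriv_ext_loc (fun t => RtoC t * (- w))%C).
  { apply filter_forall. intros s; ring. }
  apply has_deriv_line. simpl; ring.
- intros t _. auto_derive; trivial; ring.
- intros t Ht. rewrite Cmod_mult. unfold K.
  assert (H := Cexp_minus_1_le (RtoC t * w)).
  assert (Ew : Cmod (RtoC t * w) <= Cmod w).
  { rewrite Cmod_mult, Cmod_R, Rabs_pos_eq by lra. assert (H' := Cmod_ge_0 w). nra. }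
  assert (E2 : exp (Cmod (RtoC t * w)) <= exp (Cmod w)) by (apply exp_le; exact Ew).
  assert (Cmod (RtoC t * w) * exp (Cmod (RtoC t * w)) <= Cmod w * exp (Cmod w)).
  { apply Rmult_le_compat; trivial. apply Cmod_ge_0. apply Rlt_le, exp_pos. }
  assert (H' := Cmod_ge_0 w). 
  replace (Cmod w ^ 2 * exp (Cmod w)) with (Cmod w * (Cmod w * exp (Cmod w))) by ring.
  apply Rmult_le_compat_l; lra.
Qed.

(** * Convergence and improper integrals *)


Definition tends {T : Type} (F : (T -> Prop) -> Prop) (f : T -> C) (l : C) : Prop :=
  forall eps, 0 < eps -> F (fun x => Cmod (f x - l) < eps).

(** The balls of [C_UniformSpace] are squares while [tends] uses discs; passing from the square to
    the disc costs the factor [sqrt 2]. *)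
Lemma tends_locally {T} (F : (T -> Prop) -> Prop) {FF : Filter F} (f : T -> C) l :
  tends F f l <-> filterlim f F (locally (T := C_UniformSpace) l).
Proof.
split.
- intros H Q [d Hd]. unfold filtermap.
  eapply filter_imp; [|apply (H d), cond_pos].
  intros x Hx. apply Hd. apply C_NormedModule_mixin_compat1. exact Hx.
- intros H eps He.
  assert (Hs : 0 < sqrt 2) by (apply sqrt_lt_R0; lra).
  assert (Hd : 0 < eps / sqrt 2) by (apply Rdiv_lt_0_compat; trivial).
  apply (H (fun y : C => Cmod (y - l) < eps)).
  exists (mkposreal _ Hd). intros y Hy.
  assert (K := C_NormedModule_mixin_compat2 _ _ _ Hy). simpl in K.
  replace (sqrt 2 * (eps / sqrt 2)) with eps in K by (field; lra). exact K.
Qed.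

Lemma tends_unique {T} (F : (T -> Prop) -> Prop) {FF : ProperFilter F} (f : T -> C) l l' :
  tends F f l -> tends F f l' -> l = l'.
Proof.
intros H H'.
destruct (Req_dec (Cmod (l - l')) 0) as [Z|NZ].
- apply Cmod_eq_0 in Z. replace l with (l - l' + l')%C by ring. rewrite Z. ring.
- assert (Hp : 0 < Cmod (l - l') / 2) by (assert (K := Cmod_ge_0 (l - l')); lra).
  destruct (filter_ex _ (filter_and _ _ (H _ Hp) (H' _ Hp))) as [x [A B]].
  assert (K := Cmod_triangle (- (f x - l)) (f x - l')).
  rewrite Cmod_opp in K.
  replace (- (f x - l) + (f x - l'))%C with (l - l')%C in K by ring. lra.
Qed.

Lemma tends_ext_loc {T} (F : (T -> Prop) -> Prop) {FF : Filter F} (f g : T -> C) l :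
  F (fun x => f x = g x) -> tends F f l -> tends F g l.
Proof.
intros H Hf eps He. eapply filter_imp; [|apply (filter_and _ _ H (Hf eps He))].
intros x [E K]. simpl in *. rewrite <- E. exact K.
Qed.

Lemma tends_ext {T} (F : (T -> Prop) -> Prop) {FF : Filter F} (f g : T -> C) l :
  (forall x, f x = g x) -> tends F f l -> tends F g l.
Proof. intros H. apply tends_ext_loc; trivial. apply filter_forall; trivial. Qed.

Lemma tends_const {T} (F : (T -> Prop) -> Prop) {FF : Filter F} (c : C) :
  tends F (fun _ => c) c.
Proof.
intros eps He. apply filter_forall. intros _.
replace (c - c)%C with (RtoC 0) by ring. rewrite Cmod_0. exact He.
Qed.

Lemma tends_plus {T} (F : (T -> Prop) -> Prop) {FF : Filter F} (f g : T -> C) l m :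
  tends F f l -> tends F g m -> tends F (fun x => f x + g x)%C (l + m)%C.
Proof.
intros H K eps He.
assert (He2 : 0 < eps / 2) by lra.
eapply filter_imp; [|apply (filter_and _ _ (H _ He2) (K _ He2))].
intros x [A B]. simpl in *.
assert (L := Cmod_triangle (f x - l) (g x - m)).
replace (f x + g x - (l + m))%C with (f x - l + (g x - m))%C by ring. lra.
Qed.

Lemma tends_mult {T} (F : (T -> Prop) -> Prop) {FF : Filter F} (f g : T -> C) l m :
  tends F f l -> tends F g m -> tends F (fun x => f x * g x)%C (l * m)%C.
Proof.
intros H K eps He.
set (M := Cmod l + Cmod m + 1).
assert (Hl := Cmod_ge_0 l). assert (Hm := Cmod_ge_0 m).
assert (HM : 0 < M) by (unfold M; lra).
set (d := Rmin 1 (eps / (2 * M))).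
assert (Hd : 0 < d).
{ apply Rmin_pos; [lra|]. apply Rdiv_lt_0_compat; lra. }
assert (Hd1 : d <= 1) by apply Rmin_l.
assert (Hd2 : d * M <= eps / 2).
{ apply Rle_trans with (eps / (2 * M) * M).
  apply Rmult_le_compat_r; [lra | apply Rmin_r]. right. field. lra. }
eapply filter_imp; [|apply (filter_and _ _ (H _ Hd) (K _ Hd))].
intros x [A B]. simpl in *.
replace (f x * g x - l * m)%C with ((f x - l) * (g x - m) + (l * (g x - m) + (f x - l) * m))%C by ring.
eapply Rle_lt_trans. apply Cmod_triangle.
eapply Rle_lt_trans. apply Rplus_le_compat_l. apply Cmod_triangle.
rewrite !Cmod_mult.
assert (P1 := Cmod_ge_0 (f x - l)). assert (P2 := Cmod_ge_0 (g x - m)).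
assert (Cmod (f x - l) * Cmod (g x - m) <= d * 1) by (apply Rmult_le_compat; lra).
assert (Cmod l * Cmod (g x - m) <= Cmod l * d) by (apply Rmult_le_compat_l; lra).
assert (Cmod (f x - l) * Cmod m <= d * Cmod m) by (apply Rmult_le_compat_r; lra).
unfold M in Hd2. nra.
Qed.

Lemma tends_scal {T} (F : (T -> Prop) -> Prop) {FF : Filter F} (f : T -> C) c l :
  tends F f l -> tends F (fun x => c * f x)%C (c * l)%C.
Proof. intros H. apply tends_mult; trivial. apply tends_const; trivial. Qed.

Lemma tends_le {T} (F : (T -> Prop) -> Prop) {FF : Filter F} (f : T -> C) (g : T -> R) l :
  F (fun x => Cmod (f x - l) <= g x) -> (forall eps, 0 < eps -> F (fun x => g x < eps)) ->
  tends F f l.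
Proof.
intros H K eps He. eapply filter_imp; [|apply (filter_and _ _ H (K _ He))].
intros x [A B]. simpl in *. lra.
Qed.

(** Cauchy criterion by comparison with a convergent real function [h]. It serves both for
    primitives at the two ends of the half-line, with [h] the primitive of a weight, and for the
    partial sums of the zeta series. *)
Lemma tends_cauchy {T} (F : (T -> Prop) -> Prop) {FF : ProperFilter F}
  (D : T -> Prop) (f : T -> C) (h : T -> R) (L K : R) : 0 <= K -> F D ->
  (forall x y, D x -> D y -> Cmod (f y - f x) <= K * Rabs (h y - h x)) ->
  (forall eps, 0 < eps -> F (fun x => Rabs (h x - L) < eps)) ->
  exists l, tends F f l.
Proof.
intros HK HD Hf Hh.
assert (E : exists l : C_UniformSpace, filterlim f F (locally l)).
{ apply (filterlim_locally_cauchy (U := C_CompleteNormedModule)). intros eps.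
  assert (He : 0 < eps / (2 * (K + 1))).
  { apply Rdiv_lt_0_compat; [apply cond_pos | lra]. }
  exists (fun x => D x /\ Rabs (h x - L) < eps / (2 * (K + 1))). split.
  - apply filter_and; trivial. apply Hh, He.
  - intros u v [Du Hu] [Dv Hv]. apply C_NormedModule_mixin_compat1.
    apply Rle_lt_trans with (K * Rabs (h v - h u)). apply Hf; trivial.
    assert (Rabs (h v - h u) < eps / (K + 1)).
    { replace (h v - h u) with ((h v - L) + - (h u - L)) by ring.
      eapply Rle_lt_trans. apply Rabs_triang. rewrite Rabs_Ropp.
      replace (eps / (K + 1)) with (eps / (2 * (K + 1)) + eps / (2 * (K + 1))) by (field; lra).
      lra. }
    apply Rle_lt_trans with (K * (eps / (K + 1))). apply Rmult_le_compat_l; lra.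
    assert (0 < eps) by apply cond_pos.
    apply Rlt_le_trans with ((K + 1) * (eps / (K + 1))).
    assert (0 < eps / (K + 1)) by (apply Rdiv_lt_0_compat; lra). nra.
    right. field. lra. }
destruct E as [l Hl]. exists l. apply tends_locally; trivial. apply _.
Qed.

(* Improper integral over (0, +oo) through an antiderivative, which makes
   linearity and linear substitutions immediate. *)
Definition has_int (f : R -> C) (v : C) : Prop :=
  (forall x, 0 < x -> continuous_C f x) /\
  exists (F : R -> C) (A B : C),
    (forall x, 0 < x -> has_deriv F x (f x)) /\
    tends (at_right 0) F A /\ tends (Rbar_locally p_infty) F B /\ v = (B - A)%C.

Lemma at_right_0_pos : at_right 0 (fun x => 0 < x).
Proof. exists (mkposreal 1 Rlt_0_1). intros y _ H; exact H. Qed.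

Lemma at_right_0_lt (d : R) : 0 < d -> at_right 0 (fun x => 0 < x < d).
Proof.
intros Hd. exists (mkposreal d Hd). intros y H H0.
unfold ball in H; simpl in H; unfold AbsRing_ball, abs, minus, plus, opp in H; simpl in H.
rewrite Ropp_0, Rplus_0_r, Rabs_pos_eq in H; lra.
Qed.

Lemma p_infty_gt (d : R) : Rbar_locally p_infty (fun x => d < x).
Proof. exists d. trivial. Qed.

Lemma is_RInt_of_has_deriv (F f : R -> C) a b :
  (forall x, Rmin a b <= x <= Rmax a b -> has_deriv F x (f x)) ->
  (forall x, Rmin a b <= x <= Rmax a b -> continuous_C f x) ->
  is_RInt (V := C_R_NormedModule) f a b (F b - F a)%C.
Proof.
intros HF Hf.
apply (is_RInt_fct_extend_pair (U := R_NormedModule) (V := R_NormedModule) f a b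
  (Re (F b - F a)%C) (Im (F b - F a)%C)).
- apply (is_RInt_derive (V := R_CompleteNormedModule) (fun t => Re (F t)) (fun t => Re (f t))).
  intros x Hx; exact (proj1 (HF x Hx)). intros x Hx; exact (proj1 (Hf x Hx)).
- apply (is_RInt_derive (V := R_CompleteNormedModule) (fun t => Im (F t)) (fun t => Im (f t))).
  intros x Hx; exact (proj2 (HF x Hx)). intros x Hx; exact (proj2 (Hf x Hx)).
Qed.

Lemma has_int_is_RInt_gen f v : has_int f v ->
  is_RInt_gen (V := C_R_NormedModule) f (at_right 0) (Rbar_locally p_infty) v.
Proof.
intros [Hc [F [A [B [HF [HA [HB ->]]]]]]] Q [d Hd].
assert (Hd2 : 0 < d / 2) by (assert (H := cond_pos d); lra).
refine (Filter_prod _ _ _ _ _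
  (filter_and _ _ at_right_0_pos (HA _ Hd2)) (filter_and _ _ (p_infty_gt 0) (HB _ Hd2)) _).
intros x y [Hx Kx] [Hy Ky]. exists (F y - F x)%C. split.
- assert (Hm := Rmin_pos x y Hx Hy).
  apply is_RInt_of_has_deriv; simpl; intros t Ht; [apply HF | apply Hc]; lra.
- apply Hd. apply C_NormedModule_mixin_compat1.
  change (Cmod ((F y - F x) - (B - A)) < d).
  replace ((F y - F x) - (B - A))%C with ((F y - B) + - (F x - A))%C by ring.
  eapply Rle_lt_trans. apply Cmod_triangle. rewrite Cmod_opp. lra.
Qed.

Lemma has_int_eq f v : has_int f v -> integral_0_infty f = v.
Proof.
intros H.
exact (is_RInt_gen_unique (V := C_R_CompleteNormedModule) f v (has_int_is_RInt_gen f v H)).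
Qed.

Lemma locally_pos (x : R) : 0 < x -> locally x (fun t => 0 < t).
Proof. intros H. apply (open_gt 0 x H). Qed.

Lemma has_int_ext f g v : (forall x, 0 < x -> f x = g x) -> has_int f v -> has_int g v.
Proof.
intros E [Hc [F [A [B [HF H]]]]]. split.
- intros x Hx. apply (continuous_C_ext_loc f); [|apply Hc, Hx].
  eapply filter_imp; [|apply (locally_pos x Hx)]. intros t Ht; apply E, Ht.
- exists F, A, B. split; trivial. intros x Hx. rewrite <- E by trivial. apply HF, Hx.
Qed.

Lemma has_int_plus f g v w : has_int f v -> has_int g w ->
  has_int (fun x => f x + g x)%C (v + w)%C.
Proof.
intros [Hc [F [A [B [HF [HA [HB ->]]]]]]] [Hc' [F' [A' [B' [HF' [HA' [HB' ->]]]]]]].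
split.
- intros x Hx; apply continuous_C_plus; auto.
- exists (fun x => F x + F' x)%C, (A + A')%C, (B + B')%C. split; [|split; [|split]].
  + intros x Hx; apply has_deriv_plus; auto.
  + apply tends_plus; trivial. apply _.
  + apply tends_plus; trivial. apply _.
  + ring.
Qed.

Lemma has_int_scal c f v : has_int f v -> has_int (fun x => c * f x)%C (c * v)%C.
Proof.
intros [Hc [F [A [B [HF [HA [HB ->]]]]]]].
split.
- intros x Hx; apply continuous_C_mult; auto. apply continuous_C_const.
- exists (fun x => c * F x)%C, (c * A)%C, (c * B)%C. split; [|split; [|split]].
  + intros x Hx. eapply has_deriv_eq. apply has_deriv_mult; [apply has_deriv_const | apply HF, Hx]. simpl; ring.
  + apply tends_scal; trivial. apply _.
  + apply tends_scal; trivial. apply _.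
  + ring.
Qed.

Lemma has_int_comp_scal (c : R) f v : 0 < c -> has_int f v ->
  has_int (fun x => RtoC c * f (c * x)%R)%C v.
Proof.
intros H0 [Hc [F [A [B [HF [HA [HB ->]]]]]]].
assert (D : forall x, is_derive (fun x => c * x) x c).
{ intros x. auto_derive; trivial. ring. }
split.
- intros x Hx; apply continuous_C_mult; auto. apply continuous_C_const.
  apply (continuous_C_comp_R f). apply Hc. nra.
  apply (ex_derive_continuous (K := R_AbsRing) (V := R_NormedModule)). exists c. apply D.
- exists (fun x => F (c * x)), A, B. split; [|split; [|split; trivial]].
  + intros x Hx. apply has_deriv_comp_R; trivial. apply HF. nra.
  + intros eps He. destruct (HA eps He) as [d Hd].
    eapply filter_imp; [|apply (at_right_0_lt (d / c))].
    2:{ apply Rdiv_lt_0_compat; trivial. apply cond_pos. }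
    intros x [X Y]. apply Hd; [|nra].
    unfold ball; simpl; unfold AbsRing_ball, abs, minus, plus, opp; simpl.
    replace (c * x + - 0) with (c * x) by ring.
    rewrite Rabs_pos_eq by nra.
    replace (pos d) with (c * (d / c)) by (field; lra). apply Rmult_lt_compat_l; trivial.
  + intros eps He. destruct (HB eps He) as [M HM].
    exists (M / c). intros x Hx. apply HM.
    replace M with (c * (M / c)) by (field; lra). apply Rmult_lt_compat_l; trivial.
Qed.

(* The weight [x^(e-1) / (1 + x^e)^2] and its antiderivative [- 1 / (e (1 + x^e))],
   which increases from [- 1 / e] to [0]. *)
Definition weight (e x : R) : R := exp (e * ln x) / (x * (1 + exp (e * ln x)) ^ 2).
Definition weight_prim (e x : R) : R := - / (e * (1 + exp (e * ln x))).

Lemma weight_pos e x : 0 < x -> 0 < weight e x.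
Proof.
intros Hx. unfold weight. assert (H := exp_pos (e * ln x)).
apply Rdiv_lt_0_compat; trivial. apply Rmult_lt_0_compat; trivial. apply pow_lt. lra.
Qed.

Lemma weight_prim_derive e x : 0 < e -> 0 < x -> is_derive (weight_prim e) x (weight e x).
Proof.
intros He Hx. unfold weight_prim, weight. assert (H := exp_pos (e * ln x)).
auto_derive.
- repeat split; trivial. apply Rgt_not_eq. apply Rmult_lt_0_compat; lra.
- field. repeat split; try lra.
Qed.

Lemma weight_prim_bounds e x : 0 < e -> - / e <= weight_prim e x <= 0.
Proof.
intros He. unfold weight_prim. assert (H := exp_pos (e * ln x)).
assert (0 < / e) by (apply Rinv_0_lt_compat; trivial).
rewrite Rinv_mult.
assert (0 < / (1 + exp (e * ln x)) <= 1).
{ split. apply Rinv_0_lt_compat; lra. rewrite <- Rinv_1. apply Rinv_le_contravar; lra. }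
nra.
Qed.

Lemma weight_prim_0 e : 0 < e -> forall eps, 0 < eps ->
  at_right 0 (fun x => Rabs (weight_prim e x - - / e) < eps).
Proof.
intros He eps Heps.
eapply filter_imp; [|apply (at_right_0_lt (exp (ln (e * eps) / e)))]. 2: apply exp_pos.
intros x [X Y].
assert (Hee : 0 < e * eps) by nra.
assert (L : e * ln x < ln (e * eps)).
{ apply ln_increasing in Y; trivial. rewrite ln_exp in Y.
  replace (ln (e * eps)) with (e * (ln (e * eps) / e)) by (field; lra). nra. }
apply exp_increasing in L. rewrite exp_ln in L by trivial.
assert (H := exp_pos (e * ln x)).
replace (weight_prim e x - - / e) with (exp (e * ln x) / (e * (1 + exp (e * ln x)))).
2:{ unfold weight_prim. field. split; lra. }
rewrite Rabs_pos_eq.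
2:{ apply Rlt_le, Rdiv_lt_0_compat; nra. }
apply Rmult_lt_reg_r with (e * (1 + exp (e * ln x))). nra.
replace (exp (e * ln x) / (e * (1 + exp (e * ln x))) * (e * (1 + exp (e * ln x))))
  with (exp (e * ln x)) by (field; split; lra). nra.
Qed.

Lemma weight_prim_p_infty e : 0 < e -> forall eps, 0 < eps ->
  Rbar_locally p_infty (fun x => Rabs (weight_prim e x - 0) < eps).
Proof.
intros He eps Heps.
eapply filter_imp; [|apply (p_infty_gt (exp (- ln (e * eps) / e)))].
intros x Y.
assert (Hx : 0 < x). { eapply Rlt_trans; [apply exp_pos|exact Y]. }
assert (Hee : 0 < e * eps) by nra.
assert (L : - ln (e * eps) < e * ln x).
{ apply ln_increasing in Y; [|apply exp_pos]. rewrite ln_exp in Y.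
  replace (- ln (e * eps)) with (e * (- ln (e * eps) / e)) by (field; lra). nra. }
apply exp_increasing in L. rewrite exp_Ropp, exp_ln in L by trivial.
assert (H := exp_pos (e * ln x)).
unfold weight_prim. rewrite Rminus_0_r, Rabs_Ropp, Rabs_pos_eq.
2:{ apply Rlt_le, Rinv_0_lt_compat; nra. }
apply Rmult_lt_reg_r with (e * (1 + exp (e * ln x))). nra.
rewrite Rinv_l by nra.
apply Rmult_lt_compat_l with (r := e * eps) in L; trivial.
rewrite Rinv_r in L; nra.
Qed.

(** The absolute value makes the bound symmetric in [x] and [y], as the Cauchy criterion requires;
    the ordered case is the mean value inequality against [K * weight_prim e]. *)
Lemma weight_increment (F f : R -> C) e K x y : 0 < e -> 0 < x -> 0 < y ->
  (forall t, 0 < t -> has_deriv F t (f t)) ->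
  (forall t, 0 < t -> Cmod (f t) <= K * weight e t) ->
  Cmod (F y - F x) <= K * Rabs (weight_prim e y - weight_prim e x).
Proof.
intros He.
assert (W : forall x y, 0 < x -> x <= y ->
  (forall t, 0 < t -> has_deriv F t (f t)) ->
  (forall t, 0 < t -> Cmod (f t) <= K * weight e t) ->
  Cmod (F y - F x) <= K * Rabs (weight_prim e y - weight_prim e x)).
{ clear x y. intros x y Hx Hxy HF Hf.
  replace (K * _) with (K * weight_prim e y - K * weight_prim e x).
  - apply (Cmod_increment_le F f (fun t => K * weight_prim e t) (fun t => K * weight e t)); trivial.
    + intros t Ht. apply HF. lra.
    + intros t Ht. apply (is_derive_scal (weight_prim e) t K). apply weight_prim_derive; lra.
    + intros t Ht. apply Hf. lra.
  - rewrite Rabs_pos_eq. ring.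
    assert (- weight_prim e y <= - weight_prim e x); [|lra].
    apply (derive_nonpos_decr (fun t => - weight_prim e t) (fun t => - weight e t)); trivial.
    + intros t Ht. apply (is_derive_opp (K := R_AbsRing) (V := R_NormedModule)).
      apply weight_prim_derive; lra.
    + intros t Ht. assert (H := weight_pos e t). lra. }
intros Hx Hy HF Hf. destruct (Rle_dec x y).
- apply W; trivial.
- replace (F y - F x)%C with (- (F x - F y))%C by ring.
  rewrite Cmod_opp, Rabs_minus_sym. apply W; trivial. lra.
Qed.

(** The primitive of the weight rises by [1 / e] in all. This is the quantitative tool behind every
    limit under the integral sign. *)
Lemma has_int_bound f v e K : 0 < e -> has_int f v ->
  (forall x, 0 < x -> Cmod (f x) <= K * weight e x) -> Cmod v <= K / e.
Proof.
intros He [Hc [F [A [B [HF [HA [HB ->]]]]]]] Hf.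
assert (HK : 0 <= K).
{ assert (H := Hf 1 Rlt_0_1). assert (H' := weight_pos e 1 Rlt_0_1).
  assert (H2 := Cmod_ge_0 (f 1)). nra. }
apply le_epsilon. intros eps Heps.
assert (He2 : 0 < eps / 2) by lra.
destruct (filter_ex _ (filter_and _ _ at_right_0_pos (HA _ He2))) as [x [Hx Kx]].
destruct (filter_ex _ (filter_and _ _ (p_infty_gt 0) (HB _ He2))) as [y [Hy Ky]].
assert (I := weight_increment F f e K x y He Hx Hy HF Hf).
replace (B - A)%C with ((F y - F x) + (- (F y - B) + (F x - A)))%C by ring.
eapply Rle_trans. apply Cmod_triangle.
apply Rplus_le_compat.
- eapply Rle_trans. exact I. apply Rmult_le_compat_l; trivial.
  assert (B1 := weight_prim_bounds e x He). assert (B2 := weight_prim_bounds e y He).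
  apply Rabs_le. lra.
- eapply Rle_trans. apply Cmod_triangle. rewrite Cmod_opp. lra.
Qed.

Lemma continuous_C_primitive (f : R -> C) : (forall x, 0 < x -> continuous_C f x) ->
  exists F, forall x, 0 < x -> has_deriv F x (f x).
Proof.
intros Hc.
assert (W : forall g : R -> R, (forall x, 0 < x -> continuous g x) ->
  forall x, 0 < x -> is_derive (RInt g 1) x (g x)).
{ intros g Hg x Hx. apply (is_derive_RInt (V := R_NormedModule) g (RInt g 1) 1); auto.
  eapply filter_imp; [|apply (locally_pos x Hx)].
  intros t Ht. apply (RInt_correct (V := R_CompleteNormedModule)).
  apply (ex_RInt_continuous (V := R_CompleteNormedModule)). intros z Hz. apply Hg.
  assert (H := Rmin_pos 1 t Rlt_0_1 Ht). lra. }
exists (fun x => (RInt (fun t => Re (f t)) 1 x, RInt (fun t => Im (f t)) 1 x)).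
intros x Hx; split; simpl.
- apply W; trivial. intros t Ht; exact (proj1 (Hc t Ht)).
- apply W; trivial. intros t Ht; exact (proj2 (Hc t Ht)).
Qed.

(** Any primitive is Cauchy at both ends, because its increments are bounded by those of
    [weight_prim e], which converges there. *)
Lemma has_int_dominated f e K : 0 < e -> (forall x, 0 < x -> continuous_C f x) ->
  (forall x, 0 < x -> Cmod (f x) <= K * weight e x) -> exists v, has_int f v.
Proof.
intros He Hc Hf.
assert (HK : 0 <= K).
{ assert (H := Hf 1 Rlt_0_1). assert (H' := weight_pos e 1 Rlt_0_1).
  assert (H2 := Cmod_ge_0 (f 1)). nra. }
destruct (continuous_C_primitive f Hc) as [F HF].
assert (I := fun x y Hx Hy => weight_increment F f e K x y He Hx Hy HF Hf).
destruct (tends_cauchy (at_right 0) (fun x => 0 < x) F (weight_prim e) (- / e) K HK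
  at_right_0_pos I (weight_prim_0 e He)) as [A HA].
destruct (tends_cauchy (Rbar_locally p_infty) (fun x => 0 < x) F (weight_prim e) 0 K HK
  (p_infty_gt 0) I (weight_prim_p_infty e He)) as [B HB].
exists (B - A)%C. split; trivial. exists F, A, B. auto.
Qed.

(** * The integrands and their domination *)


(* [x^a (1 + x)^b], for [0 < x]. *)
Definition power_pair (a b : C) (x : R) : C := Cexp (a * RtoC (ln x) + b * RtoC (ln (1 + x))).

Lemma Rpow_C_minus_1 x z : 0 < x -> Rpow_C x (z - 1) = (Cexp (z * RtoC (ln x)) * RtoC (/ x))%C.
Proof.
intros Hx. unfold Rpow_C.
replace ((z - 1) * RtoC (ln x))%C with (z * RtoC (ln x) + RtoC (- ln x))%C.
2:{ rewrite RtoC_opp. ring. }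
rewrite Cexp_plus, Cexp_RtoC, exp_Ropp, exp_ln by trivial. reflexivity.
Qed.

Lemma log_beta_integrand_power_pair n l m x : 0 < x ->
  log_beta_integrand n l m x = (power_pair l (- (m + 1)) x * RtoC (ln (1 + x) ^ n * / x))%C.
Proof.
intros Hx. unfold log_beta_integrand, power_pair. rewrite Rpow_C_minus_1 by trivial.
rewrite Cexp_plus.
replace (- (m + 1) * RtoC (ln (1 + x)))%C with (- ((m + 1) * RtoC (ln (1 + x))))%C by ring.
rewrite Cexp_opp. unfold Rpow_C. rewrite RtoC_mult. unfold Cdiv. ring.
Qed.

Lemma is_derive_ln_1p x : 0 < x -> is_derive (fun x => ln (1 + x)) x (/ (1 + x)).
Proof. intros Hx. auto_derive; [lra | field; lra]. Qed.

Lemma power_pair_has_deriv a b x : 0 < x ->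
  has_deriv (power_pair a b) x ((a * RtoC (/ x) + b * RtoC (/ (1 + x))) * power_pair a b x)%C.
Proof.
intros Hx. unfold power_pair. apply has_deriv_Cexp.
eapply has_deriv_eq.
- apply has_deriv_plus; (apply has_deriv_mult; [apply has_deriv_const|]).
  + apply has_deriv_RtoC. apply is_derive_Reals, derivable_pt_lim_ln, Hx.
  + apply has_deriv_RtoC. apply is_derive_ln_1p, Hx.
- cbv beta. ring.
Qed.

Lemma continuous_C_RtoC (g : R -> R) x : continuous g x -> continuous_C (fun t => RtoC (g t)) x.
Proof. intros H; split; simpl; [exact H | apply continuous_const]. Qed.

Lemma continuous_ln_1p_pow_div n x : 0 < x ->
  continuous (fun x => ln (1 + x) ^ n * / x) x.
Proof.
intros Hx. apply (ex_derive_continuous (K := R_AbsRing) (V := R_NormedModule)).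
auto_derive. repeat split; lra.
Qed.

Lemma continuous_C_log_beta n l m x : 0 < x -> continuous_C (log_beta_integrand n l m) x.
Proof.
intros Hx.
apply (continuous_C_ext_loc (fun x => power_pair l (- (m + 1)) x * RtoC (ln (1 + x) ^ n * / x))%C).
- eapply filter_imp; [|apply (locally_pos x Hx)]. intros t Ht.
  symmetry; apply log_beta_integrand_power_pair, Ht.
- apply continuous_C_mult. exact (has_deriv_continuous_C _ _ _ (power_pair_has_deriv _ _ x Hx)).
  apply continuous_C_RtoC, continuous_ln_1p_pow_div, Hx.
Qed.

(* The logarithms of [p = x / (1 + x)] and [q = 1 / (1 + x)]: up to its power of
   [ln (1 + x)], the integrand is [p^l q^(m+1-l) / x]. *)
Definition ln_p (x : R) : R := ln x - ln (1 + x).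
Definition ln_q (x : R) : R := - ln (1 + x).

Lemma ln_1p_pos x : 0 < x -> 0 < ln (1 + x).
Proof. intros H. rewrite <- ln_1. apply ln_increasing; lra. Qed.

Lemma ln_p_neg x : 0 < x -> ln_p x < 0.
Proof. intros H. unfold ln_p. assert (ln x < ln (1 + x)) by (apply ln_increasing; lra). lra. Qed.

Lemma ln_q_neg x : 0 < x -> ln_q x < 0.
Proof. intros H. unfold ln_q. assert (K := ln_1p_pos x H). lra. Qed.

(** Since [p] and [q] lie below 1, lowering both exponents to [e] only increases the left side, and
    [p^e q^e = x^e / (1 + x)^(2 e)]. As [(1 + x)^e] is at least both 1 and [x^e], one has
    [(1 + x^e)^2 <= 4 (1 + x)^(2 e)], whence the 4. *)
Lemma exp_ln_p_ln_q_le_weight al be e x : 0 < x -> 0 < e -> e <= al -> e <= be ->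
  exp (al * ln_p x + be * ln_q x) * / x <= 4 * weight e x.
Proof.
intros Hx He Ha Hb. assert (P := ln_p_neg x Hx). assert (Q := ln_q_neg x Hx).
unfold weight.
assert (H : exp (al * ln_p x + be * ln_q x) <= exp (e * ln x) / (exp (e * ln (1 + x))) ^ 2).
{ unfold Rdiv. replace (exp (e * ln x) * / exp (e * ln (1 + x)) ^ 2)
    with (exp (e * ln_p x + e * ln_q x)).
  - apply exp_le. nra.
  - unfold ln_p, ln_q.
    replace (e * (ln x - ln (1 + x)) + e * - ln (1 + x)) with
      (e * ln x + (- (e * ln (1 + x)) + - (e * ln (1 + x)))) by ring.
    rewrite !exp_plus, exp_Ropp. field. apply Rgt_not_eq, exp_pos. }
set (X := exp (e * ln x)) in *. set (Y := exp (e * ln (1 + x))) in *.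
assert (HX : 0 < X) by apply exp_pos.
assert (HXY : X <= Y).
{ apply exp_le. unfold ln_p in P. nra. }
assert (HY : 1 <= Y).
{ unfold Y. rewrite <- exp_0 at 1. apply exp_le. apply Rmult_le_pos; unfold ln_q in Q; lra. }
apply Rle_trans with (X / Y ^ 2 * / x).
{ apply Rmult_le_compat_r; trivial. apply Rlt_le, Rinv_0_lt_compat, Hx. }
assert (HYX : (1 + X) ^ 2 <= 4 * Y ^ 2) by nra.
assert (0 < (1 + X) ^ 2) by (apply pow_lt; lra).
assert (0 < Y ^ 2) by (apply pow_lt; lra).
replace (X / Y ^ 2 * / x) with (X / x * / Y ^ 2) by (field; repeat split; lra).
replace (4 * (X / (x * (1 + X) ^ 2))) with (X / x * (4 * / (1 + X) ^ 2)) by (field; repeat split; lra).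
apply Rmult_le_compat_l. apply Rlt_le, Rdiv_lt_0_compat; lra.
apply Rmult_le_reg_r with (Y ^ 2 * (1 + X) ^ 2). nra.
replace (/ Y ^ 2 * (Y ^ 2 * (1 + X) ^ 2)) with ((1 + X) ^ 2) by (field; lra).
replace (4 * / (1 + X) ^ 2 * (Y ^ 2 * (1 + X) ^ 2)) with (4 * Y ^ 2) by (field; lra).
exact HYX.
Qed.

Lemma ln_le_minus_1 y : 0 < y -> ln y <= y - 1.
Proof.
intros H. assert (K := exp_ineq1_le (ln y)). rewrite exp_ln in K; lra.
Qed.

(** A logarithm gains a full factor [p] at 0 and costs only [q^(-d)] at infinity; this is why [n]
    logarithms extend convergence to [0 < Re l + n] without narrowing [0 < Re (m + 1 - l)]. With
    [Y = (1 + x)^d] one has [ln Y <= Y - 1], and [Y - 1 <= Y x / (1 + x)] because [Y <= 1 + x]. *)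
Lemma ln_1p_le_exp d x : 0 < d <= 1 -> 0 < x -> ln (1 + x) <= / d * exp (ln_p x - d * ln_q x).
Proof.
intros Hd Hx.
assert (Q := ln_q_neg x Hx).
apply Rmult_le_reg_l with d; [lra|].
rewrite <- Rmult_assoc, Rinv_r, Rmult_1_l by lra.
set (Y := exp (- (d * ln_q x))).
assert (HY : 0 < Y) by apply exp_pos.
assert (L : d * ln (1 + x) = ln Y) by (unfold Y; rewrite ln_exp; unfold ln_q; ring).
rewrite L. eapply Rle_trans. apply ln_le_minus_1, HY.
unfold Rminus at 2. rewrite exp_plus. fold Y.
assert (E : exp (ln_p x) = x / (1 + x)).
{ unfold ln_p, Rminus. rewrite exp_plus, exp_Ropp, !exp_ln by lra. reflexivity. }
rewrite E.
assert (YX : Y <= 1 + x).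
{ rewrite <- (exp_ln (1 + x)) by lra. unfold Y. apply exp_le. unfold ln_q in *. nra. }
apply Rmult_le_reg_r with (1 + x); [lra|].
replace (x / (1 + x) * Y * (1 + x)) with (x * Y) by (field; lra). nra.
Qed.

Lemma ln_1p_pow_le_exp n d x : 0 < d <= 1 -> 0 < x ->
  ln (1 + x) ^ n <= (/ d) ^ n * exp (INR n * ln_p x - INR n * d * ln_q x).
Proof.
intros Hd Hx.
replace (exp (INR n * ln_p x - INR n * d * ln_q x)) with (exp (ln_p x - d * ln_q x) ^ n).
- rewrite <- Rpow_mult_distr. apply pow_incr. split.
  apply Rlt_le, ln_1p_pos, Hx. apply ln_1p_le_exp; trivial.
- induction n as [|n IH].
  + simpl. rewrite <- exp_0. f_equal. ring.
  + rewrite S_INR, <- tech_pow_Rmult, IH, <- exp_plus. f_equal. ring.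
Qed.

(* Dominates the logarithms produced by varying or differentiating in the exponents. *)
Definition logsize (x : R) : R := Rabs (ln x) + ln (1 + x).

Lemma logsize_nonneg x : 0 < x -> 0 <= logsize x.
Proof.
intros H. unfold logsize. assert (K := ln_1p_pos x H). assert (K' := Rabs_pos (ln x)). lra.
Qed.

Lemma logsize_le x : 0 < x -> logsize x <= - ln_p x - 2 * ln_q x.
Proof.
intros H. assert (P := ln_p_neg x H). assert (Q := ln_q_neg x H).
unfold logsize. assert (Rabs (ln x) <= - ln_p x - ln_q x).
{ apply Rabs_le. unfold ln_p, ln_q in *. lra. }
unfold ln_q in *. lra.
Qed.

Lemma Cmod_power_pair l m x : Cmod (power_pair l (- (m + 1)) x) =
  exp (Re l * ln_p x + Re (m + 1 - l)%C * ln_q x).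
Proof.
unfold power_pair. rewrite Cmod_Cexp. f_equal. unfold ln_p, ln_q, Re; simpl. ring.
Qed.

(** The factor [exp (d * logsize x)] is a margin: it pays for a change of the exponents by up to
    [d / 2] together with the logarithms that such a change or a derivative brings in. *)
Definition dominated (f : R -> C) (d e K : R) : Prop :=
  forall x, 0 < x -> Cmod (f x) * exp (d * logsize x) <= K * weight e x.

(** A budget of exponents of [p] and [q], starting from [al] and [be]. The logarithms are already
    counted in [al] and cost at most [be / 4] of [q]. The margin costs [d <= al / 2] of [p] and
    [2 d <= be / 4] of [q]. At least [al / 2] and [be / 2] remain, which is what [e] needs. *)
Lemma log_beta_dominated n l m : 0 < Re l + INR n -> 0 < Re (m + 1 - l)%C ->
  exists d e K, 0 < d /\ 0 < e /\ dominated (log_beta_integrand n l m) d e K.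
Proof.
set (al := Re l + INR n). set (be := Re (m + 1 - l)%C). intros Ha Hb.
assert (Hn := pos_INR n).
set (d1 := Rmin 1 (be / (4 * (INR n + 1)))).
assert (Hd1 : 0 < d1 <= 1).
{ split. apply Rmin_pos; [lra|]. apply Rdiv_lt_0_compat; lra. apply Rmin_l. }
assert (Hnd : INR n * d1 <= be / 4).
{ apply Rle_trans with ((INR n + 1) * (be / (4 * (INR n + 1)))).
  - apply Rmult_le_compat; try lra. apply Rmin_r.
  - right. field. lra. }
set (d := Rmin (al / 2) (be / 8)).
assert (Hd : 0 < d) by (apply Rmin_pos; lra).
assert (D1 : d <= al / 2) by apply Rmin_l.
assert (D2 : d <= be / 8) by apply Rmin_r.
set (e := Rmin (al / 2) (be / 2)).
assert (E1 : e <= al / 2) by apply Rmin_l.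
assert (E2 : e <= be / 2) by apply Rmin_r.
assert (He : 0 < e) by (apply Rmin_pos; lra).
exists d, e, ((/ d1) ^ n * 4). split; [exact Hd | split; [exact He|]].
intros x Hx. rewrite log_beta_integrand_power_pair by trivial.
assert (P := ln_p_neg x Hx). assert (Q := ln_q_neg x Hx).
assert (HL := ln_1p_pos x Hx).
assert (Hpw := pow_lt _ n HL).
assert (Hix := Rinv_0_lt_compat x Hx).
rewrite Cmod_mult, Cmod_power_pair, Cmod_R, Rabs_pos_eq by (apply Rlt_le, Rmult_lt_0_compat; trivial).
rewrite (Rmult_assoc _ 4).
eapply Rle_trans.
2:{ apply Rmult_le_compat_l. apply Rlt_le, pow_lt, Rinv_0_lt_compat; lra.
    apply (exp_ln_p_ln_q_le_weight (al - d) (be - INR n * d1 - 2 * d) e x Hx He); lra. }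
assert (B1 := ln_1p_pow_le_exp n d1 x Hd1 Hx).
assert (B2 : exp (d * logsize x) <= exp (d * (- ln_p x - 2 * ln_q x))).
{ apply exp_le, Rmult_le_compat_l; [lra | apply logsize_le, Hx]. }
apply Rle_trans with (exp (Re l * ln_p x + be * ln_q x) *
  ((/ d1) ^ n * exp (INR n * ln_p x - INR n * d1 * ln_q x) * / x) * exp (d * (- ln_p x - 2 * ln_q x))).
- apply Rmult_le_compat; trivial.
  + apply Rmult_le_pos. apply Rlt_le, exp_pos. apply Rlt_le, Rmult_lt_0_compat; trivial.
  + apply Rlt_le, exp_pos.
  + apply Rmult_le_compat_l. apply Rlt_le, exp_pos.
    apply Rmult_le_compat_r; lra.
- right.
  replace ((al - d) * ln_p x + (be - INR n * d1 - 2 * d) * ln_q x) with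
    ((Re l * ln_p x + be * ln_q x) + ((INR n * ln_p x - INR n * d1 * ln_q x) + d * (- ln_p x - 2 * ln_q x)))
    by (unfold al; ring).
  rewrite (exp_plus (Re l * ln_p x + be * ln_q x)),
   (exp_plus (INR n * ln_p x - INR n * d1 * ln_q x)). ring.
Qed.

(** The inequality [ln y <= y - 1] at [y = (1 + x) / s]. The constant [s^s exp (1 - s)] is the value
    of [(1 + x)^s exp (- x)] at its critical point [1 + x = s]. *)
Lemma exp_opp_le_exp_ln_q s x : 0 < s -> 0 < x ->
  exp (- x) <= exp (s * ln s + 1 - s) * exp (s * ln_q x).
Proof.
intros Hs Hx. rewrite <- exp_plus. apply exp_le. unfold ln_q.
assert (K := ln_le_minus_1 ((1 + x) / s)).
assert (0 < (1 + x) / s) by (apply Rdiv_lt_0_compat; lra).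
unfold Rdiv in K. rewrite ln_mult, ln_Rinv in K; try lra.
2:{ apply Rinv_0_lt_compat; lra. }
assert (K' : ln (1 + x) <= ln s + (1 + x) * / s - 1) by lra.
apply (Rmult_le_compat_l s) in K'; [|lra].
replace (s * (ln s + (1 + x) * / s - 1)) with (s * ln s + (1 + x) - s) in K' by (field; lra).
lra.
Qed.

Definition Gamma_integrand (z : C) (x : R) : C := (Rpow_C x (z - 1) * RtoC (exp (- x)))%C.

Lemma Gamma_integrand_power_pair z x : 0 < x ->
  Gamma_integrand z x = (power_pair z 0 x * RtoC (exp (- x) * / x))%C.
Proof.
intros Hx. unfold Gamma_integrand, power_pair. rewrite Rpow_C_minus_1 by trivial.
replace (z * RtoC (ln x) + 0 * RtoC (ln (1 + x)))%C with (z * RtoC (ln x))%C by ring.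
rewrite RtoC_mult. ring.
Qed.

Lemma continuous_C_Gamma_integrand z x : 0 < x -> continuous_C (Gamma_integrand z) x.
Proof.
intros Hx.
apply (continuous_C_ext_loc (fun x => power_pair z 0 x * RtoC (exp (- x) * / x))%C).
- eapply filter_imp; [|apply (locally_pos x Hx)]. intros t Ht.
  symmetry; apply Gamma_integrand_power_pair, Ht.
- apply continuous_C_mult. exact (has_deriv_continuous_C _ _ _ (power_pair_has_deriv _ _ x Hx)).
  apply continuous_C_RtoC, (ex_derive_continuous (K := R_AbsRing) (V := R_NormedModule)).
  auto_derive. lra.
Qed.

Lemma Gamma_dominated z : 0 < Re z ->
  exists d e K, 0 < d /\ 0 < e /\ dominated (Gamma_integrand z) d e K.
Proof.
intros Hz. set (s := Re z) in *.
(* The growth [x^s = p^s q^(-s)] is met by taking decay [q^(3 s)] from the exponential. After the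
   margin, which costs [p^(s/2) q^s], there remains [p^(s/2) q^s]. *)
exists (s / 2), (s / 2), (exp (3 * s * ln (3 * s) + 1 - 3 * s) * 4).
split; [lra | split; [lra|]].
intros x Hx. rewrite Gamma_integrand_power_pair by trivial.
assert (P := ln_p_neg x Hx). assert (Q := ln_q_neg x Hx).
assert (Hix := Rinv_0_lt_compat x Hx).
assert (Hex := exp_pos (- x)).
rewrite Cmod_mult, Cmod_R, Rabs_pos_eq by (apply Rlt_le, Rmult_lt_0_compat; trivial).
unfold power_pair. rewrite Cmod_Cexp.
replace (Re _) with (s * ln_p x - s * ln_q x) by (unfold s, ln_p, ln_q, Re; simpl; ring).
rewrite (Rmult_assoc _ 4).
eapply Rle_trans.
2:{ apply Rmult_le_compat_l. apply Rlt_le, exp_pos.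
    apply (exp_ln_p_ln_q_le_weight (s - s / 2) (3 * s - s - s) (s / 2) x Hx); lra. }
assert (B1 := exp_opp_le_exp_ln_q (3 * s) x ltac:(lra) Hx).
assert (B2 : exp (s / 2 * logsize x) <= exp (s / 2 * (- ln_p x - 2 * ln_q x))).
{ apply exp_le, Rmult_le_compat_l; [lra | apply logsize_le, Hx]. }
set (k := exp (3 * s * ln (3 * s) + 1 - 3 * s)) in *.
apply Rle_trans with (exp (s * ln_p x - s * ln_q x) *
  (k * exp (3 * s * ln_q x) * / x) * exp (s / 2 * (- ln_p x - 2 * ln_q x))).
- apply Rmult_le_compat; trivial.
  + apply Rmult_le_pos. apply Rlt_le, exp_pos. apply Rlt_le, Rmult_lt_0_compat; trivial.
  + apply Rlt_le, exp_pos.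
  + apply Rmult_le_compat_l. apply Rlt_le, exp_pos.
    apply Rmult_le_compat_r; lra.
- right.
  replace ((s - s / 2) * ln_p x + (3 * s - s - s) * ln_q x) with
    ((s * ln_p x - s * ln_q x) + (3 * s * ln_q x + s / 2 * (- ln_p x - 2 * ln_q x))) by field.
  rewrite (exp_plus (s * ln_p x - s * ln_q x)), (exp_plus (3 * s * ln_q x)). ring.
Qed.

(** * Varying the exponents under the integral sign *)

Lemma dominated_weight f d e K : 0 <= d -> dominated f d e K ->
  forall x, 0 < x -> Cmod (f x) <= K * weight e x.
Proof.
intros Hd H x Hx. eapply Rle_trans; [|apply H, Hx].
rewrite <- (Rmult_1_r (Cmod (f x))) at 1. apply Rmult_le_compat_l. apply Cmod_ge_0.
rewrite <- exp_0. apply exp_le. apply Rmult_le_pos; trivial. apply logsize_nonneg, Hx.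
Qed.

Lemma le_exp_scaled c t : 0 < c -> t <= / c * exp (c * t).
Proof.
intros Hc. assert (H := exp_ineq1_le (c * t)).
apply Rmult_le_reg_l with c; trivial. rewrite <- Rmult_assoc, Rinv_r, Rmult_1_l; lra.
Qed.

(** With [L = logsize x], the modulus of [Cexp w - 1] is at most [r L exp (r L)], and
    [L <= (4 / d) exp (d L / 4)]. As [r <= d / 2], the exponentials together stay within the margin
    [exp (d L)]. *)
Lemma dominated_perturb_0 f d e K r (w : R -> C) : 0 < d -> 0 <= r <= d / 2 ->
  dominated f d e K -> (forall x, 0 < x -> Cmod (w x) <= r * logsize x) ->
  forall x, 0 < x -> Cmod (f x * (Cexp (w x) - 1)) <= r * (4 / d * K) * weight e x.
Proof.
intros Hd Hr Hf Hw x Hx. rewrite Cmod_mult.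
assert (L := logsize_nonneg x Hx). set (p := logsize x) in *.
assert (W := Hw x Hx). fold p in W.
assert (W0 := Cmod_ge_0 (w x)).
assert (E1 := Cexp_minus_1_le (w x)).
assert (Ep := le_exp_scaled (d / 4) p ltac:(lra)).
assert (E2 : Cmod (w x) * exp (Cmod (w x)) <= r * (4 / d * exp (d / 4 * p)) * exp (r * p)).
{ apply Rmult_le_compat; trivial. apply Rlt_le, exp_pos.
  eapply Rle_trans. exact W. apply Rmult_le_compat_l. lra.
  replace (4 / d) with (/ (d / 4)) by (field; lra). exact Ep. 
  apply exp_le, W. }
assert (E3 : exp (d / 4 * p) * exp (r * p) <= exp (d * p)).
{ rewrite <- exp_plus. apply exp_le. nra. }
apply Rle_trans with (Cmod (f x) * (r * (4 / d) * exp (d * p))).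
- apply Rmult_le_compat_l. apply Cmod_ge_0.
  eapply Rle_trans. exact E1. eapply Rle_trans. exact E2.
  replace (r * (4 / d * exp (d / 4 * p)) * exp (r * p)) with
    (r * (4 / d) * (exp (d / 4 * p) * exp (r * p))) by ring.
  apply Rmult_le_compat_l; trivial. apply Rmult_le_pos. lra. apply Rlt_le, Rdiv_lt_0_compat; lra.
- replace (Cmod (f x) * (r * (4 / d) * exp (d * p))) with
    (r * (4 / d) * (Cmod (f x) * exp (d * p))) by ring.
  replace (r * (4 / d * K) * weight e x) with (r * (4 / d) * (K * weight e x)) by ring.
  apply Rmult_le_compat_l. apply Rmult_le_pos. lra. apply Rlt_le, Rdiv_lt_0_compat; lra.
  apply Hf, Hx.
Qed.

(** As for the first-order bound, with two factors [exp (d L / 4)] coming from [L^2]; together with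
    [exp (r L)] and [r <= d / 2] they use up exactly the margin. *)
Lemma dominated_perturb_1 f d e K r (w : R -> C) : 0 < d -> 0 <= r <= d / 2 ->
  dominated f d e K -> (forall x, 0 < x -> Cmod (w x) <= r * logsize x) ->
  forall x, 0 < x -> Cmod (f x * (Cexp (w x) - 1 - w x)) <= r ^ 2 * (16 / d ^ 2 * K) * weight e x.
Proof.
intros Hd Hr Hf Hw x Hx. rewrite Cmod_mult.
assert (L := logsize_nonneg x Hx). set (p := logsize x) in *.
assert (W := Hw x Hx). fold p in W.
assert (W0 := Cmod_ge_0 (w x)).
assert (E1 := Cexp_taylor_1_le (w x)).
assert (Ep := le_exp_scaled (d / 4) p ltac:(lra)).
assert (E2 : Cmod (w x) ^ 2 * exp (Cmod (w x)) <= (r * (4 / d * exp (d / 4 * p))) ^ 2 * exp (r * p)).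
{ apply Rmult_le_compat. apply pow_le; trivial. apply Rlt_le, exp_pos.
  apply pow_incr. split; trivial.
  eapply Rle_trans. exact W. apply Rmult_le_compat_l. lra.
  replace (4 / d) with (/ (d / 4)) by (field; lra). exact Ep. 
  apply exp_le, W. }
assert (E3 : exp (d / 4 * p) ^ 2 * exp (r * p) <= exp (d * p)).
{ simpl. rewrite Rmult_1_r, <- !exp_plus. apply exp_le. nra. }
assert (K0 : 0 <= r ^ 2 * (16 / d ^ 2)).
{ apply Rmult_le_pos. apply pow_le; lra. apply Rlt_le, Rdiv_lt_0_compat; [lra | apply pow_lt; lra]. }
apply Rle_trans with (Cmod (f x) * (r ^ 2 * (16 / d ^ 2) * exp (d * p))).
- apply Rmult_le_compat_l. apply Cmod_ge_0.
  eapply Rle_trans. exact E1. eapply Rle_trans. exact E2.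
  replace ((r * (4 / d * exp (d / 4 * p))) ^ 2 * exp (r * p)) with
    (r ^ 2 * (16 / d ^ 2) * (exp (d / 4 * p) ^ 2 * exp (r * p))) by (field; lra).
  apply Rmult_le_compat_l; trivial.
- replace (Cmod (f x) * (r ^ 2 * (16 / d ^ 2) * exp (d * p))) with
    (r ^ 2 * (16 / d ^ 2) * (Cmod (f x) * exp (d * p))) by ring.
  replace (r ^ 2 * (16 / d ^ 2 * K) * weight e x) with (r ^ 2 * (16 / d ^ 2) * (K * weight e x)) by ring.
  apply Rmult_le_compat_l; trivial. apply Hf, Hx.
Qed.

(** A quadratic remainder is what the integral estimates produce; the derivatives of the inverse and
    of a translation are obtained in the same way. *)
Lemma is_derive_C_quadratic (f : C -> C) z l d M : 0 < d ->
  (forall h, Cmod h <= d -> Cmod (f (z + h) - f z - h * l)%C <= M * Cmod h ^ 2) ->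
  is_derive (K := C_AbsRing) (V := C_NormedModule) f z l.
Proof.
intros Hd H. split.
- apply is_linear_scal_l.
- intros x Hx. assert (E := is_filter_lim_locally_unique (V := AbsRing_NormedModule C_AbsRing) z x Hx). subst x.
  intros eps.
  assert (He : 0 < eps) by apply cond_pos.
  set (d' := Rmin d (eps / (Rabs M + 1))).
  assert (HM := Rabs_pos M).
  assert (Hd' : 0 < d').
  { apply Rmin_pos; trivial. apply Rdiv_lt_0_compat; lra. }
  exists (mkposreal d' Hd').
  intros y Hy. 
  change (Cmod (y - z) < d') in Hy.
  change (Cmod (f y - f z - (y - z) * l)%C <= eps * Cmod (y - z)).
  set (h := (y - z)%C) in *.
  assert (H1 : Cmod h <= d) by (apply Rlt_le, Rlt_le_trans with d'; trivial; apply Rmin_l).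
  assert (H2 : Cmod h <= eps / (Rabs M + 1)) by (apply Rlt_le, Rlt_le_trans with d'; trivial; apply Rmin_r).
  replace y with (z + h)%C by (unfold h; ring).
  eapply Rle_trans. apply H, H1.
  assert (H0 := Cmod_ge_0 h).
  apply Rle_trans with ((Rabs M + 1) * (eps / (Rabs M + 1)) * Cmod h).
  + replace (M * Cmod h ^ 2) with (M * Cmod h * Cmod h) by ring.
    apply Rmult_le_compat_r; trivial.
    apply Rle_trans with (Rabs M * Cmod h). apply Rmult_le_compat_r; trivial. apply Rle_abs.
    apply Rmult_le_compat; lra.
  + right. field. lra.
Qed.

(** Differentiation under the integral sign for families that vary by a factor [Cexp (h psi)]. It is
    used for Euler's integral with [psi = ln] and for the beta integral in [m] with
    [psi x = - ln (1 + x)]. The second-order remainder of the exponential is integrated against the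
    weight. *)
Lemma has_int_derive (F : C -> C) (f : C -> R -> C) (psi : R -> R) z d e K :
  0 < d -> 0 < e -> dominated (f z) d e K ->
  (forall x, 0 < x -> continuous_C (f z) x) ->
  (forall x, 0 < x -> continuous psi x) ->
  (forall x, 0 < x -> Rabs (psi x) <= logsize x) ->
  (forall h x, 0 < x -> f (z + h)%C x = (f z x * Cexp (h * RtoC (psi x)))%C) ->
  (forall h, Cmod h <= d / 2 -> has_int (f (z + h)%C) (F (z + h)%C)) ->
  exists l, has_int (fun x => f z x * RtoC (psi x))%C l /\
    is_derive (K := C_AbsRing) (V := C_NormedModule) F z l.
Proof.
intros Hd He Hf Hc Hpc Hp Hsh HF.
destruct (has_int_dominated (fun x => f z x * RtoC (psi x))%C e (/ d * K) He) as [l Hl].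
- intros x Hx. apply continuous_C_mult. apply Hc, Hx. apply continuous_C_RtoC, Hpc, Hx.
- intros x Hx. rewrite Cmod_mult, Cmod_R.
  replace (/ d * K * weight e x) with (/ d * (K * weight e x)) by ring.
  eapply Rle_trans.
  2:{ apply Rmult_le_compat_l; [|apply (Hf x Hx)]. apply Rlt_le, Rinv_0_lt_compat, Hd. }
  replace (/ d * (Cmod (f z x) * exp (d * logsize x))) with
    (Cmod (f z x) * (/ d * exp (d * logsize x))) by ring.
  apply Rmult_le_compat_l. apply Cmod_ge_0.
  eapply Rle_trans. apply Hp, Hx. apply le_exp_scaled, Hd.
- exists l. split; trivial.
  apply (is_derive_C_quadratic F z l (d / 2) (16 / d ^ 2 * K / e)). lra.
  intros h Hh.
  replace (16 / d ^ 2 * K / e * Cmod h ^ 2) with (Cmod h ^ 2 * (16 / d ^ 2 * K) / e) by (field; lra).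
  assert (F0 : has_int (f z) (F z)).
  { assert (H := HF 0%C). rewrite Cmod_0 in H.
    replace (z + 0)%C with z in H by ring. apply H; lra. }
  apply (has_int_bound (fun x => f z x * (Cexp (h * RtoC (psi x)) - 1 - h * RtoC (psi x)))%C); trivial.
  + replace (F (z + h)%C - F z - h * l)%C with (F (z + h)%C + ((-1) * F z + (-h) * l))%C by ring.
    eapply has_int_ext.
    2:{ apply has_int_plus. apply HF, Hh. apply has_int_plus; apply has_int_scal; eassumption. }
    intros x Hx. simpl. rewrite Hsh by trivial. ring.
  + apply (dominated_perturb_1 (f z) d e K (Cmod h) (fun x => h * RtoC (psi x))%C); trivial.
    * split; [apply Cmod_ge_0 | trivial].
    * intros x Hx. rewrite Cmod_mult, Cmod_R. apply Rmult_le_compat_l. apply Cmod_ge_0. apply Hp, Hx.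
Qed.

(** * Recurrences for the logarithmic beta integrals *)


Definition log_beta_int (n : nat) (l m : C) : C := integral_0_infty (log_beta_integrand n l m).

Lemma log_beta_int_has_int n l m : 0 < Re l + INR n -> 0 < Re (m + 1 - l)%C ->
  has_int (log_beta_integrand n l m) (log_beta_int n l m).
Proof.
intros Hl Hm.
destruct (log_beta_dominated n l m Hl Hm) as [d [e [K [Hd [He H]]]]].
destruct (has_int_dominated (log_beta_integrand n l m) e K He) as [v Hv].
- intros x Hx; apply continuous_C_log_beta, Hx.
- apply (dominated_weight _ d); trivial. lra.
- unfold log_beta_int. rewrite (has_int_eq _ _ Hv). exact Hv.
Qed.

Lemma has_int_unique f v w : has_int f v -> has_int f w -> v = w.
Proof. intros H K. rewrite <- (has_int_eq _ _ H). apply has_int_eq, K. Qed.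

Lemma power_pair_plus_l a b x : 0 < x -> power_pair (a + 1) b x = (power_pair a b x * RtoC x)%C.
Proof.
intros Hx. unfold power_pair.
replace ((a + 1) * RtoC (ln x) + b * RtoC (ln (1 + x)))%C with
  (a * RtoC (ln x) + b * RtoC (ln (1 + x)) + RtoC (ln x))%C by ring.
rewrite Cexp_plus, Cexp_RtoC, exp_ln; trivial.
Qed.

Lemma power_pair_minus_r a b x : 0 < x -> power_pair a (b - 1) x = (power_pair a b x * RtoC (/ (1 + x)))%C.
Proof.
intros Hx. unfold power_pair.
replace (a * RtoC (ln x) + (b - 1) * RtoC (ln (1 + x)))%C with
  (a * RtoC (ln x) + b * RtoC (ln (1 + x)) + RtoC (- ln (1 + x)))%C.
2:{ rewrite RtoC_opp. ring. }
rewrite Cexp_plus, Cexp_RtoC, exp_Ropp, exp_ln; trivial. lra.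
Qed.

Lemma log_beta_m1 n l m x : 0 < x -> log_beta_integrand n l (m + 1) x =
  (log_beta_integrand n l m x * RtoC (/ (1 + x)))%C.
Proof.
intros Hx. rewrite !log_beta_integrand_power_pair by trivial.
replace (- (m + 1 + 1))%C with (- (m + 1) - 1)%C by ring.
rewrite power_pair_minus_r by trivial. ring.
Qed.

Lemma log_beta_l1_m1 n l m x : 0 < x -> log_beta_integrand n (l + 1) (m + 1) x =
  (power_pair l (- (m + 1)) x * RtoC (ln (1 + x) ^ n * / (1 + x)))%C.
Proof.
intros Hx. rewrite !log_beta_integrand_power_pair by trivial.
replace (- (m + 1 + 1))%C with (- (m + 1) - 1)%C by ring.
rewrite power_pair_minus_r, power_pair_plus_l by trivial.
rewrite <- !Cmult_assoc, <- !RtoC_mult. do 2 f_equal. field. lra.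
Qed.

(** The identity [1 = 1 / (1 + x) + x / (1 + x)] under the integral: the first factor raises [m],
    the second raises [l] and [m] together. *)
Lemma log_beta_int_split n l m : 0 < Re l + INR n -> 0 < Re (m + 1 - l)%C ->
  (log_beta_int n l m = log_beta_int n l (m + 1) + log_beta_int n (l + 1) (m + 1))%C.
Proof.
intros Hl Hm.
apply (has_int_unique (log_beta_integrand n l m)).
- apply log_beta_int_has_int; trivial.
- eapply has_int_ext.
  2:{ apply has_int_plus; apply log_beta_int_has_int; unfold Re in *; simpl in *; lra. }
  intros x Hx. simpl. rewrite log_beta_l1_m1, log_beta_m1, log_beta_integrand_power_pair by trivial.
  rewrite <- !Cmult_assoc, <- !RtoC_mult, <- Cmult_plus_distr_l, <- RtoC_plus.
  do 2 f_equal. field. lra.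
Qed.

(** With [X = x^e] the left side is [X / (1 + X)^2] and the right side is [X / (1 + X)]. With the
    companion bound [1 / (1 + X)] at infinity, it shows that boundary terms of size [x * weight e x]
    vanish at both ends. *)
Lemma x_weight_le_0 e x : 0 < e -> 0 < x -> x * weight e x <= e * Rabs (weight_prim e x - - / e).
Proof.
intros He Hx. unfold weight, weight_prim. assert (H := exp_pos (e * ln x)).
set (X := exp (e * ln x)) in *.
replace (- / (e * (1 + X)) - - / e) with (X / (e * (1 + X))) by (field; split; lra).
assert (0 < / (1 + X) <= 1).
{ split. apply Rinv_0_lt_compat; lra. rewrite <- Rinv_1. apply Rinv_le_contravar; lra. }
rewrite Rabs_pos_eq by (apply Rlt_le, Rdiv_lt_0_compat; nra).
replace (x * (X / (x * (1 + X) ^ 2))) with ((X * / (1 + X)) * / (1 + X)) by (field; split; lra).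
replace (e * (X / (e * (1 + X)))) with ((X * / (1 + X)) * 1) by (field; split; lra).
apply Rmult_le_compat_l; nra.
Qed.

Lemma x_weight_le_infty e x : 0 < e -> 0 < x -> x * weight e x <= e * Rabs (weight_prim e x - 0).
Proof.
intros He Hx. unfold weight, weight_prim. assert (H := exp_pos (e * ln x)).
set (X := exp (e * ln x)) in *.
assert (0 < / (1 + X)) by (apply Rinv_0_lt_compat; lra).
rewrite Rminus_0_r, Rabs_Ropp, Rabs_pos_eq by (apply Rlt_le, Rinv_0_lt_compat; nra).
replace (x * (X / (x * (1 + X) ^ 2))) with (/ (1 + X) * (X * / (1 + X))) by (field; split; lra).
replace (e * (/ (e * (1 + X)))) with (/ (1 + X) * 1) by (field; split; lra).
apply Rmult_le_compat_l; [lra|].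
apply Rmult_le_reg_r with (1 + X); [lra|]. rewrite Rmult_assoc, Rinv_l; lra.
Qed.

Lemma tends_boundary {T} (F : (T -> Prop) -> Prop) {FF : Filter F} (f : T -> C) (x : T -> R)
  e K L : 0 < e -> 0 <= K -> F (fun t => 0 < x t) ->
  (forall t, 0 < x t -> Cmod (f t) <= x t * (K * weight e (x t))) ->
  (forall t, 0 < x t -> x t * weight e (x t) <= e * Rabs (weight_prim e (x t) - L)) ->
  (forall eps, 0 < eps -> F (fun t => Rabs (weight_prim e (x t) - L) < eps)) ->
  tends F f 0.
Proof.
intros He HK Hx Hf Hw Hp eps Heps.
assert (Hd : 0 < eps / (e * (K + 1))).
{ apply Rdiv_lt_0_compat; trivial. apply Rmult_lt_0_compat; lra. }
eapply filter_imp; [|apply (filter_and _ _ Hx (Hp _ Hd))].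
intros t [H1 H2]. simpl in *.
replace (f t - 0)%C with (f t) by ring.
eapply Rle_lt_trans. apply Hf, H1.
apply Rle_lt_trans with (K * (e * Rabs (weight_prim e (x t) - L))).
- replace (x t * (K * weight e (x t))) with (K * (x t * weight e (x t))) by ring.
  apply Rmult_le_compat_l; trivial. apply Hw, H1.
- assert (HA := Rabs_pos (weight_prim e (x t) - L)).
  apply Rle_lt_trans with ((K + 1) * e * Rabs (weight_prim e (x t) - L)). nra.
  replace eps with ((K + 1) * e * (eps / (e * (K + 1)))) by (field; lra).
  apply Rmult_lt_compat_l; trivial. apply Rmult_lt_0_compat; lra.
Qed.

Lemma has_int_zero_boundary (F f : R -> C) e K : 0 < e ->
  (forall x, 0 < x -> continuous_C f x) -> (forall x, 0 < x -> has_deriv F x (f x)) ->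
  (forall x, 0 < x -> Cmod (F x) <= x * (K * weight e x)) -> has_int f 0.
Proof.
intros He Hc HF Hb.
assert (HK : 0 <= K).
{ assert (H := Hb 1 Rlt_0_1). assert (H' := weight_pos e 1 Rlt_0_1).
  assert (H2 := Cmod_ge_0 (F 1)). nra. }
split; trivial. exists F, 0%C, 0%C. split; [trivial | split; [|split; [|ring]]].
- apply (tends_boundary (at_right 0) F (fun x => x) e K (- / e)); trivial.
  + apply at_right_0_pos.
  + intros t Ht; apply x_weight_le_0; trivial.
  + apply weight_prim_0, He.
- apply (tends_boundary (Rbar_locally p_infty) F (fun x => x) e K 0); trivial.
  + apply p_infty_gt.
  + intros t Ht; apply x_weight_le_infty; trivial.
  + apply weight_prim_p_infty, He.
Qed.

(** The function [x^l (1 + x)^(-(m+1)) ln^n (1 + x)] is [x] times the integrand, so the domination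
    of the integrand already makes its boundary values vanish; its derivative is the combination of
    the three integrands. *)
Lemma log_beta_int_parts n l m : 0 < Re l + INR n -> 0 < Re (m + 1 - l)%C ->
  (l * log_beta_int n l m = (m + 1) * log_beta_int n (l + 1) (m + 1)
     - RtoC (INR n) * log_beta_int (n - 1) (l + 1) (m + 1))%C.
Proof.
intros Hl Hm.
(* Raising [l] compensates the lost logarithm. For [n = 0] the truncated [n - 1] is again 0 and the
   term carries the coefficient 0. *)
assert (Hn : 0 < Re (l + 1)%C + INR (n - 1)).
{ destruct n as [|n]; [simpl in *; unfold Re in *; simpl; lra|].
  rewrite S_INR in Hl. replace (S n - 1)%nat with n by lia. unfold Re in *; simpl; lra. }
assert (H : has_int (fun x => l * log_beta_integrand n l m x +
  (- (m + 1) * log_beta_integrand n (l + 1) (m + 1) x +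
   RtoC (INR n) * log_beta_integrand (n - 1) (l + 1) (m + 1) x))%C 0).
{ destruct (log_beta_dominated n l m Hl Hm) as [d [e [K [Hd [He H]]]]].
  apply (has_int_zero_boundary (fun x => power_pair l (- (m + 1)) x * RtoC (ln (1 + x) ^ n))%C _ e K He).
  - intros x Hx. apply continuous_C_plus; [|apply continuous_C_plus]; (apply continuous_C_mult;
      [apply continuous_C_const | apply continuous_C_log_beta, Hx]).
  - intros x Hx. eapply has_deriv_eq.
    + apply has_deriv_mult. apply power_pair_has_deriv, Hx. apply has_deriv_RtoC.
      apply (is_derive_pow (fun x => ln (1 + x))). apply is_derive_ln_1p, Hx.
    + rewrite !log_beta_l1_m1, log_beta_integrand_power_pair by trivial.
      replace (Nat.pred n) with (n - 1)%nat by lia.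
      rewrite !RtoC_mult. ring.
  - intros x Hx. assert (B := dominated_weight _ _ _ _ (Rlt_le _ _ Hd) H x Hx).
    rewrite log_beta_integrand_power_pair in B by trivial.
    eapply Rle_trans.
    2:{ apply Rmult_le_compat_l. lra. exact B. }
    rewrite RtoC_mult, Cmult_assoc, (Cmod_mult _ (RtoC (/ x))), Cmod_R, Rabs_pos_eq.
    2:{ apply Rlt_le, Rinv_0_lt_compat, Hx. }
    right. field. lra. }
assert (E := has_int_plus _ _ _ _ (has_int_scal l _ _ (log_beta_int_has_int n l m Hl Hm))
 (has_int_plus _ _ _ _
   (has_int_scal (- (m + 1)) _ _ (log_beta_int_has_int n (l + 1) (m + 1) ltac:(unfold Re in *; simpl; lra)
      ltac:(unfold Re in *; simpl in *; lra)))
   (has_int_scal (RtoC (INR n)) _ _ (log_beta_int_has_int (n - 1) (l + 1) (m + 1) Hn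
      ltac:(unfold Re in *; simpl in *; lra))))).
assert (Q := has_int_unique _ _ _ E H).
replace (l * log_beta_int n l m)%C with (l * log_beta_int n l m + (- (m + 1) * log_beta_int n (l + 1) (m + 1) +
   RtoC (INR n) * log_beta_int (n - 1) (l + 1) (m + 1)) + ((m + 1) * log_beta_int n (l + 1) (m + 1)
     - RtoC (INR n) * log_beta_int (n - 1) (l + 1) (m + 1)))%C by ring.
rewrite Q. ring.
Qed.

(** The splitting, applied at orders [n] and [n - 1], eliminates the integrals at [l + 1] from the
    integration by parts, so that [l] stays fixed. *)
Lemma log_beta_int_succ_m n l m : 0 < Re l -> 0 < Re (m + 1 - l)%C ->
  ((m + 1) * log_beta_int n l (m + 1) = (m + 1 - l) * log_beta_int n l m
     - RtoC (INR n) * (log_beta_int (n - 1) l m - log_beta_int (n - 1) l (m + 1)))%C.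
Proof.
intros Hl Hm.
assert (Hn := pos_INR n). assert (Hn1 := pos_INR (n - 1)).
assert (S1 := log_beta_int_split n l m ltac:(lra) Hm).
assert (S2 := log_beta_int_split (n - 1) l m ltac:(lra) Hm).
assert (Q := log_beta_int_parts n l m ltac:(lra) Hm).
replace (log_beta_int (n - 1) l m - log_beta_int (n - 1) l (m + 1))%C with (log_beta_int (n - 1) (l + 1) (m + 1)).
2:{ rewrite S2. ring. }
replace (log_beta_int n l (m + 1)) with (log_beta_int n l m - log_beta_int n (l + 1) (m + 1))%C.
2:{ rewrite S1. ring. }
replace ((m + 1 - l) * log_beta_int n l m)%C with ((m + 1) * log_beta_int n l m - l * log_beta_int n l m)%C by ring.
rewrite Q. ring.
Qed.

(** For [m = l] the integrand is the derivative of [(x / (1 + x))^z / z], which runs from 0 to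
    [1 / z]. This one explicit beta value fixes the constant in Gauss's product. *)
Lemma log_beta_int_0_diag z : 0 < Re z -> log_beta_int 0 z z = (/ z)%C.
Proof.
intros Hz.
assert (Nz : z <> 0) by (intros ->; simpl in Hz; lra).
apply (has_int_unique (log_beta_integrand 0 z z)).
{ apply log_beta_int_has_int; simpl; lra. }
split. intros x Hx; apply continuous_C_log_beta, Hx.
exists (fun x => / z * power_pair z (- z) x)%C, 0%C, (/ z)%C.
assert (Ep : forall x, power_pair z (- z) x = Cexp (z * RtoC (ln_p x))).
{ intros x. unfold power_pair, ln_p. f_equal. rewrite RtoC_minus. ring. }
split; [|split; [|split; [|ring]]].
- intros x Hx. eapply has_deriv_eq. apply has_deriv_mult; [apply has_deriv_const | apply power_pair_has_deriv, Hx].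
  rewrite log_beta_integrand_power_pair by trivial. cbv beta.
  replace (- (z + 1))%C with (- z - 1)%C by ring.
  rewrite power_pair_minus_r by trivial. simpl pow.
  replace (z * RtoC (/ x) + - z * RtoC (/ (1 + x)))%C with (z * RtoC (/ x * / (1 + x)))%C.
  + rewrite !RtoC_mult. field. exact Nz.
  + replace (/ x * / (1 + x)) with (/ x - / (1 + x)) by (field; lra).
    rewrite RtoC_minus. ring.
- replace (RtoC 0) with (/ z * RtoC 0)%C by ring. apply tends_scal. apply _.
  intros eps He.
  eapply filter_imp; [|apply (at_right_0_lt (exp (ln eps / Re z))), exp_pos].
  intros x [X Y]. replace (power_pair z (- z) x - 0)%C with (power_pair z (- z) x) by ring.
  rewrite Ep, Cmod_Cexp. rewrite <- (exp_ln eps) by trivial. apply exp_increasing.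
  replace (Re (z * RtoC (ln_p x))) with (Re z * ln_p x) by (unfold Re; simpl; ring).
  apply ln_increasing in Y; trivial. rewrite ln_exp in Y.
  assert (K := ln_1p_pos x X). unfold ln_p.
  replace (ln eps) with (Re z * (ln eps / Re z)) by (field; lra).
  apply Rmult_lt_compat_l; lra.
- cut (tends (Rbar_locally p_infty) (fun x => / z * power_pair z (- z) x)%C (/ z * 1)%C).
  { rewrite Cmult_1_r; trivial. }
  apply tends_scal. apply _.
  intros eps He.
  set (M := Cmod z * exp (Cmod z)).
  assert (HM : 0 <= M) by (apply Rmult_le_pos; [apply Cmod_ge_0 | apply Rlt_le, exp_pos]).
  eapply filter_imp; [|apply (filter_and _ _ (p_infty_gt 1) (p_infty_gt (M / eps)))].
  intros x [X Y]. simpl in *. rewrite Ep.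
  (* At infinity [- ln_p x = ln (1 + 1 / x)] is at most [1 / x], so [p^z] tends to 1. *)
  assert (L : Cmod (z * RtoC (ln_p x)) <= Cmod z * / x).
  { rewrite Cmod_mult, Cmod_R. apply Rmult_le_compat_l. apply Cmod_ge_0.
    assert (K := ln_p_neg x ltac:(lra)). rewrite Rabs_left by trivial.
    unfold ln_p. replace (- (ln x - ln (1 + x))) with (ln ((1 + x) * / x)).
    2:{ rewrite ln_mult, ln_Rinv; try lra. apply Rinv_0_lt_compat; lra. }
    eapply Rle_trans. apply ln_le_minus_1. apply Rmult_lt_0_compat; [lra|apply Rinv_0_lt_compat; lra].
    right. field. lra. }
  assert (Ix : 0 < / x <= 1).
  { split. apply Rinv_0_lt_compat; lra. rewrite <- Rinv_1. apply Rinv_le_contravar; lra. }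
  eapply Rle_lt_trans. apply Cexp_minus_1_le.
  apply Rle_lt_trans with (Cmod z * / x * exp (Cmod z)).
  + apply Rmult_le_compat; trivial. apply Cmod_ge_0. apply Rlt_le, exp_pos.
    apply exp_le. assert (C0 := Cmod_ge_0 z). nra.
  + replace (Cmod z * / x * exp (Cmod z)) with (M / x) by (unfold M; field; lra).
    apply Rmult_lt_reg_r with x; [lra|]. unfold Rdiv at 1. rewrite Rmult_assoc, Rinv_l, Rmult_1_r by lra.
    apply Rmult_lt_compat_r with (r := eps) in Y; trivial.
    unfold Rdiv in Y. rewrite Rmult_assoc, Rinv_l, Rmult_1_r in Y by lra. lra.
Qed.

(** * Asymptotics for large [m] *)


Lemma ln_1p_le x : 0 < x -> ln (1 + x) <= x.
Proof. intros H. assert (K := ln_le_minus_1 (1 + x) ltac:(lra)). lra. Qed.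

Lemma ln_1p_ge x : 0 < x -> x / (1 + x) <= ln (1 + x).
Proof.
intros H. assert (H1 : 0 < / (1 + x)) by (apply Rinv_0_lt_compat; lra).
assert (K := ln_le_minus_1 (/ (1 + x)) H1). rewrite ln_Rinv in K by lra.
replace (x / (1 + x)) with (1 - / (1 + x)) by (field; lra). lra.
Qed.

(** That [(1 + x / s)^s] increases with [s]: both sides vanish at [x = 0], and the derivatives in
    [x] are ordered. It allows one exponent [s] to serve for all large [N]. *)
Lemma scaled_ln_1p_mono s N x : 0 < s -> s <= N -> 0 < x ->
  s * ln (1 + x / s) <= N * ln (1 + x / N).
Proof.
intros Hs HN Hx.
assert (W := derive_nonpos_decr (fun x => s * ln (1 + x / s) - N * ln (1 + x / N))
  (fun x => / (1 + x / s) - / (1 + x / N)) 0 x ltac:(lra)).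
cbv beta in W.
replace (0 / s) with 0 in W by (field; lra). replace (0 / N) with 0 in W by (field; lra).
rewrite Rplus_0_r, ln_1 in W.
assert (P : forall t u, 0 <= t -> 0 < u -> 0 < 1 + t / u).
{ intros t u Ht Hu. assert (0 <= t / u) by (apply Rmult_le_pos; [|apply Rlt_le, Rinv_0_lt_compat]; lra). lra. }
assert (s * ln (1 + x / s) - N * ln (1 + x / N) <= s * 0 - N * 0); [apply W | lra].
- intros t Ht. assert (P1 := P t s ltac:(lra) Hs). assert (P2 := P t N ltac:(lra) ltac:(lra)).
  auto_derive. repeat split; trivial; lra.
  field. repeat split; lra.
- intros t Ht. assert (P1 := P t s ltac:(lra) Hs). assert (P2 := P t N ltac:(lra) ltac:(lra)).
  assert (/ (1 + t / s) <= / (1 + t / N)); [|lra].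
  apply Rinv_le_contravar; trivial. apply Rplus_le_compat_l.
  apply Rmult_le_compat_l. lra. apply Rinv_le_contravar; lra.
Qed.

(** By monotonicity [(1 + x / N)^(-N) <= (1 + x / s)^(-s)], and [1 + x / s >= (1 + x) / s] because
    [s >= 1]. *)
Lemma exp_opp_scaled_ln_le s N x : 1 <= s -> s <= N -> 0 < x ->
  exp (- (N * ln (1 + x / N))) <= exp (s * ln s) * exp (s * ln_q x).
Proof.
intros Hs HN Hx. rewrite <- exp_plus. apply exp_le. unfold ln_q.
assert (M := scaled_ln_1p_mono s N x ltac:(lra) HN Hx).
assert (ln ((1 + x) / s) <= ln (1 + x / s)).
{ apply ln_le. apply Rdiv_lt_0_compat; lra.
  replace (1 + x / s) with ((s + x) / s) by (field; lra).
  apply Rmult_le_compat_r; [apply Rlt_le, Rinv_0_lt_compat|]; lra. }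
rewrite ln_div in H by lra.
assert (s * (ln (1 + x) - ln s) <= s * ln (1 + x / s)) by (apply Rmult_le_compat_l; lra).
lra.
Qed.

(** Of the decay [(1 + x)^(-(2 sg + k))] taken from [(1 + x / N)^(-N)], the part [k] absorbs the
    polynomial factor, and the part [2 sg] turns [x^sg] into [p^sg q^sg]. *)
Lemma asymptotic_weight_le sg k N x : 0 < sg -> 1 <= k -> 2 * sg + k <= N -> 0 < x ->
  exp (sg * ln x) * / x * exp (- (N * ln (1 + x / N))) * exp (k * ln (1 + x)) <=
  exp ((2 * sg + k) * ln (2 * sg + k)) * 4 * weight sg x.
Proof.
intros Hs Hk HN Hx. set (s := 2 * sg + k) in *.
assert (B := exp_opp_scaled_ln_le s N x ltac:(unfold s; lra) HN Hx).
set (A := exp (s * ln s)) in *.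
assert (Hix := Rinv_0_lt_compat x Hx).
rewrite Rmult_assoc.
apply Rle_trans with (A * (exp (sg * ln_p x + sg * ln_q x) * / x)).
- apply Rle_trans with (exp (sg * ln x) * / x * (A * exp (s * ln_q x)) * exp (k * ln (1 + x))).
  + rewrite <- Rmult_assoc. apply Rmult_le_compat_r. apply Rlt_le, exp_pos.
    apply Rmult_le_compat_l; trivial. apply Rlt_le, Rmult_lt_0_compat; trivial. apply exp_pos.
  + right. replace (sg * ln_p x + sg * ln_q x) with (sg * ln x + (s * ln_q x + k * ln (1 + x)))
      by (unfold s, ln_p, ln_q; ring).
    rewrite (exp_plus (sg * ln x)), (exp_plus (s * ln_q x)). ring.
- rewrite (Rmult_assoc A). apply Rmult_le_compat_l. apply Rlt_le, exp_pos.
  apply exp_ln_p_ln_q_le_weight; lra.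
Qed.

Lemma Gamma_has_int z : 0 < Re z -> has_int (Gamma_integrand z) (Gamma_integral z).
Proof.
intros Hz.
destruct (Gamma_dominated z Hz) as [d [e [K [Hd [He H]]]]].
destruct (has_int_dominated (Gamma_integrand z) e K He) as [v Hv].
- intros x Hx; apply continuous_C_Gamma_integrand, Hx.
- apply (dominated_weight _ d); trivial. lra.
- assert (E : Gamma_integral z = v) by exact (has_int_eq _ _ Hv). rewrite E. exact Hv.
Qed.

(* [N^l] times the integrand of [I_n(l, m + N)] after the substitution [x / N]. *)
Definition scaled_integrand (n : nat) (l m : C) (N x : R) : C :=
  (power_pair l 0 x * RtoC (/ x) * (Cexp (- (m + 1) * RtoC (ln (1 + x / N))) *
    RtoC (exp (- (N * ln (1 + x / N))) * ln (1 + x / N) ^ n)))%C.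

Lemma scaled_integrand_has_int n l m N : 0 < Re l -> 0 < Re (m + 1 - l)%C -> 0 < N ->
  has_int (scaled_integrand n l m N) (Cexp (l * RtoC (ln N)) * log_beta_int n l (m + RtoC N))%C.
Proof.
intros Hl Hm HN. assert (Hn := pos_INR n).
assert (HiN := Rinv_0_lt_compat N HN).
assert (H := log_beta_int_has_int n l (m + RtoC N) ltac:(lra) ltac:(unfold Re in *; simpl in *; lra)).
apply (has_int_comp_scal (/ N) _ _ HiN) in H.
apply (has_int_scal (Cexp (l * RtoC (ln N)))) in H.
eapply has_int_ext; [|exact H].
intros x Hx. cbv beta.
rewrite log_beta_integrand_power_pair by (apply Rmult_lt_0_compat; trivial).
unfold scaled_integrand, power_pair. replace (/ N * x) with (x / N) by (unfold Rdiv; ring).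
set (L := ln (1 + x / N)).
replace (l * RtoC (ln (x / N)) + - (m + RtoC N + 1) * RtoC L)%C with
  ((l * RtoC (ln x) + 0 * RtoC (ln (1 + x))) + (- (m + 1) * RtoC L + (- (l * RtoC (ln N)) + RtoC (- (N * L)))))%C.
2:{ rewrite ln_div, RtoC_minus, RtoC_opp, RtoC_mult by lra. ring. }
rewrite (Cexp_plus (_ + _)), (Cexp_plus (- (m + 1) * RtoC L)), (Cexp_plus (- (l * RtoC (ln N)))),
  Cexp_opp, Cexp_RtoC.
replace (/ (x / N)) with (N * / x) by (field; split; lra).
rewrite !RtoC_mult, !RtoC_inv by lra. field.
repeat split; try apply Cexp_neq_0; intros Q; apply RtoC_inj in Q; lra.
Qed.

Lemma Cmod_power_pair_0 l x : Cmod (power_pair l 0 x) = exp (Re l * ln x).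
Proof. unfold power_pair. rewrite Cmod_Cexp. f_equal. unfold Re; simpl; ring. Qed.

Lemma scaled_ln_bounds N x : 1 <= N -> 0 < x ->
  0 < ln (1 + x / N) /\ ln (1 + x / N) <= x / N /\ ln (1 + x / N) <= ln (1 + x) /\
  0 <= x - N * ln (1 + x / N) <= x ^ 2 / N.
Proof.
intros HN Hx. assert (P : 0 < x / N) by (apply Rdiv_lt_0_compat; lra).
assert (B1 := ln_1p_le _ P). assert (B2 := ln_1p_ge _ P).
assert (E : N * (x / N) = x) by (field; lra).
repeat split; trivial.
- apply ln_1p_pos, P.
- apply ln_le; [lra|]. apply Rplus_le_compat_l.
  rewrite <- E at 2. rewrite <- (Rmult_1_l (x / N)) at 1. apply Rmult_le_compat_r; lra.
- apply Rmult_le_compat_l with (r := N) in B1; lra.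
- apply Rmult_le_compat_l with (r := N) in B2; [|lra].
  assert (E2 : x - N * (x / N / (1 + x / N)) = x ^ 2 / (N + x)) by (field; lra).
  assert (x ^ 2 / (N + x) <= x ^ 2 / N).
  { apply Rmult_le_compat_l. nra. apply Rinv_le_contravar; lra. }
  lra.
Qed.

Lemma exp_ln_1p_ge x : 0 < x -> x <= exp (ln (1 + x)).
Proof. intros H. rewrite exp_ln; lra. Qed.

Lemma exp_opp_minus_le a b : 0 <= b - a -> Rabs (exp (- a) - exp (- b)) <= exp (- a) * (b - a).
Proof.
intros H. replace (exp (- b)) with (exp (- a) * exp (- (b - a))).
2:{ rewrite <- exp_plus. f_equal. ring. }
assert (E := exp_ineq1_le (- (b - a))). assert (P := exp_pos (- a)).
assert (exp (- (b - a)) <= 1) by (rewrite <- exp_0; apply exp_le; lra).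
rewrite Rabs_pos_eq; nra.
Qed.

Lemma Cmod_Cexp_scal_le c t : 0 <= t -> Cmod (Cexp (- c * RtoC t)) <= exp (Cmod c * t).
Proof.
intros Ht. rewrite Cmod_Cexp. apply exp_le.
replace (Re (- c * RtoC t)) with (t * - Re c) by (unfold Re; simpl; ring).
assert (K := re_le_Cmod c). apply Rabs_le_between in K. nra.
Qed.

Lemma Cmod_Cexp_scal_minus_1_le c t : 0 <= t ->
  Cmod (Cexp (- c * RtoC t) - 1) <= Cmod c * t * exp (Cmod c * t).
Proof.
intros Ht. assert (K := Cexp_minus_1_le (- c * RtoC t)).
rewrite Cmod_mult, Cmod_opp, Cmod_R, Rabs_pos_eq in K; trivial.
Qed.

(** Two errors of order [1 / N]: the factor [(1 + x / N)^(-(m+1))] differs from 1 by at most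
    [M (x / N) (1 + x)^M], and [(1 + x / N)^(-N)] differs from [exp (- x)] by at most itself times
    [x^2 / N]. Both grow no faster than [(1 + x)^(M + 2)], which explains the threshold on [N]. *)
Lemma scaled_integrand_0_close l m : 0 < Re l -> exists K, forall N x,
  2 * Re l + (Cmod (m + 1) + 2) <= N -> 0 < x ->
  Cmod (scaled_integrand 0 l m N x - Gamma_integrand l x) <= K / N * weight (Re l) x.
Proof.
intros Hl. set (M := Cmod (m + 1)). assert (HM : 0 <= M) by apply Cmod_ge_0.
set (s := 2 * Re l + (M + 2)).
exists ((M + 1) * (exp (s * ln s) * 4)). intros N x HN Hx.
unfold s in HN. assert (HN1 : 1 <= N) by lra.
destruct (scaled_ln_bounds N x HN1 Hx) as [L0 [L1 [L2 L3]]].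
rewrite Gamma_integrand_power_pair by trivial. unfold scaled_integrand.
set (L := ln (1 + x / N)) in *.
replace (power_pair l 0 x * RtoC (/ x) * (Cexp (- (m + 1) * RtoC L) * RtoC (exp (- (N * L)) * L ^ 0)) -
  power_pair l 0 x * RtoC (exp (- x) * / x))%C with
  (power_pair l 0 x * RtoC (/ x) * ((Cexp (- (m + 1) * RtoC L) - 1) * RtoC (exp (- (N * L))) +
     RtoC (exp (- (N * L)) - exp (- x))))%C.
2:{ simpl pow. rewrite Rmult_1_r, RtoC_mult, RtoC_minus. ring. }
assert (Hix := Rinv_0_lt_compat x Hx).
rewrite !Cmod_mult, Cmod_power_pair_0, Cmod_R, (Rabs_pos_eq (/ x)) by lra.
assert (HLx : 0 < ln (1 + x)) by (apply ln_1p_pos, Hx).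
assert (HiN : 0 < / N) by (apply Rinv_0_lt_compat; lra).
assert (T : Cmod ((Cexp (- (m + 1) * RtoC L) - 1) * RtoC (exp (- (N * L))) +
     RtoC (exp (- (N * L)) - exp (- x))) <=
   (M + 1) / N * (exp (- (N * L)) * exp ((M + 2) * ln (1 + x)))).
{ set (y := exp (ln (1 + x))).
  assert (Hy1 : x <= y) by (apply exp_ln_1p_ge, Hx).
  assert (Hy2 : 1 <= y) by (unfold y; rewrite exp_ln; lra).
  set (z := exp (M * ln (1 + x))).
  assert (Hz : 1 <= z) by (unfold z; rewrite <- exp_0 at 1; apply exp_le; nra).
  replace (exp ((M + 2) * ln (1 + x))) with (z * (y * y)).
  2:{ unfold z, y. rewrite <- !exp_plus. f_equal. ring. }
  set (q := exp (- (N * L))). assert (Hq : 0 < q) by apply exp_pos.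
  eapply Rle_trans. apply Cmod_triangle.
  rewrite Cmod_mult, !Cmod_R, (Rabs_pos_eq q) by lra.
  assert (T1 : Cmod (Cexp (- (m + 1) * RtoC L) - 1) <= M * (y * / N) * z).
  { eapply Rle_trans. apply Cmod_Cexp_scal_minus_1_le; lra. fold M.
    apply Rmult_le_compat. apply Rmult_le_pos; lra. apply Rlt_le, exp_pos.
    apply Rmult_le_compat_l; trivial. eapply Rle_trans. exact L1.
    apply Rmult_le_compat_r; lra.
    apply exp_le. apply Rmult_le_compat_l; lra. }
  assert (T2 : Rabs (q - exp (- x)) <= q * (y * y * / N)).
  { eapply Rle_trans. apply exp_opp_minus_le. lra. apply Rmult_le_compat_l; [lra|].
    eapply Rle_trans. apply L3. apply Rmult_le_compat_r; nra. }
  apply Rle_trans with (M * (y * / N) * z * q + q * (y * y * / N)).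
  { apply Rplus_le_compat; trivial. apply Rmult_le_compat_r; lra. }
  replace ((M + 1) / N * (q * (z * (y * y)))) with
    (q * / N * (M * (y * y) * z + y * y * z)) by (unfold Rdiv; ring).
  replace (M * (y * / N) * z * q + q * (y * y * / N)) with
    (q * / N * (M * (y * 1) * z + y * y * 1)) by ring.
  apply Rmult_le_compat_l. apply Rlt_le, Rmult_lt_0_compat; trivial.
  apply Rplus_le_compat.
  - apply Rmult_le_compat_r. lra. apply Rmult_le_compat_l; trivial.
    apply Rmult_le_compat_l; lra.
  - apply Rmult_le_compat_l; nra. }
eapply Rle_trans.
{ apply Rmult_le_compat_l; [|exact T]. apply Rlt_le, Rmult_lt_0_compat; trivial. apply exp_pos. }
assert (W := asymptotic_weight_le (Re l) (M + 2) N x Hl ltac:(lra) HN Hx).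
fold s L in W.
replace (exp (Re l * ln x) * / x * ((M + 1) / N * (exp (- (N * L)) * exp ((M + 2) * ln (1 + x)))))
 with ((M + 1) / N * (exp (Re l * ln x) * / x * exp (- (N * L)) * exp ((M + 2) * ln (1 + x)))) by (unfold Rdiv; ring).
replace ((M + 1) * (exp (s * ln s) * 4) / N * weight (Re l) x) with
  ((M + 1) / N * (exp (s * ln s) * 4 * weight (Re l) x)) by (unfold Rdiv; ring).
apply Rmult_le_compat_l; trivial.
apply Rmult_le_pos; lra.
Qed.

(** One logarithm is bounded by [x / N] and provides the rate; the other [n] are bounded by powers
    of [1 + x], uniformly in [N]. *)
Lemma scaled_integrand_S_small n l m : 0 < Re l -> exists K, forall N x,
  2 * Re l + (Cmod (m + 1) + INR (S n)) <= N -> 0 < x ->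
  Cmod (scaled_integrand (S n) l m N x) <= K / N * weight (Re l) x.
Proof.
intros Hl. set (M := Cmod (m + 1)). assert (HM : 0 <= M) by apply Cmod_ge_0.
assert (Hn := pos_INR n).
set (s := 2 * Re l + (M + INR (S n))).
exists (exp (s * ln s) * 4). intros N x HN Hx.
unfold s in HN. assert (HN1 : 1 <= N) by (rewrite S_INR in HN; lra).
destruct (scaled_ln_bounds N x HN1 Hx) as [L0 [L1 [L2 L3]]].
unfold scaled_integrand.
set (L := ln (1 + x / N)) in *.
assert (Hix := Rinv_0_lt_compat x Hx).
assert (HLx : 0 < ln (1 + x)) by (apply ln_1p_pos, Hx).
assert (HiN : 0 < / N) by (apply Rinv_0_lt_compat; lra).
assert (HLn : 0 < L ^ S n) by (apply pow_lt; trivial).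
set (q := exp (- (N * L))). assert (Hq : 0 < q) by apply exp_pos.
rewrite !Cmod_mult, Cmod_power_pair_0, !Cmod_R, (Rabs_pos_eq (/ x)), (Rabs_pos_eq (q * L ^ S n))
  by (try apply Rmult_le_pos; lra).
assert (T : Cmod (Cexp (- (m + 1) * RtoC L)) * (q * L ^ S n) <=
  / N * (q * exp ((M + INR (S n)) * ln (1 + x)))).
{ apply Rle_trans with (exp (M * ln (1 + x)) * (q * (/ N * exp (INR (S n) * ln (1 + x))))).
  - apply Rmult_le_compat. apply Cmod_ge_0. apply Rmult_le_pos; lra.
    + eapply Rle_trans. apply Cmod_Cexp_scal_le; lra. apply exp_le, Rmult_le_compat_l; trivial.
    + apply Rmult_le_compat_l; [lra|].
      assert (Ex : exp (INR (S n) * ln (1 + x)) = (1 + x) ^ S n).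
      { fold (Rpower (1 + x) (INR (S n))). apply Rpower_pow; lra. }
      rewrite Ex. simpl pow.
      apply Rle_trans with ((/ N * (1 + x)) * (1 + x) ^ n).
      * apply Rmult_le_compat; trivial. lra. apply pow_le; lra.
        eapply Rle_trans. exact L1. unfold Rdiv. rewrite Rmult_comm.
        apply Rmult_le_compat_l; lra.
        apply pow_incr. split; [lra|]. eapply Rle_trans. exact L2.
        eapply Rle_trans. apply ln_1p_le, Hx. lra.
      * right; ring.
  - right. rewrite Rmult_plus_distr_r, exp_plus. ring. }
eapply Rle_trans.
{ apply Rmult_le_compat_l; [|exact T]. apply Rlt_le, Rmult_lt_0_compat; trivial. apply exp_pos. }
assert (W := asymptotic_weight_le (Re l) (M + INR (S n)) N x Hl ltac:(rewrite S_INR; lra) HN Hx).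
fold s L in W. fold q in W.
replace (exp (Re l * ln x) * / x * (/ N * (q * exp ((M + INR (S n)) * ln (1 + x)))))
 with (/ N * (exp (Re l * ln x) * / x * q * exp ((M + INR (S n)) * ln (1 + x)))) by ring.
replace (exp (s * ln s) * 4 / N * weight (Re l) x) with
  (/ N * (exp (s * ln s) * 4 * weight (Re l) x)) by (unfold Rdiv; ring).
apply Rmult_le_compat_l; trivial. lra.
Qed.

Lemma eventually_INR_ge (A : R) : eventually (fun N => A <= INR N).
Proof.
destruct (nfloor_ex (Rabs A) (Rabs_pos A)) as [k [_ Hk]].
exists (S k). intros N HN. apply le_INR in HN. rewrite S_INR in HN.
assert (H := Rle_abs A). lra.
Qed.

Lemma eventually_div_INR_lt (K eps : R) : 0 < eps -> eventually (fun N => K / INR N < eps).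
Proof.
intros He. eapply filter_imp; [|apply (eventually_INR_ge (Rabs K / eps + 1))].
intros N HN. simpl in *.
assert (0 <= Rabs K / eps) by (apply Rmult_le_pos; [apply Rabs_pos | apply Rlt_le, Rinv_0_lt_compat, He]).
apply Rmult_lt_reg_r with (INR N); [lra|].
unfold Rdiv at 1. rewrite Rmult_assoc, Rinv_l, Rmult_1_r by lra.
assert (H2 := Rle_abs K). 
assert (eps * (Rabs K / eps + 1) <= eps * INR N) by (apply Rmult_le_compat_l; lra).
replace (eps * (Rabs K / eps + 1)) with (Rabs K + eps) in H0 by (field; lra). lra.
Qed.

Lemma log_beta_int_asymptotic n l m : 0 < Re l -> 0 < Re (m + 1 - l)%C ->
  tends eventually (fun N => Cexp (l * RtoC (ln (INR N))) * log_beta_int n l (m + RtoC (INR N)))%C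
    (match n with O => Gamma_integral l | S _ => 0 end).
Proof.
intros Hl Hm.
assert (Q : exists K A, forall N, A <= INR N -> Cmod (Cexp (l * RtoC (ln (INR N))) * log_beta_int n l (m + RtoC (INR N)) -
   match n with O => Gamma_integral l | S _ => 0 end)%C <= K / Re l / INR N).
{ destruct n as [|n].
  - destruct (scaled_integrand_0_close l m Hl) as [K HK].
    exists K, (2 * Re l + (Cmod (m + 1) + 2)). intros N HN.
    assert (HM := Cmod_ge_0 (m + 1)). assert (HN0 : 0 < INR N) by lra.
    replace (K / Re l / INR N) with (K / INR N / Re l) by (field; lra).
    apply (has_int_bound (fun x => scaled_integrand 0 l m (INR N) x - Gamma_integrand l x)%C); trivial.
    + eapply has_int_ext.
      2:{ apply has_int_plus. apply scaled_integrand_has_int; eassumption.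
          replace (- Gamma_integral l)%C with ((-1) * Gamma_integral l)%C by ring.
          apply has_int_scal, Gamma_has_int, Hl. }
      intros x Hx. cbv beta. ring.
    + intros x Hx. apply HK; trivial.
  - destruct (scaled_integrand_S_small n l m Hl) as [K HK].
    exists K, (2 * Re l + (Cmod (m + 1) + INR (S n))). intros N HN.
    assert (HM := Cmod_ge_0 (m + 1)). assert (Hn := pos_INR (S n)).
    assert (HN0 : 0 < INR N) by lra.
    replace (K / Re l / INR N) with (K / INR N / Re l) by (field; lra).
    replace (Cexp (l * RtoC (ln (INR N))) * log_beta_int (S n) l (m + RtoC (INR N)) - 0)%C with
      (Cexp (l * RtoC (ln (INR N))) * log_beta_int (S n) l (m + RtoC (INR N)))%C by ring.
    apply (has_int_bound (scaled_integrand (S n) l m (INR N))); trivial.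
    + apply scaled_integrand_has_int; trivial.
    + intros x Hx. apply HK; trivial. }
destruct Q as [K [A H]].
apply (tends_le eventually _ (fun N => K / Re l / INR N)).
- eapply filter_imp; [|apply (eventually_INR_ge A)]. exact H.
- intros eps He. apply eventually_div_INR_lt, He.
Qed.

(** * Euler's integral *)


Lemma nonpole_plus_neq_0 z k : ~ nonpos_integer z -> (z + RtoC (INR k))%C <> 0.
Proof.
intros H E. apply H. exists k.
replace z with ((z + RtoC (INR k)) - RtoC (INR k))%C by ring.
rewrite E, RtoC_opp. ring.
Qed.

Lemma nonpole_neq_0 z : ~ nonpos_integer z -> z <> 0.
Proof.
intros H E. apply (nonpole_plus_neq_0 z 0 H). rewrite E. simpl. ring.
Qed.

Lemma nonpole_Re_pos z : 0 < Re z -> ~ nonpos_integer z.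
Proof.
intros H [k ->]. assert (K := pos_INR k). simpl in H. lra.
Qed.

Lemma nonpole_succ z : ~ nonpos_integer z -> ~ nonpos_integer (z + 1)%C.
Proof.
intros H [k E]. apply H. exists (S k).
replace z with (z + 1 - 1)%C by ring. rewrite E, S_INR, <- RtoC_minus. f_equal. ring.
Qed.

Lemma rising_neq_0 z k : ~ nonpos_integer z -> rising z k <> 0.
Proof.
intros H. induction k as [|k IH]; simpl.
- intros E; apply RtoC_inj in E; lra.
- apply Cmult_neq_0; trivial. apply nonpole_plus_neq_0, H.
Qed.

Lemma rising_S_l z k : rising z (S k) = (z * rising (z + 1) k)%C.
Proof.
induction k as [|k IH].
- simpl. ring.
- change (rising z (S (S k))) with (rising z (S k) * (z + RtoC (INR (S k))))%C.
  rewrite IH. simpl rising. rewrite S_INR, RtoC_plus. ring.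
Qed.

Lemma log_beta_int_0_shift N l m : 0 < Re l -> 0 < Re (m + 1 - l)%C ->
  (rising (m + 1) N * log_beta_int 0 l (m + RtoC (INR N)) = rising (m + 1 - l) N * log_beta_int 0 l m)%C.
Proof.
intros Hl Hm. induction N as [|N IH].
- simpl. replace (m + 0)%C with m by ring. ring.
- simpl rising. rewrite S_INR.
  assert (HN := pos_INR N).
  assert (K := log_beta_int_succ_m 0 l (m + RtoC (INR N)) Hl ltac:(unfold Re in *; simpl in *; lra)).
  simpl INR in K.
  replace (m + RtoC (INR N + 1))%C with (m + RtoC (INR N) + 1)%C by (rewrite RtoC_plus; ring).
  transitivity (rising (m + 1) N * ((m + RtoC (INR N) + 1) * log_beta_int 0 l (m + RtoC (INR N) + 1)))%C; [ring|].
  rewrite K.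
  transitivity ((rising (m + 1) N * log_beta_int 0 l (m + RtoC (INR N))) * (m + 1 - l + RtoC (INR N)))%C; [ring|].
  rewrite IH. ring.
Qed.

(** Gauss's [N^z N! / (z (z + 1) ... (z + N))] in disguise, as [Gauss_approx_eq] shows ([rising 1 N]
    is [N!]); in this form its limit is a case of the asymptotics. *)
Definition Gauss_approx (z : C) (N : nat) : C :=
  (Cexp (z * RtoC (ln (INR N))) * log_beta_int 0 z (z + RtoC (INR N)))%C.

Lemma Gauss_limit z : 0 < Re z -> tends eventually (Gauss_approx z) (Gamma_integral z).
Proof.
intros Hz. apply (log_beta_int_asymptotic 0 z z Hz). unfold Re in *; simpl; lra.
Qed.

Lemma Gauss_approx_eq z N : 0 < Re z ->
  (rising z N * (z + RtoC (INR N)) * Gauss_approx z N =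
   Cexp (z * RtoC (ln (INR N))) * rising 1 N)%C.
Proof.
intros Hz.
assert (H := log_beta_int_0_shift N z z Hz ltac:(unfold Re in *; simpl; lra)).
assert (E := rising_S_l z N). simpl rising in E.
rewrite E. unfold Gauss_approx.
transitivity (z * (rising (z + 1) N * log_beta_int 0 z (z + RtoC (INR N))) * Cexp (z * RtoC (ln (INR N))))%C; [ring|].
rewrite H, log_beta_int_0_diag by trivial.
replace (z + 1 - z)%C with (RtoC 1) by ring.
field. apply nonpole_neq_0, nonpole_Re_pos, Hz.
Qed.

Lemma Cmod_inv_le (z : C) r : 0 < r -> r <= Cmod z -> Cmod (/ z)%C <= / r.
Proof.
intros Hr H. rewrite Cmod_inv. apply Rinv_le_contravar; trivial.
apply Cmod_gt_0. lra.
Qed.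

Lemma tends_shift_ratio a w :
  tends eventually (fun N => (a + RtoC (INR N)) / (w + RtoC (INR N)))%C 1.
Proof.
apply (tends_le eventually _ (fun N => 2 * Cmod (a - w) / INR N)).
- eapply filter_imp; [|apply (eventually_INR_ge (2 * Cmod w + 1))].
  intros N HN. cbv beta in *. assert (Hw := Cmod_ge_0 w).
  assert (L : INR N / 2 <= Cmod (w + RtoC (INR N))).
  { assert (T := Cmod_triangle (w + RtoC (INR N)) (- w)).
    replace (w + RtoC (INR N) + - w)%C with (RtoC (INR N)) in T by ring.
    rewrite Cmod_opp, Cmod_R, Rabs_pos_eq in T by lra. lra. }
  assert (Nz : (w + RtoC (INR N))%C <> 0) by (apply Cmod_gt_0; lra).
  replace ((a + RtoC (INR N)) / (w + RtoC (INR N)) - 1)%C with ((a - w) * / (w + RtoC (INR N)))%C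
    by (field; trivial).
  rewrite Cmod_mult.
  replace (2 * Cmod (a - w) / INR N) with (Cmod (a - w) * / (INR N / 2)) by (field; lra).
  apply Rmult_le_compat_l. apply Cmod_ge_0. apply Cmod_inv_le; lra.
- intros eps He. apply eventually_div_INR_lt, He.
Qed.

(** For each [N], the product of [I_0(l, m)] with the Gauss approximant at [w] equals
    [(a + N) / (w + N)] times the approximant at [a] times [N^l I_0(l, m + N)]: the rising
    factorials cancel by the iterated recurrence, and [N^w = N^a N^l]. All factors have known
    limits. *)
Lemma log_beta_int_0_Gamma_integral l m : 0 < Re l -> 0 < Re (m + 1 - l)%C ->
  (log_beta_int 0 l m * Gamma_integral (m + 1) = Gamma_integral (m + 1 - l) * Gamma_integral l)%C.
Proof.
intros Hl Hm.
assert (Hw : 0 < Re (m + 1)%C) by (unfold Re in *; simpl in *; lra).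
set (w := (m + 1)%C) in *. set (a := (w - l)%C) in *.
apply (tends_unique eventually (fun N => log_beta_int 0 l m * Gauss_approx w N)%C).
- apply tends_scal. apply _. apply Gauss_limit, Hw.
- replace (Gamma_integral a * Gamma_integral l)%C with
    (1 * (Gamma_integral a * Gamma_integral l))%C by ring.
  apply (tends_ext eventually (fun N => (a + RtoC (INR N)) / (w + RtoC (INR N)) *
    (Gauss_approx a N * (Cexp (l * RtoC (ln (INR N))) * log_beta_int 0 l (m + RtoC (INR N)))))%C).
  2:{ apply tends_mult. apply _. apply tends_shift_ratio. apply tends_mult. apply _.
      apply Gauss_limit, Hm. apply (log_beta_int_asymptotic 0); trivial. }
  intros N.
  assert (N1 := rising_neq_0 w N (nonpole_Re_pos w Hw)).
  assert (N2 := nonpole_plus_neq_0 w N (nonpole_Re_pos w Hw)).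
  assert (E1 := Gauss_approx_eq w N Hw).
  assert (E2 := Gauss_approx_eq a N Hm).
  assert (E3 := log_beta_int_0_shift N l m Hl Hm). fold w in E3. fold a in E3.
  assert (Ew : Cexp (w * RtoC (ln (INR N))) =
    (Cexp (a * RtoC (ln (INR N))) * Cexp (l * RtoC (ln (INR N))))%C).
  { rewrite <- Cexp_plus. f_equal. unfold a. ring. }
  rewrite Ew in E1.
  set (el := Cexp (l * RtoC (ln (INR N)))) in *. set (ea := Cexp (a * RtoC (ln (INR N)))) in *.
  transitivity ((rising w N * (w + RtoC (INR N)) * Gauss_approx w N) * log_beta_int 0 l m /
    (rising w N * (w + RtoC (INR N))))%C.
  2:{ field. split; trivial. }
  rewrite E1.
  transitivity (el * (ea * rising 1 N) * log_beta_int 0 l m / (rising w N * (w + RtoC (INR N))))%C.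
  2:{ field. split; trivial. }
  rewrite <- E2.
  transitivity (el * (a + RtoC (INR N)) * Gauss_approx a N * (rising a N * log_beta_int 0 l m) /
     (rising w N * (w + RtoC (INR N))))%C.
  2:{ field. split; trivial. }
  rewrite <- E3. field. split; trivial.
Qed.

Lemma Gamma_integral_1 : Gamma_integral 1 = 1.
Proof.
apply (has_int_unique (Gamma_integrand 1)).
- apply Gamma_has_int. simpl; lra.
- split. intros x Hx; apply continuous_C_Gamma_integrand, Hx.
  exists (fun x => RtoC (- exp (- x))), (RtoC (-1)), (RtoC 0).
  split; [|split; [|split]].
  + intros x Hx. eapply has_deriv_eq.
    * apply has_deriv_RtoC. instantiate (1 := exp (- x)). auto_derive; trivial. ring.
    * unfold Gamma_integrand, Rpow_C. replace ((1 - 1) * RtoC (ln x))%C with (RtoC 0) by ring.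
      rewrite Cexp_0. ring.
  + intros eps He.
    eapply filter_imp; [|apply (at_right_0_lt eps He)].
    intros x [X Y]. rewrite <- RtoC_minus, Cmod_R.
    assert (K := exp_opp_minus_le 0 x ltac:(lra)). rewrite Ropp_0, exp_0 in K.
    replace (- exp (- x) - -1) with (1 - exp (- x)) by ring. lra.
  + intros eps He.
    eapply filter_imp; [|apply (p_infty_gt (- ln eps))].
    intros x X. rewrite <- RtoC_minus, Cmod_R.
    replace (- exp (- x) - 0) with (- exp (- x)) by ring. rewrite Rabs_Ropp, Rabs_pos_eq by apply Rlt_le, exp_pos.
    rewrite <- (exp_ln eps) by trivial. apply exp_increasing. lra.
  + rewrite <- RtoC_minus. f_equal. ring.
Qed.

(** The beta identity at [m = l = z], where the beta integral is [1 / z] and Gamma is 1 at 1. *)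
Lemma Gamma_integral_succ z : 0 < Re z -> Gamma_integral (z + 1) = (z * Gamma_integral z)%C.
Proof.
intros Hz. assert (H := log_beta_int_0_Gamma_integral z z Hz ltac:(unfold Re; simpl; lra)).
replace (z + 1 - z)%C with (RtoC 1) in H by ring.
rewrite log_beta_int_0_diag, Gamma_integral_1, Cmult_1_l in H by trivial.
rewrite <- H. field. apply nonpole_neq_0, nonpole_Re_pos, Hz.
Qed.

Lemma dominated_mono f d d' e K : d' <= d -> dominated f d e K -> dominated f d' e K.
Proof.
intros Hd H x Hx. eapply Rle_trans; [|apply H, Hx].
apply Rmult_le_compat_l. apply Cmod_ge_0. apply exp_le.
apply Rmult_le_compat_r; trivial. apply logsize_nonneg, Hx.
Qed.

Lemma Re_plus_pos z h r : Cmod h <= r -> r < Re z -> 0 < Re (z + h)%C.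
Proof.
intros H1 H2. assert (K := re_le_Cmod h). apply Rabs_le_between in K.
unfold Re in *; simpl. lra.
Qed.

Lemma Gamma_integral_ex_derive z : 0 < Re z ->
  ex_derive (K := C_AbsRing) (V := C_NormedModule) Gamma_integral z.
Proof.
intros Hz.
destruct (Gamma_dominated z Hz) as [d [e [K [Hd [He H]]]]].
(* The margin is cut down to [Re z] so that [z + h] stays in the right half-plane for [h] up to half
   of it. *)
assert (Hm : 0 < Rmin d (Re z)) by (apply Rmin_pos; trivial).
destruct (has_int_derive Gamma_integral Gamma_integrand ln z (Rmin d (Re z)) e K) as [l [_ Hl]]; trivial.
- apply (dominated_mono _ d); trivial. apply Rmin_l.
- apply continuous_C_Gamma_integrand.
- intros x Hx. apply (ex_derive_continuous (K := R_AbsRing) (V := R_NormedModule)).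
  auto_derive. exact Hx.
- intros x Hx. unfold logsize. assert (L := ln_1p_pos x Hx). lra.
- intros h x Hx. unfold Gamma_integrand, Rpow_C.
  replace ((z + h - 1) * RtoC (ln x))%C with ((z - 1) * RtoC (ln x) + h * RtoC (ln x))%C by ring.
  rewrite Cexp_plus. ring.
- intros h Hh. apply Gamma_has_int. apply (Re_plus_pos z h (Rmin d (Re z) / 2)); trivial.
  assert (R := Rmin_r d (Re z)). lra.
- exists l. exact Hl.
Qed.

Lemma ex_derive_C_tends f z : ex_derive (K := C_AbsRing) (V := C_NormedModule) f z ->
  forall u : nat -> C, tends eventually u z -> tends eventually (fun N => f (u N)) (f z).
Proof.
intros H u Hu.
apply (proj2 (tends_locally eventually _ _)).
assert (Cf := ex_derive_continuous _ _ H).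
eapply filterlim_comp; [|exact Cf].
intros Q [d Hd]. unfold filtermap.
eapply filter_imp; [|apply (Hu d), cond_pos].
intros N HN. apply Hd. exact HN.
Qed.

(* A zero [w] would propagate through [B(w/2, w/2) Gamma(w) = Gamma(w/2)^2] to
   all [w / 2^k], hence [Gamma(1 + w/2^k) = 0], against continuity at 1. *)
Lemma Gamma_integral_neq_0 w : 0 < Re w -> Gamma_integral w <> 0.
Proof.
intros Hw E.
set (u := fun k => (w * RtoC ((/ 2) ^ k))%C).
assert (Hu : forall k, 0 < Re (u k)).
{ intros k. unfold u. replace (Re (w * RtoC ((/ 2) ^ k))) with (Re w * (/ 2) ^ k) by (unfold Re; simpl; ring).
  apply Rmult_lt_0_compat; trivial. apply pow_lt. lra. }
assert (Z : forall k, Gamma_integral (u k) = 0).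
{ induction k as [|k IH].
  - unfold u. simpl. rewrite Cmult_1_r. exact E.
  (* In the beta identity, [l = u (S k)] and [m + 1 = u k] make [m + 1 - l] equal to [l] as well, so
     that the right side is a square. *)
  - assert (Ek : u k = (u (S k) + u (S k) - 1 + 1)%C).
    { unfold u. rewrite <- tech_pow_Rmult, RtoC_mult.
      replace (RtoC (/ 2)) with (/ RtoC 2)%C by (rewrite RtoC_inv; [reflexivity | lra]).
      field. }
    assert (K := log_beta_int_0_Gamma_integral (u (S k)) (u (S k) + u (S k) - 1)
      (Hu (S k))).
    rewrite <- Ek, IH in K.
    replace (u k - u (S k))%C with (u (S k)) in K by (rewrite Ek; ring).
    specialize (K (Hu (S k))). rewrite Cmult_0_r in K.
    destruct (Ceq_dec (Gamma_integral (u (S k))) 0) as [|NE]; trivial.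
    exfalso. apply (Cmult_neq_0 _ _ NE NE). symmetry; exact K. }
assert (T : tends eventually (fun k => u k + 1)%C 1).
{ replace (RtoC 1) with (0 + 1)%C at 1 by ring. apply tends_plus. apply _.
  2: apply tends_const, _.
  intros eps He. 
  assert (He' : 0 < eps / (Cmod w + 1)).
  { apply Rdiv_lt_0_compat; trivial. assert (K := Cmod_ge_0 w). lra. }
  destruct (pow_lt_1_zero (/ 2) ltac:(rewrite Rabs_pos_eq; lra) _ He') as [N0 HN].
  exists N0. intros k Hk. specialize (HN k Hk).
  replace (u k - 0)%C with (u k) by ring. unfold u. rewrite Cmod_mult, Cmod_R.
  assert (K := Cmod_ge_0 w). assert (K' := Rabs_pos ((/ 2) ^ k)).
  apply Rle_lt_trans with ((Cmod w + 1) * Rabs ((/ 2) ^ k)). nra.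
  replace eps with ((Cmod w + 1) * (eps / (Cmod w + 1))) by (field; lra).
  apply Rmult_lt_compat_l; lra. }
apply (ex_derive_C_tends Gamma_integral) in T.
2:{ apply Gamma_integral_ex_derive. simpl; lra. }
rewrite Gamma_integral_1 in T.
assert (Q : RtoC 1 = RtoC 0).
{ apply (tends_unique eventually _ _ _ T).
  apply (tends_ext eventually (fun _ => RtoC 0)); [|apply tends_const, _].
  intros k. rewrite Gamma_integral_succ, Z by apply Hu. ring. }
apply RtoC_inj in Q. lra.
Qed.

(** * The gamma and digamma functions *)


Lemma Gamma_shift_spec z : let k := Z.to_nat (up (- Re z)) in 0 < Re z + INR k.
Proof.
intros k. assert (H := proj1 (archimed (- Re z))).
destruct (Z_le_gt_dec 0 (up (- Re z))) as [L|L].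
- unfold k. rewrite INR_IZR_INZ, Z2Nat.id by trivial. lra.
- assert (IZR (up (- Re z)) <= 0) by (apply IZR_le; lia).
  assert (K := pos_INR k). lra.
Qed.

Lemma Gamma_Re_pos z : 0 < Re z -> Gamma z = Gamma_integral z.
Proof.
intros Hz. unfold Gamma.
replace (Z.to_nat (up (- Re z))) with 0%nat.
- simpl. replace (z + 0)%C with z by ring. field.
- assert (H := proj2 (archimed (- Re z))).
  assert (IZR (up (- Re z)) < 1) by lra. apply lt_IZR in H0.
  symmetry. destruct (up (- Re z)); trivial. lia.
Qed.

Lemma Gamma_integral_shift z k : 0 < Re z ->
  Gamma_integral (z + RtoC (INR k)) = (rising z k * Gamma_integral z)%C.
Proof.
intros Hz. induction k as [|k IH].
- simpl. replace (z + 0)%C with z by ring. ring.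
- rewrite S_INR, RtoC_plus, Cplus_assoc, Gamma_integral_succ.
  2:{ assert (K := pos_INR k). unfold Re in *; simpl. lra. }
  rewrite IH. simpl. ring.
Qed.

Lemma rising_plus z j k : rising z (j + k) = (rising z j * rising (z + RtoC (INR j)) k)%C.
Proof.
induction k as [|k IH].
- rewrite Nat.add_0_r. simpl. ring.
- rewrite Nat.add_succ_r. simpl. rewrite IH, plus_INR, RtoC_plus. ring.
Qed.

(** Independence of the shift: every admissible [k] gives the value that the least shift defines, by
    the functional equation of Euler's integral. *)
Lemma Gamma_rising z k : ~ nonpos_integer z -> 0 < Re z + INR k ->
  (Gamma z * rising z k)%C = Gamma_integral (z + RtoC (INR k)).
Proof.
intros Hz Hk. unfold Gamma. assert (H0 := Gamma_shift_spec z). cbv zeta in H0.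
set (k0 := Z.to_nat (up (- Re z))) in *.
assert (N0 := rising_neq_0 z k0 Hz).
destruct (le_lt_dec k0 k) as [L|L].
- replace k with (k0 + (k - k0))%nat by lia. set (j := (k - k0)%nat).
  rewrite rising_plus, plus_INR, RtoC_plus, Cplus_assoc, (Gamma_integral_shift (z + RtoC (INR k0)) j).
  field; trivial. unfold Re in *; simpl. lra.
- replace k0 with (k + (k0 - k))%nat in N0 |- * by lia. set (j := (k0 - k)%nat) in *.
  rewrite rising_plus in N0.
  rewrite rising_plus, plus_INR, RtoC_plus, Cplus_assoc, (Gamma_integral_shift (z + RtoC (INR k)) j).
  2:{ unfold Re in *; simpl. lra. }
  field. split; intros Q; apply N0; rewrite Q; ring.
Qed.

Lemma Gamma_succ z : ~ nonpos_integer z -> Gamma (z + 1) = (z * Gamma z)%C.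
Proof.
intros Hz. assert (Hz1 := nonpole_succ z Hz).
set (k := Z.to_nat (up (- Re z))). assert (H := Gamma_shift_spec z). cbv zeta in H. fold k in H.
assert (E1 := Gamma_rising (z + 1) k Hz1 ltac:(unfold Re in *; simpl; lra)).
assert (E2 := Gamma_rising z (S k) Hz ltac:(rewrite S_INR; lra)).
rewrite rising_S_l in E2.
replace (z + RtoC (INR (S k)))%C with (z + 1 + RtoC (INR k))%C in E2 by (rewrite S_INR, RtoC_plus; ring).
rewrite <- E1 in E2.
assert (N := rising_neq_0 (z + 1) k Hz1).
transitivity (Gamma (z + 1) * rising (z + 1) k / rising (z + 1) k)%C; [field; trivial|].
rewrite <- E2. field. trivial.
Qed.

Lemma Gamma_neq_0 z : ~ nonpos_integer z -> Gamma z <> 0.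
Proof.
intros Hz E. set (k := Z.to_nat (up (- Re z))). assert (H := Gamma_shift_spec z). cbv zeta in H. fold k in H.
assert (E1 := Gamma_rising z k Hz H). rewrite E, Cmult_0_l in E1.
apply (Gamma_integral_neq_0 (z + RtoC (INR k))). unfold Re in *; simpl; lra. symmetry; exact E1.
Qed.

Lemma Cinv_0 : (/ 0)%C = 0.
Proof. unfold Cinv; simpl. apply injective_projections; simpl; unfold Rdiv; ring. Qed.

(** The shift in the definition exceeds [k], so [rising] contains a zero factor and division by 0
    returns 0. With this value [Gamma_pred] is an identity on all of C and can be differentiated
    without looking at neighbourhoods. *)
Lemma Gamma_pole z : nonpos_integer z -> Gamma z = 0.
Proof.
intros [k ->]. unfold Gamma. assert (H := Gamma_shift_spec (RtoC (- INR k))). cbv zeta in H.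
set (k0 := Z.to_nat (up (- Re (RtoC (- INR k))))) in *.
assert (L : (k < k0)%nat).
{ apply INR_lt. unfold Re in H; simpl in H. lra. }
assert (E : rising (RtoC (- INR k)) k0 = 0).
{ replace k0 with (S k + (k0 - S k))%nat by lia. rewrite rising_plus.
  simpl rising. rewrite <- RtoC_plus. replace (- INR k + INR k) with 0 by ring. ring. }
rewrite E. unfold Cdiv. rewrite Cinv_0. ring.
Qed.

(* Both sides are 0 at the poles, by the conventions for division. *)
Lemma Gamma_pred z : Gamma z = (/ z * Gamma (z + 1))%C.
Proof.
destruct (Classical_Prop.classic (nonpos_integer z)) as [Hp|Hp].
- rewrite (Gamma_pole z Hp). destruct Hp as [[|k] ->].
  + simpl. replace (RtoC (- 0)) with (RtoC 0) by (f_equal; ring). rewrite Cinv_0. ring.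
  + rewrite (Gamma_pole (RtoC (- INR (S k)) + 1)). ring.
    exists k. rewrite S_INR, <- RtoC_plus. f_equal. ring.
- rewrite Gamma_succ by trivial. field. apply nonpole_neq_0, Hp.
Qed.

Lemma is_derive_Cinv (z : C) : z <> 0 ->
  is_derive (K := C_AbsRing) (V := C_NormedModule) Cinv z (- / (z * z))%C.
Proof.
intros Hz. apply Cmod_gt_0 in Hz.
apply (is_derive_C_quadratic Cinv z _ (Cmod z / 2) (2 / Cmod z ^ 3)). lra.
intros h Hh.
assert (L : Cmod z / 2 <= Cmod (z + h)).
{ assert (T := Cmod_triangle (z + h) (- h)). replace (z + h + - h)%C with z in T by ring.
  rewrite Cmod_opp in T. lra. }
assert (N1 : z <> 0) by (apply Cmod_gt_0; lra).
assert (N2 : (z + h)%C <> 0) by (apply Cmod_gt_0; lra).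
replace (/ (z + h) - / z - h * - / (z * z))%C with (h * h * / (z * z) * / (z + h))%C
  by (field; split; trivial).
rewrite !Cmod_mult, Cmod_inv, Cmod_mult by (apply Cmult_neq_0; trivial).
assert (I := Cmod_inv_le (z + h) (Cmod z / 2) ltac:(lra) L).
replace (2 / Cmod z ^ 3 * Cmod h ^ 2) with
  (Cmod h * Cmod h * / (Cmod z * Cmod z) * / (Cmod z / 2)) by (field; lra).
apply Rmult_le_compat_l; trivial. apply Rmult_le_pos. apply Rle_0_sqr.
apply Rlt_le, Rinv_0_lt_compat. nra.
Qed.

(** The product rule and the inner function of the chain rule live in the module of the ring over
    itself. The remainder condition is the same up to conversion, so only linearity is proved
    anew. *)
Lemma is_derive_C_AbsRing (f : C -> C) (z l : C) :
  is_derive (K := C_AbsRing) (V := C_NormedModule) f z l <->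
  is_derive (K := C_AbsRing) (V := AbsRing_NormedModule C_AbsRing) f z l.
Proof.
split; intros [_ H]; (split; [apply is_linear_scal_l | exact H]).
Qed.

Lemma is_derive_C_mult f g z l m :
  is_derive (K := C_AbsRing) (V := C_NormedModule) f z l ->
  is_derive (K := C_AbsRing) (V := C_NormedModule) g z m ->
  is_derive (K := C_AbsRing) (V := C_NormedModule) (fun z => f z * g z)%C z (l * g z + f z * m)%C.
Proof.
intros Hf Hg. apply is_derive_C_AbsRing in Hf, Hg. apply is_derive_C_AbsRing.
exact (is_derive_mult (K := C_AbsRing) f g z l m Hf Hg Cmult_comm).
Qed.

Lemma is_derive_C_shift f z c l :
  is_derive (K := C_AbsRing) (V := C_NormedModule) f (z + c)%C l ->
  is_derive (K := C_AbsRing) (V := C_NormedModule) (fun z => f (z + c)%C) z l.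
Proof.
intros Hf.
assert (Hs : is_derive (K := C_AbsRing) (V := C_NormedModule) (fun z : C => (z + c)%C) z (RtoC 1)).
{ apply (is_derive_C_quadratic (fun z => (z + c)%C) z _ 1 0). lra.
  intros h _. replace (z + h + c - (z + c) - h * 1)%C with (RtoC 0) by ring.
  rewrite Cmod_0. lra. }
assert (H := is_derive_comp (K := C_AbsRing) (V := C_NormedModule) f (fun z => (z + c)%C) z l (RtoC 1) Hf (proj1 (is_derive_C_AbsRing _ _ _) Hs)).
evar_last. exact H. change (1 * l = l)%C. ring.
Qed.

Lemma is_derive_C_ext_loc f g z l :
  locally (T := C_UniformSpace) z (fun y => f y = g y) ->
  is_derive (K := C_AbsRing) (V := C_NormedModule) f z l ->
  is_derive (K := C_AbsRing) (V := C_NormedModule) g z l.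
Proof.
intros H. apply is_derive_ext_loc. apply locally_C. exact H.
Qed.

Lemma locally_Re_gt z r : r < Re z -> locally (T := C_UniformSpace) z (fun y => r < Re y).
Proof.
intros H. assert (Hd : 0 < Re z - r) by lra.
exists (mkposreal _ Hd). intros y [B _].
unfold ball in B; simpl in B; unfold AbsRing_ball, abs, minus, plus, opp in B; simpl in B.
apply Rabs_lt_between in B. unfold Re in *. lra.
Qed.

Lemma Gamma_ex_derive z : ~ nonpos_integer z ->
  ex_derive (K := C_AbsRing) (V := C_NormedModule) Gamma z.
Proof.
intros Hz. set (k := Z.to_nat (up (- Re z))). assert (H := Gamma_shift_spec z). cbv zeta in H. fold k in H.
(* Induction on the number of unit steps that lead into the right half-plane, where Euler's integral
   is differentiable. *)
clearbody k. revert z Hz H. induction k as [|k IH]; intros z Hz H.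
- simpl in H. rewrite Rplus_0_r in H.
  destruct (Gamma_integral_ex_derive z H) as [l Hl]. exists l.
  apply (is_derive_C_ext_loc Gamma_integral); trivial.
  eapply filter_imp; [|apply (locally_Re_gt z 0 H)].
  intros y Hy. symmetry; apply Gamma_Re_pos, Hy.
- destruct (IH (z + 1)%C (nonpole_succ z Hz)) as [l Hl].
  { rewrite S_INR in H. unfold Re in *; simpl. lra. }
  eexists. apply (is_derive_ext (K := C_AbsRing) (V := C_NormedModule) (fun z => / z * Gamma (z + 1))%C).
  { intros y. symmetry. apply Gamma_pred. }
  apply is_derive_C_mult. apply is_derive_Cinv, nonpole_neq_0, Hz.
  apply is_derive_C_shift. exact Hl.
Qed.

Lemma Gamma_is_derive z : ~ nonpos_integer z ->
  is_derive (K := C_AbsRing) (V := C_NormedModule) Gamma z (digamma z * Gamma z)%C.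
Proof.
intros Hz. replace (digamma z * Gamma z)%C with (C_derive Gamma z).
2:{ unfold digamma. field. apply Gamma_neq_0, Hz. }
exact (C_derive_correct Gamma z z (Gamma_ex_derive z Hz)).
Qed.

Lemma is_derive_C_unique f z l m :
  is_derive (K := C_AbsRing) (V := C_NormedModule) f z l ->
  is_derive (K := C_AbsRing) (V := C_NormedModule) f z m -> l = m.
Proof.
intros H K. rewrite <- (is_C_derive_unique f z l H). apply is_C_derive_unique, K.
Qed.

(** Both sides come from differentiating [Gamma z = Gamma (z + 1) / z] and comparing with the
    derivative of [Gamma]. *)
Lemma digamma_succ z : ~ nonpos_integer z -> digamma (z + 1) = (digamma z + / z)%C.
Proof.
intros Hz. assert (N0 := nonpole_neq_0 z Hz). assert (NG := Gamma_neq_0 z Hz).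
assert (H : is_derive (K := C_AbsRing) (V := C_NormedModule) Gamma z
  (- / (z * z) * Gamma (z + 1) + / z * (digamma (z + 1) * Gamma (z + 1)))%C).
{ apply (is_derive_ext (K := C_AbsRing) (V := C_NormedModule) (fun z => / z * Gamma (z + 1))%C).
  { intros y. symmetry. apply Gamma_pred. }
  apply (is_derive_C_mult Cinv (fun z => Gamma (z + 1)%C) z _ (digamma (z + 1) * Gamma (z + 1))%C).
  apply is_derive_Cinv, N0.
  apply is_derive_C_shift, Gamma_is_derive, nonpole_succ, Hz. }
assert (E := is_derive_C_unique _ _ _ _ H (Gamma_is_derive z Hz)).
rewrite Gamma_succ in E by trivial.
assert (E2 : (digamma (z + 1) * Gamma z = (digamma z + / z) * Gamma z)%C).
{ rewrite Cmult_plus_distr_r, <- E. field. exact N0. }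
transitivity (digamma (z + 1) * Gamma z / Gamma z)%C; [field; trivial|].
rewrite E2. field. split; trivial.
Qed.

Lemma log_beta_int_0_Gamma l m : 0 < Re l -> 0 < Re (m + 1 - l)%C ->
  (log_beta_int 0 l m * Gamma (m + 1) = Gamma (m + 1 - l) * Gamma l)%C.
Proof.
intros Hl Hm. rewrite !Gamma_Re_pos; trivial. apply log_beta_int_0_Gamma_integral; trivial.
unfold Re in *; simpl in *; lra.
Qed.

Lemma log_beta_int_0_derive_m l m : 0 < Re l -> 0 < Re (m + 1 - l)%C ->
  is_derive (K := C_AbsRing) (V := C_NormedModule) (log_beta_int 0 l) m (- log_beta_int 1 l m)%C.
Proof.
intros Hl Hm.
destruct (log_beta_dominated 0 l m ltac:(simpl; lra) Hm) as [d [e [K [Hd [He H]]]]].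
set (d' := Rmin d (Re (m + 1 - l)%C)).
assert (Hd' : 0 < d') by (apply Rmin_pos; trivial).
destruct (has_int_derive (log_beta_int 0 l) (fun m => log_beta_integrand 0 l m) (fun x => - ln (1 + x)) m d' e K)
  as [v [Hv Hder]]; trivial.
- apply (dominated_mono _ d); trivial. apply Rmin_l.
- apply continuous_C_log_beta.
- intros x Hx. apply (ex_derive_continuous (K := R_AbsRing) (V := R_NormedModule)).
  auto_derive. lra.
- intros x Hx. unfold logsize. assert (L := ln_1p_pos x Hx). assert (L' := Rabs_pos (ln x)).
  rewrite Rabs_Ropp, Rabs_pos_eq; lra.
- intros h x Hx. rewrite !log_beta_integrand_power_pair by trivial. unfold power_pair.
  replace (l * RtoC (ln x) + - (m + h + 1) * RtoC (ln (1 + x)))%C with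
   (l * RtoC (ln x) + - (m + 1) * RtoC (ln (1 + x)) + h * RtoC (- ln (1 + x)))%C.
  2:{ rewrite RtoC_opp. ring. }
  rewrite (Cexp_plus (_ + _)). ring.
- intros h Hh. apply log_beta_int_has_int. simpl; lra.
  replace (m + h + 1 - l)%C with (m + 1 - l + h)%C by ring.
  apply (Re_plus_pos _ h (d' / 2)); trivial.
  assert (R := Rmin_r d (Re (m + 1 - l)%C)). fold d' in R. lra.
- replace (- log_beta_int 1 l m)%C with v; trivial.
  apply (has_int_unique _ _ _ Hv).
  apply (has_int_ext (fun x => (-1) * log_beta_integrand 1 l m x)%C).
  + intros x Hx. rewrite !log_beta_integrand_power_pair by trivial.
    simpl pow. rewrite !RtoC_mult, RtoC_opp. ring.
  + replace (- log_beta_int 1 l m)%C with ((-1) * log_beta_int 1 l m)%C by ring.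
    apply has_int_scal, log_beta_int_has_int; trivial. simpl; lra.
Qed.

Lemma log_beta_int_0_neq_0 l m : 0 < Re l -> 0 < Re (m + 1 - l)%C -> log_beta_int 0 l m <> 0.
Proof.
intros Hl Hm E. assert (H := log_beta_int_0_Gamma l m Hl Hm). rewrite E, Cmult_0_l in H.
apply (Cmult_neq_0 (Gamma (m + 1 - l)) (Gamma l)); [| |symmetry; exact H];
  apply Gamma_neq_0, nonpole_Re_pos; trivial.
Qed.

(** The logarithmic derivative in [m] of the beta identity. It is the only link between [psi] and
    the integrals, and it gives the decay of [s_1] along [m + N] without an asymptotic expansion of
    [psi]. *)
Lemma digamma_diff l m : 0 < Re l -> 0 < Re (m + 1 - l)%C ->
  (digamma (m + 1 - l) - digamma (m + 1))%C = (- (log_beta_int 1 l m / log_beta_int 0 l m))%C.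
Proof.
intros Hl Hm.
assert (Hw : 0 < Re (m + 1)%C) by (unfold Re in *; simpl in *; lra).
assert (N0 := log_beta_int_0_neq_0 l m Hl Hm).
assert (Nw := Gamma_neq_0 _ (nonpole_Re_pos _ Hw)).
assert (D1 := is_derive_C_mult _ _ _ _ _ (log_beta_int_0_derive_m l m Hl Hm)
  (is_derive_C_shift Gamma m 1 _ (Gamma_is_derive _ (nonpole_Re_pos _ Hw)))).
assert (E0 := log_beta_int_0_Gamma l m Hl Hm).
assert (Hm' : 0 < Re (m + (1 - l))%C) by (unfold Re in *; simpl in *; lra).
assert (D2 := is_derive_C_mult _ _ _ _ _ 
  (is_derive_C_shift Gamma m (1 - l) _ (Gamma_is_derive _ (nonpole_Re_pos _ Hm')))
  (is_derive_const (K := C_AbsRing) (V := C_NormedModule) (Gamma l : C_NormedModule) m)).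
assert (D3 : is_derive (K := C_AbsRing) (V := C_NormedModule) (fun z => log_beta_int 0 l z * Gamma (z + 1))%C m
  (digamma (m + (1 - l)) * Gamma (m + (1 - l)) * Gamma l + Gamma (m + (1 - l)) * 0)%C).
{ eapply is_derive_C_ext_loc; [|exact D2].
  eapply filter_imp; [|apply (locally_Re_gt m (Re (l - 1)%C))].
  - intros y Hy. cbv beta. rewrite log_beta_int_0_Gamma; trivial.
    + do 2 f_equal. ring.
    + unfold Re in *; simpl in *; lra.
  - unfold Re in *; simpl in *; lra. }
assert (E := is_derive_C_unique _ _ _ _ D1 D3). cbv beta in E.
replace (m + (1 - l))%C with (m + 1 - l)%C in E by ring.
assert (E2 : (digamma (m + 1 - l) * (Gamma (m + 1 - l) * Gamma l) =
   (- log_beta_int 1 l m + log_beta_int 0 l m * digamma (m + 1)) * Gamma (m + 1))%C).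
{ transitivity (digamma (m + 1 - l) * Gamma (m + 1 - l) * Gamma l + Gamma (m + 1 - l) * 0)%C; [ring|].
  rewrite <- E. ring. }
rewrite <- E0 in E2.
transitivity ((digamma (m + 1 - l) * (log_beta_int 0 l m * Gamma (m + 1)) / (log_beta_int 0 l m * Gamma (m + 1))
   - digamma (m + 1)))%C; [field; split; trivial|].
rewrite E2. field. split; trivial.
Qed.

(** * Formal power series *)


Local Notation Csum f n := (sum_n (G := C_AbelianMonoid) f n : C).

Lemma Csum_0 (f : nat -> C) : Csum f 0 = f 0%nat.
Proof. exact (sum_O (G := C_AbelianMonoid) f). Qed.

Lemma Csum_S (f : nat -> C) n : Csum f (S n) = (Csum f n + f (S n))%C.
Proof. exact (sum_Sn (G := C_AbelianMonoid) f n). Qed.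

Lemma Csum_ext (f g : nat -> C) n : (forall i, (i <= n)%nat -> f i = g i) -> Csum f n = Csum g n.
Proof. exact (sum_n_ext_loc (G := C_AbelianMonoid) f g n). Qed.

Lemma Csum_shift (f : nat -> C) n : Csum f (S n) = (f 0%nat + Csum (fun i => f (S i)) n)%C.
Proof.
induction n as [|n IH].
- rewrite Csum_S, !Csum_0. reflexivity.
- rewrite Csum_S, IH, Csum_S. ring.
Qed.

Lemma Csum_plus (f g : nat -> C) n : Csum (fun i => f i + g i)%C n = (Csum f n + Csum g n)%C.
Proof. exact (sum_n_plus (G := C_AbelianMonoid) f g n). Qed.

Lemma Csum_scal (c : C) (f : nat -> C) n : Csum (fun i => c * f i)%C n = (c * Csum f n)%C.
Proof.
induction n as [|n IH]; [rewrite !Csum_0; reflexivity|]. rewrite !Csum_S, IH. ring.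
Qed.

Lemma Csum_zero n : Csum (fun _ : nat => RtoC 0) n = RtoC 0.
Proof. induction n as [|n IH]; [apply Csum_0|]. rewrite Csum_S, IH. ring. Qed.

Lemma Csum_switch (u : nat -> nat -> C) n m :
  Csum (fun i => Csum (u i) n) m = Csum (fun j => Csum (fun i => u i j) m) n.
Proof. apply (sum_n_switch (G := C_AbelianMonoid)). Qed.

Lemma Csum_truncate (f : nat -> C) n m : (n <= m)%nat ->
  (forall i, (n < i)%nat -> f i = RtoC 0) -> Csum f m = Csum f n.
Proof.
intros L H. induction m as [|m IH].
- replace n with 0%nat by lia. reflexivity.
- destruct (Nat.eq_dec n (S m)) as [->|N]; trivial.
  rewrite Csum_S, IH, H by lia. ring.
Qed.

Lemma fps_mul_ext a a' b b' n : (forall i, (i <= n)%nat -> a i = a' i) ->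
  (forall i, (i <= n)%nat -> b i = b' i) -> fps_mul a b n = fps_mul a' b' n.
Proof.
intros Ha Hb. apply Csum_ext. intros i Hi. rewrite Ha, Hb by lia. reflexivity.
Qed.

(** Both sides are the sum over all [i + j <= n] of the triple products; extending the inner sums by
    zeros to a full square lets the two summations be exchanged. *)
Lemma fps_mul_left_comm f g h n : fps_mul f (fps_mul g h) n = fps_mul g (fps_mul f h) n.
Proof.
assert (W : forall f g : nat -> C, fps_mul f (fps_mul g h) n = Csum (fun i => Csum (fun j =>
  (if le_dec (i + j) n then f i * g j * h (n - (i + j))%nat else RtoC 0)%C) n) n).
{ intros f' g'. apply Csum_ext. intros i Hi. unfold fps_mul. rewrite <- Csum_scal.
  rewrite (Csum_truncate _ (n - i) n ltac:(lia)).
  - apply Csum_ext. intros j Hj. destruct le_dec; [|lia].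
    replace (n - i - j)%nat with (n - (i + j))%nat by lia. ring.
  - intros j Hj. destruct le_dec; [lia|reflexivity]. }
rewrite W, Csum_switch, W. apply Csum_ext. intros i Hi. apply Csum_ext. intros j Hj.
rewrite (Nat.add_comm j i). destruct le_dec; ring.
Qed.

Definition fps_deriv (a : nat -> C) (n : nat) : C := (RtoC (INR (S n)) * a (S n))%C.

Lemma fps_deriv_mul a b n : fps_deriv (fps_mul a b) n =
  (fps_mul (fps_deriv a) b n + fps_mul a (fps_deriv b) n)%C.
Proof.
unfold fps_deriv at 1, fps_mul at 1. rewrite <- Csum_scal.
rewrite (Csum_ext _ (fun i => (RtoC (INR i) * a i * b (S n - i)%nat) +
  (a i * (RtoC (INR (S n - i)) * b (S n - i)%nat)))%C).
2:{ intros i Hi. rewrite minus_INR, RtoC_minus by trivial. ring. }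
rewrite Csum_plus. f_equal.
- rewrite Csum_shift. unfold fps_mul, fps_deriv. simpl (INR 0).
  rewrite !Cmult_0_l, Cplus_0_l. reflexivity.
- rewrite Csum_S, Nat.sub_diag. unfold fps_mul, fps_deriv. simpl (INR 0).
  rewrite Cmult_0_l, Cmult_0_r, Cplus_0_r. apply Csum_ext. intros i Hi.
  replace (S n - i)%nat with (S (n - i)) by lia. reflexivity.
Qed.

Lemma fps_mul_scal_r c a b n : fps_mul a (fun i => c * b i)%C n = (c * fps_mul a b n)%C.
Proof.
unfold fps_mul. rewrite <- Csum_scal. apply Csum_ext. intros i Hi. ring.
Qed.

Lemma fps_deriv_pow a k n : fps_deriv (fps_pow a (S k)) n =
  (RtoC (INR (S k)) * fps_mul (fps_deriv a) (fps_pow a k) n)%C.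
Proof.
revert n. induction k as [|k IH]; intros n.
- change (fps_pow a 1) with (fps_mul a (fps_pow a 0)). rewrite fps_deriv_mul. simpl INR.
  replace (fps_mul a (fps_deriv (fps_pow a 0)) n) with (RtoC 0); [ring|].
  symmetry. rewrite <- (Csum_zero n). apply Csum_ext. intros i Hi.
  unfold fps_deriv. simpl. ring.
- change (fps_pow a (S (S k))) with (fps_mul a (fps_pow a (S k))). rewrite fps_deriv_mul.
  rewrite (fps_mul_ext a a (fps_deriv (fps_pow a (S k)))
    (fun i => (RtoC (INR (S k)) * fps_mul (fps_deriv a) (fps_pow a k) i)%C) n); auto.
  rewrite fps_mul_scal_r, fps_mul_left_comm, (S_INR (S k)), RtoC_plus.
  change (fps_mul a (fps_pow a k)) with (fps_pow a (S k)). ring.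
Qed.

Lemma fps_pow_low a k n : a 0%nat = RtoC 0 -> (n < k)%nat -> fps_pow a k n = RtoC 0.
Proof.
intros H0. revert n. induction k as [|k IH]; intros n Hn; [lia|].
simpl. rewrite <- (Csum_zero n). apply Csum_ext. intros i Hi.
destruct i as [|i]; [rewrite H0; ring|]. rewrite IH by lia. ring.
Qed.

Lemma fps_exp_0 a : fps_exp a 0 = 1%C.
Proof. unfold fps_exp. rewrite Csum_0. simpl. field. Qed.

Lemma INR_S_neq_0 n : RtoC (INR (S n)) <> 0.
Proof. intros E. apply RtoC_inj in E. assert (H := pos_INR n). rewrite S_INR in E. lra. Qed.

Lemma INR_fact_neq_0_C n : RtoC (INR (fact n)) <> 0.
Proof. intros E. apply RtoC_inj in E. exact (INR_fact_neq_0 n E). Qed.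

Lemma fps_exp_deriv a n : a 0%nat = RtoC 0 ->
  fps_deriv (fps_exp a) n = fps_mul (fps_deriv a) (fps_exp a) n.
Proof.
intros H0. unfold fps_deriv at 1, fps_exp at 1.
rewrite <- Csum_scal, Csum_shift.
replace (fps_pow a 0 (S n)) with (RtoC 0) by reflexivity.
transitivity (Csum (fun k => fps_mul (fps_deriv a) (fps_pow a k) n / RtoC (INR (fact k)))%C n).
- replace (RtoC (INR (S n)) * (0 / RtoC (INR (fact 0))))%C with (RtoC 0).
  2:{ unfold Cdiv. ring. }
  rewrite Cplus_0_l. apply Csum_ext. intros k Hk.
  assert (E := fps_deriv_pow a k n). unfold fps_deriv at 1 in E.
  replace (RtoC (INR (S n)) * (fps_pow a (S k) (S n) / RtoC (INR (fact (S k)))))%C with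
   ((RtoC (INR (S n)) * fps_pow a (S k) (S n)) / RtoC (INR (fact (S k))))%C by (unfold Cdiv; ring).
  rewrite E, fact_simpl, mult_INR, RtoC_mult. field.
  split; [apply INR_fact_neq_0_C | apply INR_S_neq_0].
- unfold fps_mul. 
  rewrite (Csum_ext _ (fun k => Csum (fun i => fps_deriv a i * (fps_pow a k (n - i)%nat /
    RtoC (INR (fact k))))%C n)).
  2:{ intros k Hk. unfold Cdiv at 1. rewrite Cmult_comm, <- Csum_scal. apply Csum_ext.
      intros i Hi. unfold Cdiv. ring. }
  rewrite Csum_switch. apply Csum_ext. intros i Hi. rewrite Csum_scal. f_equal.
  (* The power [a^k] has no coefficient below degree [k], so the sum over [k <= n] may be cut to
     [k <= n - i], as the exponential at degree [n - i] prescribes. *)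
  apply Csum_truncate; [lia|]. intros k Hk. rewrite fps_pow_low by (trivial; lia).
  unfold Cdiv. ring.
Qed.

(** In [y' = d y] the coefficient of degree [n + 1] is determined by those of degree at most [n]. *)
Lemma fps_linear_ode_unique d a b : a 0%nat = b 0%nat ->
  (forall n, fps_deriv a n = fps_mul d a n) -> (forall n, fps_deriv b n = fps_mul d b n) ->
  forall n, a n = b n.
Proof.
intros H0 Ha Hb.
assert (W : forall n i, (i <= n)%nat -> a i = b i).
{ induction n as [|n IH]; intros i Hi.
  - replace i with 0%nat by lia. exact H0.
  - destruct (Nat.eq_dec i (S n)) as [->|N]; [|apply IH; lia].
    assert (E : fps_deriv a n = fps_deriv b n).
    { rewrite Ha, Hb. apply fps_mul_ext; auto. }
    unfold fps_deriv in E.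
    transitivity (RtoC (INR (S n)) * a (S n) / RtoC (INR (S n)))%C.
    field. apply INR_S_neq_0. rewrite E. field. apply INR_S_neq_0. }
intros n. apply (W n n). lia.
Qed.

(* The coefficients of [- log(1 - c t)]. *)
Definition fps_log_geom (c : C) (j : nat) : C :=
  match j with O => RtoC 0 | S _ => (c ^ j / RtoC (INR j))%C end.

(* The coefficients of [(1 - c t) b(t)]. *)
Definition fps_sub_shift (c : C) (b : nat -> C) (n : nat) : C :=
  match n with O => b 0%nat | S p => (b (S p) - c * b p)%C end.

(** Formally [(1 - c t) exp (a - log (1 - c t)) = exp a]. The left side is shown to solve
    [y' = a' y] with constant term 1, using [b' = a' + c / (1 - c t)]. *)
Lemma fps_exp_log_geom c a b : a 0%nat = RtoC 0 -> (forall j, b j = a j + fps_log_geom c j)%C ->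
  forall n, fps_sub_shift c (fps_exp b) n = fps_exp a n.
Proof.
intros H0 Hb.
assert (Hb0 : b 0%nat = RtoC 0) by (rewrite Hb, H0; simpl; ring).
assert (Hd : forall i, fps_deriv b i = (fps_deriv a i + c ^ (S i))%C).
{ intros i. unfold fps_deriv. rewrite Hb. unfold fps_log_geom. field. apply INR_S_neq_0. }
apply (fps_linear_ode_unique (fps_deriv a)).
- simpl. rewrite !fps_exp_0. reflexivity.
- intros n.
  assert (E := fun n => fps_exp_deriv b n Hb0).
  set (e := fps_exp b) in *.
  assert (E' : forall n, fps_deriv e n = (fps_mul (fps_deriv a) e n + fps_mul (fun i => c ^ S i)%C e n)%C).
  { intros k. rewrite E. unfold fps_mul. rewrite <- Csum_plus. apply Csum_ext.
    intros i Hi. rewrite Hd. ring. }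
  destruct n as [|n].
  + assert (E0 := E' 0%nat). unfold fps_mul in E0 |- *. rewrite !Csum_0 in E0 |- *. simpl in E0 |- *.
    unfold fps_deriv at 1 in E0. unfold fps_deriv at 1. simpl INR in *. simpl fps_sub_shift.
    transitivity (1 * e 1%nat - c * e 0%nat)%C; [ring|]. rewrite E0, Csum_0. simpl. ring.
  + assert (E1 := E' (S n)). assert (E0 := E' n).
    unfold fps_deriv at 1. unfold fps_deriv at 1 in E1. unfold fps_deriv at 1 in E0.
    unfold fps_sub_shift at 1.
    transitivity (RtoC (INR (S (S n))) * e (S (S n)) - c * e (S n) - c * (RtoC (INR (S n)) * e (S n)))%C.
    { rewrite (S_INR (S n)), RtoC_plus. ring. }
    rewrite E1, E0.
    (* The series [g = c / (1 - c t)] satisfies [g = c + c t g], hence [g e = c e + c t (g e)]. *)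
    assert (G1 : fps_mul (fun i => c ^ S i)%C e (S n) =
      (c * e (S n) + c * fps_mul (fun i => c ^ S i)%C e n)%C).
    { unfold fps_mul. rewrite Csum_shift, <- Csum_scal. f_equal.
      - simpl. ring.
      - apply Csum_ext. intros i Hi. simpl. ring. }
    assert (G2 : fps_mul (fps_deriv a) (fps_sub_shift c e) (S n) =
      (fps_mul (fps_deriv a) e (S n) - c * fps_mul (fps_deriv a) e n)%C).
    { unfold fps_mul. rewrite !(Csum_S _ n), Nat.sub_diag.
      rewrite (Csum_ext _ (fun i => fps_deriv a i * e (S n - i)%nat + - c * (fps_deriv a i * e (n - i)%nat))%C).
      - rewrite Csum_plus, Csum_scal. simpl fps_sub_shift. ring.
      - intros i Hi. replace (S n - i)%nat with (S (n - i)) by lia. simpl fps_sub_shift. ring. }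
    rewrite G1, G2. ring.
- intros n. apply fps_exp_deriv, H0.
Qed.

(** * The Hurwitz zeta function *)


Definition zeta_term (j : nat) (a : C) (k : nat) : C := (1 / (RtoC (INR k) + a) ^ j)%C.

(** For such [k], [|k + a| >= k - |a| >= (k + 1) / 2 >= 1], so the power [j] may be lowered to 2.
    The bound is chosen to telescope. *)
Lemma zeta_term_le j a k : (2 <= j)%nat -> 2 * Cmod a + 1 <= INR k ->
  Cmod (zeta_term j a k) <= 4 / (INR k * (INR k + 1)).
Proof.
intros Hj Hk. assert (Ha := Cmod_ge_0 a).
assert (Hk1 : 1 <= INR k) by lra.
assert (L : (INR k + 1) / 2 <= Cmod (RtoC (INR k) + a)).
{ assert (T := Cmod_triangle (RtoC (INR k) + a) (- a)).
  replace (RtoC (INR k) + a + - a)%C with (RtoC (INR k)) in T by ring.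
  rewrite Cmod_opp, Cmod_R, Rabs_pos_eq in T by lra. lra. }
assert (N : ((RtoC (INR k) + a) ^ j)%C <> 0).
{ apply Cmod_gt_0. rewrite Cmod_pow. apply pow_lt. lra. }
unfold zeta_term. rewrite Cmod_div, Cmod_1, Cmod_pow by trivial.
apply Rle_trans with (1 / ((INR k + 1) / 2) ^ 2).
- apply Rmult_le_compat_l; [lra|]. apply Rinv_le_contravar. apply pow_lt; lra.
  apply Rle_trans with (Cmod (RtoC (INR k) + a) ^ 2).
  apply pow_incr; lra. apply Rle_pow; trivial. lra.
- replace (1 / ((INR k + 1) / 2) ^ 2) with (4 * / ((INR k + 1) * (INR k + 1))) by (field; lra).
  apply Rmult_le_compat_l; [lra|]. apply Rinv_le_contravar; nra.
Qed.

Lemma zeta_partial_cauchy j a m n : (2 <= j)%nat -> 2 * Cmod a + 1 <= INR n -> (n <= m)%nat ->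
  Cmod (Csum (zeta_term j a) m - Csum (zeta_term j a) n) <= 4 * (/ (INR n + 1) - / (INR m + 1)).
Proof.
intros Hj Hn Hm. assert (Ha := Cmod_ge_0 a). induction m as [|m IH].
- replace n with 0%nat in Hn by lia. simpl in Hn. lra.
- destruct (Nat.eq_dec n (S m)) as [->|N].
  + replace (Csum (zeta_term j a) (S m) - Csum (zeta_term j a) (S m))%C with (RtoC 0) by ring.
    rewrite Cmod_0. lra.
  + assert (Hnm : (n <= m)%nat) by lia. specialize (IH Hnm).
    assert (Hm' := le_INR _ _ Hnm).
    rewrite Csum_S.
    assert (T := zeta_term_le j a (S m) Hj ltac:(rewrite S_INR; lra)).
    replace (Csum (zeta_term j a) m + zeta_term j a (S m) - Csum (zeta_term j a) n)%C with
      (Csum (zeta_term j a) m - Csum (zeta_term j a) n + zeta_term j a (S m))%C by ring.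
    eapply Rle_trans. apply Cmod_triangle.
    replace (4 / (INR (S m) * (INR (S m) + 1))) with (4 * (/ (INR m + 1) - / (INR (S m) + 1))) in T.
    lra. rewrite S_INR. field. lra.
Qed.

(** [Hurwitz_zeta] is a definite description, so identifying it with the limit takes both the
    existence and the uniqueness of the sum. *)
Lemma zeta_converges j a : (2 <= j)%nat ->
  tends eventually (fun n => Csum (zeta_term j a) n) (Hurwitz_zeta j a).
Proof.
intros Hj.
assert (I : forall eps, 0 < eps -> eventually (fun n => Rabs (/ (INR n + 1) - 0) < eps)).
{ intros eps He. eapply filter_imp; [|apply (filter_and _ _ (eventually_div_INR_lt 1 eps He) (eventually_INR_ge 1))].
  intros n [H1 H2]. rewrite Rminus_0_r, Rabs_pos_eq by (apply Rlt_le, Rinv_0_lt_compat; lra).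
  eapply Rle_lt_trans; [|exact H1]. unfold Rdiv. rewrite Rmult_1_l. apply Rinv_le_contravar; lra. }
destruct (tends_cauchy eventually (fun n => 2 * Cmod a + 1 <= INR n) (fun n => Csum (zeta_term j a) n)
  (fun n => / (INR n + 1)) 0 4 ltac:(lra) (eventually_INR_ge _)) as [v Hv]; trivial.
{ assert (W : forall x y, (x <= y)%nat -> 2 * Cmod a + 1 <= INR x ->
    Cmod (Csum (zeta_term j a) y - Csum (zeta_term j a) x) <= 4 * Rabs (/ (INR y + 1) - / (INR x + 1))).
  { intros x y L Hx. eapply Rle_trans. apply zeta_partial_cauchy; trivial.
    apply Rmult_le_compat_l; [lra|]. rewrite Rabs_minus_sym. apply Rle_abs. }
  intros x y Hx Hy. destruct (Nat.le_ge_cases x y) as [L|L].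
  - apply W; trivial.
  - replace (Csum (zeta_term j a) y - Csum (zeta_term j a) x)%C with
      (- (Csum (zeta_term j a) x - Csum (zeta_term j a) y))%C by ring.
    rewrite Cmod_opp, Rabs_minus_sym. apply W; trivial. }
assert (S1 : is_series (V := C_NormedModule) (zeta_term j a) v).
{ apply (tends_locally eventually (fun n => Csum (zeta_term j a) n) v). exact Hv. }
replace (Hurwitz_zeta j a) with v; trivial.
symmetry. apply (iota_unique (V := C_CompleteNormedModule)); [|exact S1].
intros y Hy. apply (tends_unique eventually (fun n => Csum (zeta_term j a) n)); trivial.
apply (tends_locally eventually (fun n => Csum (zeta_term j a) n) y). exact Hy.
Qed.

Lemma tends_succ (f : nat -> C) l : tends eventually (fun n => f (S n)) l <-> tends eventually f l.
Proof.
split; intros H eps He; destruct (H eps He) as [N HN].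
- exists (S N). intros [|n] Hn; [lia|]. apply HN. lia.
- exists N. intros n Hn. apply HN. lia.
Qed.

Lemma zeta_succ j a : (2 <= j)%nat -> (Hurwitz_zeta j a = 1 / a ^ j + Hurwitz_zeta j (a + 1))%C.
Proof.
intros Hj.
apply (tends_unique eventually (fun n => Csum (zeta_term j a) (S n))).
- apply (tends_succ (fun n => Csum (zeta_term j a) n)). apply zeta_converges, Hj.
- apply (tends_ext eventually (fun n => 1 / a ^ j + Csum (zeta_term j (a + 1)) n)%C).
  + intros n. rewrite Csum_shift. f_equal.
    * unfold zeta_term. simpl INR. rewrite Cplus_0_l. reflexivity.
    * apply Csum_ext. intros i Hi. unfold zeta_term. rewrite S_INR, RtoC_plus.
      do 2 f_equal. ring.
  + apply tends_plus. apply _. apply tends_const, _. apply zeta_converges, Hj.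
Qed.

(** The value at [a + N + 1] is the remainder after the term [N] of the convergent series at [a]. *)
Lemma zeta_tail j a : (2 <= j)%nat ->
  tends eventually (fun N => Hurwitz_zeta j (a + RtoC (INR N))) 0.
Proof.
intros Hj. apply tends_succ.
apply (tends_ext eventually (fun N => Hurwitz_zeta j a + (-1) * Csum (zeta_term j a) N)%C).
- assert (W : forall N, Hurwitz_zeta j a = (Csum (zeta_term j a) N + Hurwitz_zeta j (a + RtoC (INR (S N))))%C).
  { induction N as [|N IH].
    - rewrite (zeta_succ j a Hj), Csum_0. unfold zeta_term. simpl INR. rewrite Cplus_0_l. reflexivity.
    - rewrite IH, Csum_S, (zeta_succ j (a + RtoC (INR (S N))) Hj).
      rewrite (S_INR (S N)), RtoC_plus, Cplus_assoc. unfold zeta_term.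
      rewrite (Cplus_comm (RtoC (INR (S N))) a). rewrite Cplus_assoc. reflexivity. }
  intros N. rewrite (W N) at 1. ring.
- replace (RtoC 0) with (Hurwitz_zeta j a + (-1) * Hurwitz_zeta j a)%C by ring.
  apply tends_plus. apply _. apply tends_const, _. apply tends_scal. apply _.
  apply zeta_converges, Hj.
Qed.

(** * The formula *)


(* The power series whose exponential generates the [(-1)^n P_n / n!]. *)
Definition log_coef (l m : C) (j : nat) : C :=
  match j with
  | O => RtoC 0
  | S _ => (- (RtoC (INR (fact (j - 1))) * s_arg l m j) / RtoC (INR (fact j)))%C
  end.

Lemma log_coef_S l m j : log_coef l m (S j) = (- s_arg l m (S j) / RtoC (INR (S j)))%C.
Proof.
unfold log_coef. replace (S j - 1)%nat with j by lia.
rewrite fact_simpl, mult_INR, RtoC_mult. field.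
split; [apply INR_S_neq_0 | apply INR_fact_neq_0_C].
Qed.

Lemma Cpow_m1_sqr n : ((-1) ^ n * (-1) ^ n)%C = RtoC 1.
Proof.
induction n as [|n IH]; simpl; [ring|].
replace ((-1) * (-1) ^ n * ((-1) * (-1) ^ n))%C with ((-1) ^ n * (-1) ^ n)%C by ring. exact IH.
Qed.

(** The sign in front of [P] cancels the one inside it, leaving [n!] times a coefficient of an
    exponential series. *)
Lemma log_beta_rhs_fps n l m : log_beta_rhs n l m =
  (RtoC (INR (fact n)) * fps_exp (log_coef l m) n *
   (Gamma (m + 1 - l) * Gamma l / Gamma (m + 1)))%C.
Proof.
unfold log_beta_rhs, P, Bell. change (fps_exp _ n) with (fps_exp (log_coef l m) n).
rewrite Cmult_assoc, Cpow_m1_sqr. ring.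
Qed.

Lemma Cpow_inv (z : C) n : z <> 0 -> ((/ z) ^ n)%C = (1 / z ^ n)%C.
Proof.
intros Hz. induction n as [|n IH]; simpl; [field|].
rewrite IH. field. split; trivial. apply Cpow_nz, Hz.
Qed.

(** The digamma difference [s_1] follows the same pattern as the zeta differences, with first
    powers, so one formula covers all indices. *)
Lemma s_arg_succ_m l m j : ~ nonpos_integer (m + 1)%C -> ~ nonpos_integer (m + 1 - l)%C ->
  s_arg l (m + 1) (S j) = (s_arg l m (S j) + (/ (m + 1 - l)) ^ S j - (/ (m + 1)) ^ S j)%C.
Proof.
intros Hw Ha. unfold s_arg.
replace (m + 1 + 1 - l)%C with (m + 1 - l + 1)%C by ring.
destruct j as [|j].
- simpl Nat.eqb. cbv iota. rewrite !digamma_succ by trivial. simpl. ring.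
- simpl Nat.eqb. cbv iota.
  rewrite (zeta_succ (S (S j)) (m + 1)), (zeta_succ (S (S j)) (m + 1 - l)) by lia.
  rewrite !Cpow_inv by (apply nonpole_neq_0; trivial).
  set (x := (1 / (m + 1) ^ S (S j))%C). set (y := (1 / (m + 1 - l) ^ S (S j))%C). ring.
Qed.

Lemma s_arg_succ_both l m j : ~ nonpos_integer (m + 1)%C ->
  s_arg (l + 1) (m + 1) (S j) = (s_arg l m (S j) - (/ (m + 1)) ^ S j)%C.
Proof.
intros Hw. unfold s_arg.
replace (m + 1 + 1 - (l + 1))%C with (m + 1 - l)%C by ring.
destruct j as [|j].
- simpl Nat.eqb. cbv iota. rewrite !digamma_succ by trivial. simpl. ring.
- simpl Nat.eqb. cbv iota.
  rewrite (zeta_succ (S (S j)) (m + 1)) by lia.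
  rewrite !Cpow_inv by (apply nonpole_neq_0; trivial).
  set (x := (1 / (m + 1) ^ S (S j))%C). ring.
Qed.

(** Removing [- log (1 - t / a)] from the series at [m] leaves the same series [A] as removing
    [- log (1 - t / w)] from the one at [m + 1]; both sides are the coefficients of [exp A]. *)
Lemma fps_exp_succ_m l m n : ~ nonpos_integer (m + 1)%C -> ~ nonpos_integer (m + 1 - l)%C ->
  fps_sub_shift (/ (m + 1)) (fps_exp (log_coef l (m + 1))) n =
  fps_sub_shift (/ (m + 1 - l)) (fps_exp (log_coef l m)) n.
Proof.
intros Hw Ha.
set (A := fun j => (log_coef l m j - fps_log_geom (/ (m + 1 - l)) j)%C).
assert (A0 : A 0%nat = RtoC 0) by (unfold A; simpl; ring).
rewrite (fps_exp_log_geom (/ (m + 1)) A), (fps_exp_log_geom (/ (m + 1 - l)) A); trivial.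
- intros j. unfold A. ring.
- intros [|j]; [unfold A; simpl; ring|].
  unfold A. rewrite !log_coef_S, s_arg_succ_m by trivial. unfold fps_log_geom. 
  field. apply INR_S_neq_0.
Qed.

(** Raising [l] and [m] together leaves [m + 1 - l] fixed, so only the factor [1 - t / w] appears.
    This is the shift that integration by parts performs. *)
Lemma fps_exp_succ_both l m n : ~ nonpos_integer (m + 1)%C ->
  fps_sub_shift (/ (m + 1)) (fps_exp (log_coef (l + 1) (m + 1))) n = fps_exp (log_coef l m) n.
Proof.
intros Hw. apply fps_exp_log_geom; trivial.
intros [|j]; [simpl; ring|].
rewrite !log_coef_S, s_arg_succ_both by trivial. unfold fps_log_geom.
field. apply INR_S_neq_0.
Qed.

Definition norm_moment (l m : C) (n : nat) : C :=
  (log_beta_int n l m / (RtoC (INR (fact n)) * log_beta_int 0 l m))%C.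

(** The recurrence at order [n] divided by the one at order 0, which reads
    [w I_0(l, m + 1) = a I_0(l, m)]. *)
Lemma norm_moment_succ_m l m n : 0 < Re l -> 0 < Re (m + 1 - l)%C ->
  fps_sub_shift (/ (m + 1)) (norm_moment l (m + 1)) n =
  fps_sub_shift (/ (m + 1 - l)) (norm_moment l m) n.
Proof.
intros Hl Ha.
assert (Hw : 0 < Re (m + 1)%C) by (unfold Re in *; simpl in *; lra).
assert (Ha' : 0 < Re (m + 1 + 1 - l)%C) by (unfold Re in *; simpl in *; lra).
assert (N0 := log_beta_int_0_neq_0 l m Hl Ha). assert (N1 := log_beta_int_0_neq_0 l (m + 1) Hl Ha').
assert (Na := nonpole_neq_0 _ (nonpole_Re_pos _ Ha)).
assert (Nw := nonpole_neq_0 _ (nonpole_Re_pos _ Hw)).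
unfold norm_moment. destruct n as [|n]; cbn [fps_sub_shift].
- simpl. field. split; trivial.
- assert (E0 := log_beta_int_succ_m 0 l m Hl Ha). simpl INR in E0.
  assert (E1 := log_beta_int_succ_m (S n) l m Hl Ha).
  replace (S n - 1)%nat with n in E1 by lia.
  assert (F0 := INR_fact_neq_0_C n). assert (FS := INR_S_neq_0 n).
  rewrite (fact_simpl n), mult_INR, RtoC_mult.
  set (w := (m + 1)%C) in *. set (a := (w - l)%C) in *.
  set (X0 := log_beta_int 0 l m) in *. set (X1 := log_beta_int 0 l w) in *.
  set (c := RtoC (INR (S n))) in *. set (f := RtoC (INR (fact n))) in *.
  set (Y0 := log_beta_int (S n) l m) in *. set (Y1 := log_beta_int (S n) l w) in *.
  set (Z0 := log_beta_int n l m) in *. set (Z1 := log_beta_int n l w) in *.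
  assert (E0' : (w * X1 = a * X0)%C) by (rewrite E0; ring).
  transitivity ((w * Y1 - c * Z1) / (c * f * (w * X1)))%C; [field; repeat split; trivial|].
  rewrite E1, E0'. field. repeat split; trivial.
Qed.

Lemma tends_div_0 {T} (F : (T -> Prop) -> Prop) {FF : Filter F} (f g : T -> C) (l : C) :
  l <> 0 -> tends F f 0 -> tends F g l -> tends F (fun x => f x / g x)%C 0.
Proof.
intros Hl Hf Hg eps He. apply Cmod_gt_0 in Hl.
assert (H2 : 0 < Cmod l / 2) by lra.
assert (He2 : 0 < eps * (Cmod l / 2)) by (apply Rmult_lt_0_compat; trivial).
eapply filter_imp; [|apply (filter_and _ _ (Hf _ He2) (Hg _ H2))].
intros x [A B]. cbv beta in *.
assert (T1 := Cmod_triangle (g x) (- (g x - l))).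
replace (g x + - (g x - l))%C with l in T1 by ring. rewrite Cmod_opp in T1.
assert (L : Cmod l / 2 < Cmod (g x)) by lra.
replace (f x - 0)%C with (f x) in A by ring.
replace (f x / g x - 0)%C with (f x / g x)%C by ring.
rewrite Cmod_div by (apply Cmod_gt_0; lra).
apply Rmult_lt_reg_r with (Cmod (g x)); [lra|].
unfold Rdiv at 1. rewrite Rmult_assoc, Rinv_l, Rmult_1_r by lra.
eapply Rlt_trans. exact A. apply Rmult_lt_compat_l; lra.
Qed.

(** The factor [N^l] cancels in the quotient; the denominator's limit [Gamma_integral l] is not
    0. *)
Lemma log_beta_int_ratio_tends_0 n l m : 0 < Re l -> 0 < Re (m + 1 - l)%C ->
  tends eventually (fun N => log_beta_int (S n) l (m + RtoC (INR N)) / log_beta_int 0 l (m + RtoC (INR N)))%C 0.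
Proof.
intros Hl Ha.
apply (tends_ext eventually (fun N => (Cexp (l * RtoC (ln (INR N))) * log_beta_int (S n) l (m + RtoC (INR N))) /
  (Cexp (l * RtoC (ln (INR N))) * log_beta_int 0 l (m + RtoC (INR N))))%C).
- intros N. field. split; [|apply Cexp_neq_0].
  apply log_beta_int_0_neq_0; trivial. assert (K := pos_INR N). unfold Re in *; simpl in *; lra.
- apply (tends_div_0 eventually _ _ (Gamma_integral l)).
  + apply Gamma_integral_neq_0, Hl.
  + apply (log_beta_int_asymptotic (S n)); trivial.
  + apply (log_beta_int_asymptotic 0); trivial.
Qed.

Lemma tends_Csum {T} (F : (T -> Prop) -> Prop) {FF : Filter F} (f : T -> nat -> C) (g : nat -> C) n :
  (forall i, (i <= n)%nat -> tends F (fun x => f x i) (g i)) ->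
  tends F (fun x => Csum (f x) n) (Csum g n).
Proof.
intros H. induction n as [|n IH].
- apply (tends_ext F (fun x => f x 0%nat)). intros x; rewrite Csum_0; reflexivity.
  rewrite Csum_0. apply H. lia.
- apply (tends_ext F (fun x => Csum (f x) n + f x (S n))%C). intros x; rewrite Csum_S; reflexivity.
  rewrite Csum_S. apply tends_plus; trivial. apply IH. intros i Hi. apply H. lia. apply H. lia.
Qed.

Lemma tends_fps_pow {T} (F : (T -> Prop) -> Prop) {FF : Filter F} (a : T -> nat -> C) (b : nat -> C) k n :
  (forall i, tends F (fun x => a x i) (b i)) ->
  tends F (fun x => fps_pow (a x) k n) (fps_pow b k n).
Proof.
intros H. revert n. induction k as [|k IH]; intros n.
- simpl. apply tends_const; trivial.
- simpl. apply tends_Csum; trivial. intros i _. apply tends_mult; trivial.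
Qed.

(** Each coefficient is a polynomial in finitely many coefficients of the argument, so
    coefficientwise convergence is enough. *)
Lemma tends_fps_exp {T} (F : (T -> Prop) -> Prop) {FF : Filter F} (a : T -> nat -> C) (b : nat -> C) n :
  (forall i, tends F (fun x => a x i) (b i)) ->
  tends F (fun x => fps_exp (a x) n) (fps_exp b n).
Proof.
intros H. unfold fps_exp. apply tends_Csum; trivial. intros i _. unfold Cdiv.
apply tends_mult; trivial. apply tends_fps_pow; trivial. apply tends_const; trivial.
Qed.

Lemma fps_exp_zero n : fps_exp (fun _ => RtoC 0) (S n) = RtoC 0.
Proof.
unfold fps_exp. transitivity (Csum (fun _ : nat => RtoC 0) (S n)); [|apply Csum_zero].
apply Csum_ext. intros [|k] _.
- simpl. unfold Cdiv. ring.
- simpl. unfold fps_mul. rewrite (Csum_ext _ (fun _ => RtoC 0)).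
  rewrite Csum_zero. unfold Cdiv. ring. intros i _. apply Cmult_0_l.
Qed.

Lemma log_coef_tail l m j : 0 < Re l -> 0 < Re (m + 1 - l)%C ->
  tends eventually (fun N => log_coef l (m + RtoC (INR N)) j) 0.
Proof.
intros Hl Ha. destruct j as [|j]; [exact (tends_const eventually (RtoC 0))|].
apply (tends_ext eventually (fun N => - / RtoC (INR (S j)) * s_arg l (m + RtoC (INR N)) (S j))%C).
{ intros N. rewrite log_coef_S. unfold Cdiv. ring. }
replace (RtoC 0) with (- / RtoC (INR (S j)) * 0)%C by ring.
apply tends_scal. apply _.
unfold s_arg. destruct j as [|j]; simpl Nat.eqb; cbv iota.
- apply (tends_ext eventually (fun N => (-1) * (log_beta_int 1 l (m + RtoC (INR N)) / log_beta_int 0 l (m + RtoC (INR N))))%C).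
  + intros N. rewrite digamma_diff; trivial. ring.
    assert (K := pos_INR N). unfold Re in *; simpl in *; lra.
  + replace (RtoC 0) with ((-1) * 0)%C by ring. apply tends_scal. apply _.
    apply log_beta_int_ratio_tends_0; trivial.
- apply (tends_ext eventually (fun N => Hurwitz_zeta (S (S j)) (m + 1 + RtoC (INR N)) +
    (-1) * Hurwitz_zeta (S (S j)) (m + 1 - l + RtoC (INR N)))%C).
  + intros N. replace (m + RtoC (INR N) + 1)%C with (m + 1 + RtoC (INR N))%C by ring.
    replace (m + 1 + RtoC (INR N) - l)%C with (m + 1 - l + RtoC (INR N))%C by ring. ring.
  + replace (RtoC 0) with (0 + (-1) * 0)%C by ring. apply tends_plus. apply _.
    apply zeta_tail; lia. apply tends_scal. apply _. apply zeta_tail; lia.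
Qed.

(* Both sides satisfy the same first-order recurrence in [m], and their
   difference vanishes as [m] tends to infinity. *)
Lemma norm_moment_eq n l m : 0 < Re l -> 0 < Re (m + 1 - l)%C ->
  norm_moment l m n = fps_exp (log_coef l m) n.
Proof.
intros Hl. revert m. induction n as [|n IH]; intros m Ha.
- rewrite fps_exp_0. unfold norm_moment. simpl. field.
  apply log_beta_int_0_neq_0; trivial.
- set (D := fun m => (norm_moment l m (S n) - fps_exp (log_coef l m) (S n))%C).
  assert (Hstep : forall m, 0 < Re (m + 1 - l)%C -> D (m + 1)%C = D m).
  { clear m Ha. intros m Ha.
    assert (Hw : 0 < Re (m + 1)%C) by (unfold Re in *; simpl in *; lra).
    assert (Ha' : 0 < Re (m + 1 + 1 - l)%C) by (unfold Re in *; simpl in *; lra).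
    (* At order [n + 1] both recurrences involve order [n], where the two sequences agree at [m] and
       at [m + 1] by induction. These terms cancel and leave [D] invariant under the shift. *)
    assert (E1 := norm_moment_succ_m l m (S n) Hl Ha).
    assert (E2 := fps_exp_succ_m l m (S n) (nonpole_Re_pos _ Hw) (nonpole_Re_pos _ Ha)).
    cbn [fps_sub_shift] in E1, E2. rewrite <- !IH in E2 by trivial.
    unfold D.
    set (x := (/ (m + 1) * norm_moment l (m + 1) n)%C) in *.
    set (y := (/ (m + 1 - l) * norm_moment l m n)%C) in *.
    replace (norm_moment l (m + 1) (S n)) with (norm_moment l (m + 1) (S n) - x + x)%C by ring.
    replace (fps_exp (log_coef l (m + 1)) (S n)) with (fps_exp (log_coef l (m + 1)) (S n) - x + x)%C by ring.
    rewrite E1, E2. ring. }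
  assert (HN : forall N, D (m + RtoC (INR N))%C = D m).
  { induction N as [|N IHN].
    - simpl. f_equal. ring.
    - rewrite <- IHN, <- (Hstep (m + RtoC (INR N))%C).
      rewrite S_INR, RtoC_plus. f_equal; ring.
      assert (K := pos_INR N). unfold Re in *; simpl in *; lra. }
  assert (Z : D m = RtoC 0).
  { apply (tends_unique eventually (fun N => D (m + RtoC (INR N))%C)).
    - apply (tends_ext eventually (fun _ => D m)). intros N; rewrite HN; reflexivity.
      apply tends_const, _.
    - apply (tends_ext eventually (fun N => / RtoC (INR (fact (S n))) *
        (log_beta_int (S n) l (m + RtoC (INR N)) / log_beta_int 0 l (m + RtoC (INR N))) +
        (-1) * fps_exp (log_coef l (m + RtoC (INR N))) (S n))%C).
      + intros N. unfold D, norm_moment. field. split; [|apply INR_fact_neq_0_C].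
        apply log_beta_int_0_neq_0; trivial. assert (K := pos_INR N). unfold Re in *; simpl in *; lra.
      + replace (RtoC 0) with (/ RtoC (INR (fact (S n))) * 0 + (-1) * 0)%C by ring.
        apply tends_plus. apply _. apply tends_scal. apply _. apply log_beta_int_ratio_tends_0; trivial.
        apply tends_scal. apply _. rewrite <- (fps_exp_zero n).
        apply tends_fps_exp. apply _. intros j. apply log_coef_tail; trivial. }
  unfold D in Z.
  transitivity (norm_moment l m (S n) - fps_exp (log_coef l m) (S n) + fps_exp (log_coef l m) (S n))%C; [ring|].
  rewrite Z. ring.
Qed.

Lemma log_beta_int_eq_Re_pos n l m : 0 < Re l -> 0 < Re (m + 1 - l)%C -> log_beta_int n l m = log_beta_rhs n l m.
Proof.
intros Hl Ha. rewrite log_beta_rhs_fps, <- norm_moment_eq by trivial.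
assert (Hw : 0 < Re (m + 1)%C) by (unfold Re in *; simpl in *; lra).
assert (Nw := Gamma_neq_0 _ (nonpole_Re_pos _ Hw)).
rewrite <- log_beta_int_0_Gamma by trivial. unfold norm_moment. field.
repeat split; trivial. apply log_beta_int_0_neq_0; trivial. apply INR_fact_neq_0_C.
Qed.

Lemma log_beta_int_eq n l m : 0 < Re l + INR n -> 0 < Re (m + 1 - l)%C ->
  ~ nonpos_integer l -> ~ nonpos_integer (m + 1)%C -> log_beta_int n l m = log_beta_rhs n l m.
Proof.
(* The number [k] of steps to the right half-plane is separated from the order, because integration
   by parts refers to two different orders at [l + 1]. *)
assert (W : forall k n l m, 0 < Re l + INR k -> 0 < Re l + INR n -> 0 < Re (m + 1 - l)%C ->
  ~ nonpos_integer l -> ~ nonpos_integer (m + 1)%C -> log_beta_int n l m = log_beta_rhs n l m).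
{ clear n l m. induction k as [|k IH]; intros n l m Hk Hn Ha Nl Nw.
  { apply log_beta_int_eq_Re_pos; trivial. simpl in Hk. lra. }
  destruct (Rlt_dec 0 (Re l)) as [Hl|Hl]; [apply log_beta_int_eq_Re_pos; trivial|].
  destruct n as [|n]; [simpl in Hn; lra|].
  rewrite S_INR in Hk, Hn.
  assert (Hk' : 0 < Re (l + 1)%C + INR k) by (unfold Re in *; simpl in *; lra).
  assert (Hn' : 0 < Re (l + 1)%C + INR n) by (unfold Re in *; simpl in *; lra).
  assert (HSn' : 0 < Re (l + 1)%C + INR (S n)) by (rewrite S_INR; lra).
  assert (Ha' : 0 < Re (m + 1 + 1 - (l + 1))%C) by (unfold Re in *; simpl in *; lra).
  assert (Nl' := nonpole_succ l Nl). assert (Nw' := nonpole_succ (m + 1) Nw).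
  assert (Q := log_beta_int_parts (S n) l m ltac:(rewrite S_INR; lra) Ha).
  replace (S n - 1)%nat with n in Q by lia.
  rewrite (IH (S n) _ _ Hk' HSn' Ha' Nl' Nw'), (IH n _ _ Hk' Hn' Ha' Nl' Nw') in Q.
  rewrite !log_beta_rhs_fps in Q. rewrite log_beta_rhs_fps.
  (* This coefficient identity is exactly the combination [w I_(n+1) - (n+1) I_n] on the right of
     the integration by parts, once the Gamma factors are shifted. *)
  assert (E := fps_exp_succ_both l m (S n) Nw). cbn [fps_sub_shift] in E.
  rewrite <- E.
  replace (m + 1 + 1 - (l + 1))%C with (m + 1 - l)%C in Q by ring.
  rewrite (Gamma_succ l Nl), (Gamma_succ (m + 1) Nw) in Q.
  assert (Gw := Gamma_neq_0 _ Nw). assert (Zl := nonpole_neq_0 _ Nl).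
  assert (Zw := nonpole_neq_0 _ Nw).
  transitivity (l * log_beta_int (S n) l m / l)%C; [field; trivial|].
  rewrite Q, fact_simpl, mult_INR, RtoC_mult. field. repeat split; trivial. }
intros Hn. apply (W n); trivial.
Qed.

(** * Necessity of the convergence conditions *)


Lemma cos_ge_half x : Rabs x <= 1 -> / 2 <= cos x.
Proof.
intros H. assert (K := PI2_3_2).
assert (W : forall y, 0 <= y <= 1 -> / 2 <= cos y).
{ intros y Hy. replace (/ 2) with (cos (PI / 3)) by (rewrite cos_PI3; field).
  apply cos_decr_1; lra. }
unfold Rabs in H. destruct (Rcase_abs x).
- rewrite <- cos_neg. apply W. lra.
- apply W. lra.
Qed.

(* The oscillation of the integrand is logarithmic in [t], so over [X, c X] with
   [c] fixed and close to 1 no cancellation can occur. *)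
Lemma log_beta_block_lower_bound n l m : exists c k0, 1 < c /\ 0 < k0 /\
  forall (F : R -> C) X k, 0 < X -> 0 <= k ->
  (forall t, 0 < t -> has_deriv F t (log_beta_integrand n l m t)) ->
  (forall t, X <= t <= c * X ->
    k <= exp (Re l * ln_p t + Re (m + 1 - l)%C * ln_q t) * ln (1 + t) ^ n) ->
  k * k0 <= Cmod (F (c * X) - F X).
Proof.
set (B := Rabs (Im l) + Rabs (Im (m + 1)%C)).
assert (B1 := Rabs_pos (Im l)). assert (B2 := Rabs_pos (Im (m + 1)%C)).
assert (HB : 0 <= B) by (unfold B; lra).
assert (HiB : 0 < / (B + 1)) by (apply Rinv_0_lt_compat; lra).
(* With [ln c = 1 / (B + 1)] the phase varies by at most [B / (B + 1) < 1] over a block, so its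
   cosine stays above [1 / 2]. The other constant is [ln c / 2], the integral of [1 / (2 t)] over
   the block. *)
exists (exp (/ (B + 1))), (/ 2 * / (B + 1)).
set (c := exp (/ (B + 1))).
assert (Hc : 1 < c) by (unfold c; rewrite <- exp_0 at 1; apply exp_increasing; lra).
split; [trivial | split; [lra|]].
intros F X k HX Hk HF Hlow.
assert (HXc : X <= c * X) by nra.
set (theta := fun t => Im l * ln t - Im (m + 1)%C * ln (1 + t)).
(* A rotation by the phase at [X], after which the real part of the integrand is bounded below. *)
set (u := Cexp (0, - theta X)).
assert (Hu : Cmod u = 1) by (unfold u; rewrite Cmod_Cexp; simpl; apply exp_0).
assert (Hth : forall t, X <= t <= c * X -> / 2 <= cos (theta t - theta X)).
{ intros t Ht. apply cos_ge_half. unfold theta.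
  assert (L1 : 0 <= ln t - ln X) by (assert (ln X <= ln t) by (apply ln_le; lra); lra).
  assert (L2 : ln t - ln X <= / (B + 1)).
  { assert (ln t <= ln (c * X)) by (apply ln_le; lra).
    unfold c in H. rewrite ln_mult, ln_exp in H by (try apply exp_pos; lra). lra. }
  assert (L3 : 0 <= ln (1 + t) - ln (1 + X)).
  { assert (ln (1 + X) <= ln (1 + t)) by (apply ln_le; lra). lra. }
  assert (L4 : ln (1 + t) - ln (1 + X) <= ln t - ln X).
  { assert (E : ln ((1 + t) * X) <= ln ((1 + X) * t)) by (apply ln_le; nra).
    rewrite !ln_mult in E by lra. lra. }
  replace (Im l * ln t - Im (m + 1)%C * ln (1 + t) - (Im l * ln X - Im (m + 1)%C * ln (1 + X)))
    with (Im l * (ln t - ln X) + - (Im (m + 1)%C * (ln (1 + t) - ln (1 + X)))) by ring.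
  eapply Rle_trans. apply Rabs_triang.
  rewrite Rabs_Ropp, !Rabs_mult, (Rabs_pos_eq (ln t - ln X)), (Rabs_pos_eq (ln (1 + t) - _)) by lra.
  apply Rle_trans with (B * / (B + 1)).
  - unfold B at 1. rewrite Rmult_plus_distr_r. apply Rplus_le_compat; apply Rmult_le_compat_l; lra.
  - apply Rmult_le_reg_r with (B + 1); [lra|]. rewrite Rmult_assoc, Rinv_l; lra. }
assert (Hre : forall t, X <= t <= c * X -> k / 2 * / t <= Re (u * log_beta_integrand n l m t)%C).
{ intros t Ht. assert (Ht0 : 0 < t) by lra.
  rewrite log_beta_integrand_power_pair by trivial.
  replace (Re (u * _)%C) with (exp (Re l * ln_p t + Re (m + 1 - l)%C * ln_q t) * ln (1 + t) ^ n * / t *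
    cos (theta t - theta X)).
  - assert (A := Hlow t Ht). assert (Cs := Hth t Ht).
    set (a := exp _ * _) in *.
    assert (Hit := Rinv_0_lt_compat t Ht0).
    replace (k / 2 * / t) with (k * / t * / 2) by (field; lra).
    apply Rmult_le_compat; try lra. apply Rmult_le_pos; lra.
    apply Rmult_le_compat_r; lra.
  - unfold u, power_pair. rewrite Cmult_assoc, <- Cexp_plus.
    set (z := ((0, - theta X)%R + (l * RtoC (ln t) + - (m + 1) * RtoC (ln (1 + t))))%C).
    replace (Re l * ln_p t + Re (m + 1 - l)%C * ln_q t) with (Re z).
    2:{ unfold z, ln_p, ln_q, Re; simpl. ring. }
    replace (theta t - theta X) with (Im z).
    2:{ unfold z, theta, Im; simpl. ring. }
    unfold Cexp, Re; simpl. ring. }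
assert (M : - (Re (u * F (c * X)%R)%C - k / 2 * ln (c * X)) <= - (Re (u * F X)%C - k / 2 * ln X)).
{ apply (derive_nonpos_decr (fun t => - (Re (u * F t)%C - k / 2 * ln t))
    (fun t => - (Re (u * log_beta_integrand n l m t)%C - k / 2 * / t)) X (c * X) HXc).
  - intros t Ht. apply (is_derive_opp (K := R_AbsRing) (V := R_NormedModule)).
    apply (is_derive_minus (K := R_AbsRing) (V := R_NormedModule)).
    + destruct (has_deriv_mult _ _ _ _ _ (has_deriv_const u t) (HF t ltac:(lra))) as [A _].
      evar_last; [exact A|]. f_equal. ring.
    + apply (is_derive_scal ln t (k / 2)). apply is_derive_Reals, derivable_pt_lim_ln. lra.
  - intros t Ht. assert (R := Hre t Ht). lra. }
assert (Lc : ln (c * X) = / (B + 1) + ln X).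
{ unfold c. rewrite ln_mult, ln_exp by (try apply exp_pos; lra). reflexivity. }
rewrite Lc in M.
assert (R := Re_le_Cmod (u * (F (c * X)%R - F X))%C).
rewrite Cmod_mult, Hu in R.
replace (Re (u * (F (c * X)%R - F X))%C) with (Re (u * F (c * X)%R)%C - Re (u * F X)%C) in R
  by (unfold Re; simpl; ring).
lra.
Qed.

(** Fixing a point near one end and comparing two points near the other separates the joint
    convergence into a Cauchy condition at each end, for any primitive. *)
Lemma converges_cauchy f F : (forall x, 0 < x -> continuous_C f x) ->
  (forall x, 0 < x -> has_deriv F x (f x)) -> converges_0_infty f ->
  forall eps, 0 < eps -> exists (Q S : R -> Prop),
    at_right 0 Q /\ Rbar_locally p_infty S /\
    (forall x x', Q x -> Q x' -> Cmod (F x - F x') < eps) /\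
    (forall y y', S y -> S y' -> Cmod (F y - F y') < eps).
Proof.
intros Hc HF [v Hv] eps He.
assert (Hd : 0 < eps / (2 * sqrt 2)).
{ apply Rdiv_lt_0_compat; trivial. assert (0 < sqrt 2) by (apply sqrt_lt_R0; lra). lra. }
destruct (Hv (ball (M := C_UniformSpace) v (eps / (2 * sqrt 2)))) as [Q S HQ HS H].
{ exists (mkposreal _ Hd). intros y Hy; exact Hy. }
assert (K : forall x y, Q x /\ 0 < x -> S y /\ 0 < y -> Cmod (F y - F x - v) < eps / 2).
{ intros x y [Qx Px] [Sy Py]. destruct (H x y Qx Sy) as [I [HI HB]]. simpl in HI.
  assert (I2 : is_RInt (V := C_R_NormedModule) f x y (F y - F x)%C).
  { assert (Hm := Rmin_pos x y Px Py). apply is_RInt_of_has_deriv; intros t Ht; [apply HF | apply Hc]; lra. }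
  assert (EI : I = (F y - F x)%C).
  { rewrite <- (is_RInt_unique (V := C_R_CompleteNormedModule) f x y I HI).
    apply (is_RInt_unique (V := C_R_CompleteNormedModule)). exact I2. }
  rewrite EI in HB. assert (T := C_NormedModule_mixin_compat2 _ _ (mkposreal _ Hd) HB).
  simpl in T. assert (0 < sqrt 2) by (apply sqrt_lt_R0; lra).
  replace (sqrt 2 * (eps / (2 * sqrt 2))) with (eps / 2) in T by (field; lra). exact T. }
exists (fun x => Q x /\ 0 < x), (fun y => S y /\ 0 < y).
split; [apply filter_and; [trivial | apply at_right_0_pos]|].
split; [apply filter_and; [trivial | apply p_infty_gt]|].
assert (HS' : Rbar_locally p_infty (fun y => S y /\ 0 < y)) by (apply filter_and; [trivial | apply p_infty_gt]).
assert (HQ' : at_right 0 (fun x => Q x /\ 0 < x)) by (apply filter_and; [trivial | apply at_right_0_pos]).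
split.
- intros x x' Hx Hx'. destruct (filter_ex _ HS') as [y Hy].
  assert (K1 := K x y Hx Hy). assert (K2 := K x' y Hx' Hy).
  replace (F x - F x')%C with (- (F y - F x - v) + (F y - F x' - v))%C by ring.
  eapply Rle_lt_trans. apply Cmod_triangle. rewrite Cmod_opp. lra.
- intros y y' Hy Hy'. destruct (filter_ex _ HQ') as [x Hx].
  assert (K1 := K x y Hx Hy). assert (K2 := K x y' Hx Hy').
  replace (F y - F y')%C with ((F y - F x - v) + - (F y' - F x - v))%C by ring.
  eapply Rle_lt_trans. apply Cmod_triangle. rewrite Cmod_opp. lra.
Qed.

Lemma exp_mult_ge a y r : Rabs y <= r -> exp (- (Rabs a * r)) <= exp (a * y).
Proof.
intros H. apply exp_le.
assert (K := Rle_abs (- (a * y))). rewrite Rabs_Ropp, Rabs_mult in K.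
assert (Rabs a * Rabs y <= Rabs a * r) by (apply Rmult_le_compat_l; [apply Rabs_pos | trivial]).
lra.
Qed.

(** If a condition fails, [t] times the modulus of the integrand stays above a constant near the
    corresponding end, and the block bound contradicts the Cauchy condition. Near 0,
    [ln (1 + t) >= t / (1 + t) = p] reduces this to [p^(Re l + n) >= 1], with [q >= 1 / 2]. At
    infinity, [q^(Re a) >= 1], with [p >= 1 / 2] and [ln (1 + t) >= ln 2]. *)
Lemma log_beta_converges_domain n l m : converges_0_infty (log_beta_integrand n l m) ->
  0 < Re l + INR n /\ 0 < Re (m + 1 - l)%C.
Proof.
intros Hconv.
destruct (continuous_C_primitive _ (continuous_C_log_beta n l m)) as [F HF].
destruct (log_beta_block_lower_bound n l m) as [c [k0 [Hc [Hk0 Hblock]]]].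
assert (L2 : 0 < ln 2) by (rewrite <- ln_1; apply ln_increasing; lra).
split; apply Rnot_le_lt; intros Hneg.
- set (k := exp (- (Rabs (Re (m + 1 - l)%C) * ln 2))).
  assert (Hk : 0 < k) by apply exp_pos.
  destruct (converges_cauchy _ F (continuous_C_log_beta n l m) HF Hconv (k * k0) ltac:(nra))
    as [Q [_ [[d Hd] [_ [HQ _]]]]].
  assert (Hd0 := cond_pos d).
  (* The block [[X, c X]] ends at [min (d / 2, 1)], inside the Cauchy neighbourhood of 0 and where
     [1 + t <= 2]. *)
  set (X := Rmin (d / 2) 1 / c).
  assert (HX0 : 0 < Rmin (d / 2) 1) by (apply Rmin_pos; lra).
  assert (HX : 0 < X) by (apply Rdiv_lt_0_compat; lra).
  assert (HcX : c * X = Rmin (d / 2) 1) by (unfold X; field; lra).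
  assert (M1 := Rmin_l (d / 2) 1). assert (M2 := Rmin_r (d / 2) 1).
  assert (HXc : X <= c * X) by nra.
  assert (HQx : forall t, 0 < t <= c * X -> Q t).
  { intros t Ht. apply Hd; [|lra].
    unfold ball; simpl; unfold AbsRing_ball, abs, minus, plus, opp; simpl.
    rewrite Ropp_0, Rplus_0_r, Rabs_pos_eq; lra. }
  assert (B := Hblock F X k HX (Rlt_le _ _ Hk) HF).
  assert (U : Cmod (F (c * X) - F X) < k * k0) by (apply HQ; apply HQx; lra).
  apply (Rlt_not_le _ _ U), B. intros t Ht.
  assert (Ht0 : 0 < t) by lra.
  assert (P := ln_p_neg t Ht0). assert (Qn := ln_q_neg t Ht0).
  apply Rle_trans with (exp (Re l * ln_p t + Re (m + 1 - l)%C * ln_q t) * exp (INR n * ln_p t)).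
  + rewrite <- exp_plus.
    replace (Re l * ln_p t + Re (m + 1 - l)%C * ln_q t + INR n * ln_p t) with
      ((Re l + INR n) * ln_p t + Re (m + 1 - l)%C * ln_q t) by ring.
    rewrite exp_plus. rewrite <- (Rmult_1_l k). apply Rmult_le_compat; try lra.
    * rewrite <- exp_0. apply exp_le. nra.
    * apply exp_mult_ge. rewrite Rabs_left by trivial. unfold ln_q.
      assert (ln (1 + t) <= ln 2) by (apply ln_le; lra). lra.
  + apply Rmult_le_compat_l. apply Rlt_le, exp_pos.
    assert (G := ln_1p_ge t Ht0).
    replace (exp (INR n * ln_p t)) with ((t / (1 + t)) ^ n).
    * apply pow_incr. split; trivial. apply Rlt_le, Rdiv_lt_0_compat; lra.
    * rewrite <- Rpower_pow by (apply Rdiv_lt_0_compat; lra).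
      unfold Rpower. rewrite ln_div by lra. reflexivity.
- set (k := exp (- (Rabs (Re l) * ln 2)) * ln 2 ^ n).
  assert (Hk : 0 < k) by (apply Rmult_lt_0_compat; [apply exp_pos | apply pow_lt; trivial]).
  destruct (converges_cauchy _ F (continuous_C_log_beta n l m) HF Hconv (k * k0) ltac:(nra))
    as [_ [S [_ [[A HA] [_ HS]]]]].
  set (X := Rmax A 1 + 1).
  assert (M1 := Rmax_l A 1). assert (M2 := Rmax_r A 1).
  assert (HX : 1 < X) by (unfold X; lra).
  assert (HXc : X <= c * X) by nra.
  assert (B := Hblock F X k ltac:(lra) (Rlt_le _ _ Hk) HF).
  assert (HAX : A < X) by (unfold X; lra).
  assert (U : Cmod (F (c * X) - F X) < k * k0) by (apply HS; apply HA; lra).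
  apply (Rlt_not_le _ _ U), B. intros t Ht.
  assert (Ht0 : 0 < t) by lra.
  assert (P := ln_p_neg t Ht0). assert (Qn := ln_q_neg t Ht0).
  apply Rmult_le_compat.
  + apply Rlt_le, exp_pos.
  + apply pow_le. lra.
  + rewrite exp_plus. rewrite <- (Rmult_1_r (exp (- _))). apply Rmult_le_compat; try lra.
    * apply Rlt_le, exp_pos.
    * apply exp_mult_ge. rewrite Rabs_left by trivial. unfold ln_p.
      assert (ln (1 + t) <= ln (2 * t)) by (apply ln_le; lra).
      rewrite ln_mult in H by lra. lra.
    * rewrite <- exp_0 at 1. apply exp_le. nra.
  + apply pow_incr. split; [lra|]. apply ln_le; lra.
Qed.

(** * Continuity of the integral in [(l, m)] *)


Lemma log_beta_perturb n l m l' m' x : 0 < x ->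
  log_beta_integrand n l' m' x = (log_beta_integrand n l m x *
    Cexp ((l' - l) * RtoC (ln x) + - (m' - m) * RtoC (ln (1 + x))))%C.
Proof.
intros Hx. rewrite !log_beta_integrand_power_pair by trivial. unfold power_pair.
replace (l' * RtoC (ln x) + - (m' + 1) * RtoC (ln (1 + x)))%C with
  ((l * RtoC (ln x) + - (m + 1) * RtoC (ln (1 + x))) +
   ((l' - l) * RtoC (ln x) + - (m' - m) * RtoC (ln (1 + x))))%C by ring.
rewrite (Cexp_plus (_ + - (m + 1) * _)). ring.
Qed.

(** The integrand at [(l', m')] is the one at [(l, m)] times [Cexp w] with [|w| <= r * logsize], so
    the margin at the single point [(l, m)] gives a Lipschitz bound there. *)
Lemma log_beta_int_continuous n l m : 0 < Re l + INR n -> 0 < Re (m + 1 - l)%C ->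
  exists d K, 0 < d /\ 0 <= K /\ forall l' m' r,
   0 < Re l' + INR n -> 0 < Re (m' + 1 - l')%C ->
   Cmod (l' - l) <= r -> Cmod (m' - m) <= r -> r <= d ->
   Cmod (log_beta_int n l' m' - log_beta_int n l m) <= r * K.
Proof.
intros Hl Hm.
destruct (log_beta_dominated n l m Hl Hm) as [d [e [K [Hd [He H]]]]].
assert (HK : 0 <= K).
{ assert (B := dominated_weight _ _ _ _ (Rlt_le _ _ Hd) H 1 Rlt_0_1). assert (W := weight_pos e 1 Rlt_0_1).
  assert (H2 := Cmod_ge_0 (log_beta_integrand n l m 1)). nra. }
exists (d / 2), (4 / d * K / e). split; [lra | split].
{ apply Rmult_le_pos; [|apply Rlt_le, Rinv_0_lt_compat, He]. apply Rmult_le_pos; trivial.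
  apply Rlt_le, Rdiv_lt_0_compat; lra. }
intros l' m' r Hl' Hm' Rl Rm Rd.
assert (Hr : 0 <= r) by (eapply Rle_trans; [apply Cmod_ge_0 | exact Rl]).
set (w := fun x => ((l' - l) * RtoC (ln x) + - (m' - m) * RtoC (ln (1 + x)))%C).
replace (r * (4 / d * K / e)) with (r * (4 / d * K) / e) by (field; lra).
apply (has_int_bound (fun x => log_beta_integrand n l m x * (Cexp (w x) - 1))%C); trivial.
- apply (has_int_ext (fun x => log_beta_integrand n l' m' x + (-1) * log_beta_integrand n l m x)%C).
  + intros x Hx. rewrite (log_beta_perturb n l m l' m' x Hx). fold (w x). ring.
  + replace (log_beta_int n l' m' - log_beta_int n l m)%C with (log_beta_int n l' m' + (-1) * log_beta_int n l m)%C by ring.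
    apply has_int_plus; [|apply has_int_scal]; apply log_beta_int_has_int; trivial.
- apply (dominated_perturb_0 _ d e K r w); trivial. lra.
  intros x Hx. unfold w, logsize. assert (L := ln_1p_pos x Hx).
  eapply Rle_trans. apply Cmod_triangle.
  rewrite !Cmod_mult, Cmod_opp, !Cmod_R, (Rabs_pos_eq (ln (1 + x))) by lra.
  rewrite Rmult_plus_distr_l. apply Rplus_le_compat; apply Rmult_le_compat_r; trivial.
  apply Rabs_pos. lra.
Qed.

Lemma locally_C2_close (l m : C) r : 0 < r ->
  locally (T := prod_UniformSpace C_UniformSpace C_UniformSpace) (l, m)
    (fun p => Cmod (fst p - l) < r /\ Cmod (snd p - m) < r).
Proof.
intros Hr.
assert (Hs : 0 < sqrt 2) by (apply sqrt_lt_R0; lra).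
assert (Hd : 0 < r / sqrt 2) by (apply Rdiv_lt_0_compat; trivial).
exists (mkposreal _ Hd). intros [l' m'] [B1 B2]. simpl in B1, B2.
assert (K1 := C_NormedModule_mixin_compat2 l l' (mkposreal _ Hd) B1).
assert (K2 := C_NormedModule_mixin_compat2 m m' (mkposreal _ Hd) B2).
simpl in K1, K2. replace (sqrt 2 * (r / sqrt 2)) with r in K1, K2 by (field; lra).
split; assumption.
Qed.

Theorem theorem1 :
  forall (n : nat) (l m : C),
    converges_0_infty (log_beta_integrand n l m) ->
    (~ nonpos_integer l /\ ~ nonpos_integer (m + 1)%C ->
       integral_0_infty (log_beta_integrand n l m) = log_beta_rhs n l m) /\
    (nonpos_integer l \/ nonpos_integer (m + 1)%C ->
       filterlim (fun p : C * C => log_beta_rhs n (fst p) (snd p))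
         (within (fun p : C * C => rhs_defined (fst p) (snd p))
            (locally (T := prod_UniformSpace C_UniformSpace C_UniformSpace) (l, m)))
         (locally (T := C_UniformSpace)
            (integral_0_infty (log_beta_integrand n l m)))).
Proof.
intros n l m Hconv.
destruct (log_beta_converges_domain n l m Hconv) as [Hl Hm].
split.
- intros [Nl Nw]. exact (log_beta_int_eq n l m Hl Hm Nl Nw).
- intros _. fold (log_beta_int n l m). apply (proj1 (tends_locally _ _ _)).
  destruct (log_beta_int_continuous n l m Hl Hm) as [d [K [Hd [HK Hcont]]]].
  intros eps Heps.
  (* Half of [Re l + n] keeps that quantity positive at [l']. As [m' + 1 - l'] moves by up to [2 r],
     a quarter of [Re (m + 1 - l)] is allowed for it. The last term makes [r * K] smaller than
     [eps]. *)
  set (r := Rmin d (Rmin (Rmin (Re l + INR n) (Re (m + 1 - l)%C / 2)) (eps / (K + 1)) / 2)).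
  assert (R1 : r <= d) by apply Rmin_l.
  assert (Hek : 0 < eps / (K + 1)) by (apply Rdiv_lt_0_compat; lra).
  assert (R0 := Rmin_r d (Rmin (Rmin (Re l + INR n) (Re (m + 1 - l)%C / 2)) (eps / (K + 1)) / 2)).
  fold r in R0.
  assert (R2 := Rmin_l (Rmin (Re l + INR n) (Re (m + 1 - l)%C / 2)) (eps / (K + 1))).
  assert (R3 := Rmin_r (Rmin (Re l + INR n) (Re (m + 1 - l)%C / 2)) (eps / (K + 1))).
  assert (R4 := Rmin_l (Re l + INR n) (Re (m + 1 - l)%C / 2)).
  assert (R5 := Rmin_r (Re l + INR n) (Re (m + 1 - l)%C / 2)).
  assert (Hr : 0 < r).
  { apply Rmin_pos; trivial. apply Rdiv_lt_0_compat; [|lra].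
    repeat apply Rmin_pos; lra. }
  unfold within. eapply filter_imp; [|apply (locally_C2_close l m r Hr)].
  intros [l' m'] [C1 C2] [Nl [Nw _]]. simpl in *.
  assert (S1 := re_le_Cmod (l' - l)). assert (S2 := re_le_Cmod (m' - m)).
  apply Rabs_le_between in S1. apply Rabs_le_between in S2.
  assert (Hl' : 0 < Re l' + INR n) by (unfold Re in *; simpl in *; lra).
  assert (Hm' : 0 < Re (m' + 1 - l')%C) by (unfold Re in *; simpl in *; lra).
  rewrite <- (log_beta_int_eq n l' m') by trivial.
  eapply Rle_lt_trans. apply (Hcont l' m' r); trivial; lra.
  apply Rle_lt_trans with (eps / (K + 1) / 2 * K).
  + apply Rmult_le_compat_r; lra.
  + apply Rmult_lt_reg_r with (2 * (K + 1)); [lra|].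
    replace (eps / (K + 1) / 2 * K * (2 * (K + 1))) with (eps * K) by (field; lra). nra.
Qed.
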